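(* Let $n\ge1$. The set $\{\overline{\mathfrak{Q}}_a\}$ of quasiLascoux polynomials, $a$ ranging over weak compositions of length $n$, is a basis of $\mathrm{Poly}_n[\beta]$ (over $\mathbb{Z}[\beta]$). This basis lifts the quasiGrothendieck basis of $\mathrm{QSym}_n[\beta]$ in that \[ \{\overline{\mathfrak{Q}}_a\}\cap\mathrm{QSym}_n[\beta]=\{\overline{S}_\alpha\}. \] The quasiLascoux polynomials deform the quasikeys, in that specializing $\overline{\mathfrak{Q}}_a$ at $\beta=0$ yields the quasikey $\mathfrak{Q}_a$. Finally, the quasiLascoux polynomials are a refinement of the Lascoux polynomials and are further refined by the glide polynomials and separately by the Lascoux atoms; that is, for every weak composition $a$ of length $n$, \[ \overline{\mathfrak{D}}_a=\sum_b L^a_b\,\overline{\mathfrak{Q}}_b,\qquad \overline{\mathfrak{Q}}_a=\sum_b M^a_b\,\overline{\mathfrak{F}}_b,\qquad\text{and}\qquad \overline{\mathfrak{Q}}_a=\sum_b N^a_b\,\overline{\mathfrak{A}}_b, \] where the (finite) sums are over weak compositions $b$ of length $n$ and each of $L^a_b,M^a_b,N^a_b\in\mathbb{Z}_{\ge0}[\beta]$ is a polynomial in $\beta$ with nonnegative integer coefficients.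
   Context: Fix $n\ge1$; $\beta$ is a formal parameter. $\mathrm{Poly}_n=\mathbb{Z}[x_1,\dots,x_n]$, and $\mathrm{QSym}_n\subset\mathrm{Poly}_n$ denotes the quasisymmetric polynomials. A weak composition of length $n$ is a sequence $a=(a_1,\dots,a_n)$ of nonnegative integers, and $\mathbf{x}^a=x_1^{a_1}\cdots x_n^{a_n}$. The positive part $a^+$ is the composition (finite sequence of positive integers) obtained by deleting all zeros of $a$. For weak compositions $a,b$ of length $n$, $b\ge a$ (dominance) means $b_1+\dots+b_i\ge a_1+\dots+a_i$ for all $1\le i\le n$. Lascoux atoms. The skyline diagram $D(a)$ has $a_i$ left-justified boxes in row $i$; row $1$ is the lowest row. A triple consists of three boxes, two of them adjacent in a row (left box with entry $\beta'$, right box with entry $\alpha'$) and a third box with entry $\gamma'$, such that either (Type A) the third box is above the right box, in the same column as it, and the lower of the two rows is weakly longer, or (Type B) the third box is below the left box, in the same column as it, and the higher of the two rows is strictly longer. A triple is an inversion triple if $\gamma'<\alpha'\le\beta'$ or $\alpha'\le\beta'<\gamma'$. A set-valued filling assigns a nonempty set of positive integers to each box; the maximum of each box is its anchor, all other entries are free. Consider the conditions (S.1) entries do not repeat in a column; (S.2) rows are weakly decreasing from left to right, where $A\ge B$ means $\min A\ge\max B$; (S.3) every triple of anchors is an inversion triple; (S.4) each free entry is in the cell of the least anchor in its column such that (S.2) is not violated (i.e. among the cells of its column with larger anchor in which it could be placed without violating (S.2), it is in the one with least anchor); (S.5) anchors in the first column equal their row index. Let $\overline{\mathfrak{A}}\mathsf{SSF}(a)$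 be the set of set-valued fillings of $D(a)$ satisfying (S.1)--(S.5). For a filling $F$, $\mathrm{wt}(F)=(c_1,\dots,c_n)$ with $c_i$ the number of $i$'s in $F$, and $\mathrm{ex}(F)$ is the number of free entries. The Lascoux atom is $\overline{\mathfrak{A}}_a=\sum_{F\in\overline{\mathfrak{A}}\mathsf{SSF}(a)}\beta^{\mathrm{ex}(F)}\mathbf{x}^{\mathrm{wt}(F)}$. The Demazure atom $\mathfrak{A}_a$ is its specialization at $\beta=0$. QuasiLascoux, quasiGrothendieck, quasikey. $\overline{\mathfrak{Q}}_a=\sum_{b\ge a,\ b^+=a^+}\overline{\mathfrak{A}}_b$. For a composition $\alpha$ with at most $n$ parts (the empty composition allowed), $\overline{S}_\alpha=\overline{S}_\alpha(x_1,\dots,x_n)=\sum_{a^+=\alpha}\overline{\mathfrak{A}}_a$, sum over weak compositions $a$ of length $n$; $\{\overline{S}_\alpha\}$ denotes the set of these. The quasikey polynomial is $\mathfrak{Q}_a=\sum_{b\ge a,\ b^+=a^+}\mathfrak{A}_b$. Lascoux polynomials. Let $\overleftarrow{a}=(a_n,\dots,a_1)$. Augment $D(\overleftarrow{a})$ on the left with a column $0$ (the basement) having one box in each of the rows $1,\dots,n$, with the fixed single entry $b_i=n-i+1$ in row $i$. Let $\overline{\mathfrak{D}}\mathsf{SSF}(a)$ be the set of set-valued fillings of $D(\overleftarrow{a})$ which, including the basement, satisfy (S.1)--(S.4) (not (S.5)). Basement entries do not count towards weight. The Lascoux polynomial is $\overline{\mathfrak{D}}_a=\sum_{F\in\overline{\mathfrak{D}}\mathsf{SSF}(a)}\beta^{\mathrm{ex}(F)}\mathbf{x}^{\mathrm{wt}(F)}$.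 Glide polynomials. A weak komposition is a weak composition whose positive entries are each colored black or red (different colorings are different weak kompositions); its excess $\mathrm{ex}$ is the number of red entries. Let $a$ have nonzero entries exactly in positions $n_1<\dots<n_\ell$. A weak komposition $b$ of length $n$ is a glide of $a$ if there exist integers $0=i_0<i_1<\dots<i_\ell$ such that $b_k=0$ for $k>i_\ell$ and, for each $1\le j\le\ell$: $a_{n_j}=b_{i_{j-1}+1}+\dots+b_{i_j}-\mathrm{ex}(b_{i_{j-1}+1},\dots,b_{i_j})$; $i_j\le n_j$; and the leftmost nonzero entry among $b_{i_{j-1}+1},\dots,b_{i_j}$ is black. The glide polynomial is $\overline{\mathfrak{F}}_a=\sum_b\beta^{\mathrm{ex}(b)}\mathbf{x}^b$ over all glides $b$ of $a$. *)

(* Defs.v *)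
From HB Require Import structures.
From mathcomp Require Import all_boot all_order all_algebra.
From mathcomp Require Import mpoly.

Set Implicit Arguments.
Unset Strict Implicit.
Unset Printing Implicit Defensive.

Import Order.TTheory GRing.Theory Num.Theory.

Local Open Scope ring_scope.

(* Conventions.
   - Poly_n[beta] is {mpoly {poly int}[n]}: the coefficient ring Z[beta] is
     {poly int}, and beta is its variable 'X.
   - A weak composition of length n is an exponent vector a : 'X_{1..n}.
   - Rows, variables and entries of fillings are numbered from 0: the ordinal
     i : 'I_n stands for the integer i + 1.  Columns are numbered from 0 as
     well; when there is a basement, it is column 0.                          *)

Section Bases.

Variables (R : nzRingType) (V : lmodType R) (I : eqType).

(* The family v is an R-basis of the submodule P of V. *)
Definition is_basis (P : V -> Prop) (v : I -> V) : Prop :=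
  [/\ forall i, P (v i),
      forall (s : seq I) (c : I -> R), uniq s ->
        \sum_(i <- s) c i *: v i = 0 -> {in s, forall i, c i = 0}
    & forall p, P p ->
        exists (s : seq I) (c : I -> R), p = \sum_(i <- s) c i *: v i].

End Bases.

(* The family w expands in the family v with finitely many nonzero
   coefficients, all of them in Z_{>=0}[beta]. *)
Definition refines n (I J : eqType)
    (w : I -> {mpoly {poly int}[n]}) (v : J -> {mpoly {poly int}[n]}) : Prop :=
  forall a, exists (s : seq J) (c : J -> {poly int}),
    [/\ uniq s, forall b, c b \is a polyOver Num.nneg
      & w a = \sum_(b <- s) c b *: v b].

Section WeakCompositions.

Variable n : nat.
Implicit Types a b : 'X_{1..n}.

Definition pos_part a : seq nat := [seq k <- a | 0 < k]%N.

Definition dominates b a : bool :=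
  [forall k : 'I_n,
     (\sum_(i < n | i <= k) a i <= \sum_(i < n | i <= k) b i)%N].

Definition is_comp (alpha : seq nat) : bool :=
  all (leq 1) alpha && (size alpha <= n)%N.

(* f is quasisymmetric when the coefficients of x_{i_1}^{k_1}...x_{i_l}^{k_l}
   and x_{j_1}^{k_1}...x_{j_l}^{k_l} agree for all i_1 < ... < i_l,
   j_1 < ... < j_l and all positive k_1, ..., k_l. *)
Definition quasisymmetric (R : nzRingType) (f : {mpoly R[n]}) : Prop :=
  forall a b, pos_part a = pos_part b -> f@_a = f@_b.

End WeakCompositions.

Section Fillings.

Variable n : nat.

(* A diagram with n left-justified rows is given by its row lengths. *)
Definition box (s : 'I_n -> nat) : finType := {i : 'I_n & 'I_(s i)}.

Definition box_row s (u : box s) : 'I_n := tag u.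
Definition box_col s (u : box s) : nat := tagged u.

(* In every filling considered below, all entries are at most n, by (S.2)
   together with (S.5), or together with the basement; hence entries are taken
   in 'I_n from the outset. *)
Definition filling (s : 'I_n -> nat) : finType := {ffun box s -> {set 'I_n}}.

Section Conditions.

Variables (s : 'I_n -> nat) (F : filling s).
Implicit Types u v w : box s.

Definition anchor u : nat := \max_(e in F u) e.

Definition free_entries u : {set 'I_n} := [set e in F u | e != anchor u :> nat].

Definition nonempty_boxes : bool := [forall u, F u != set0].

Definition S1 : bool :=
  [forall u, forall v,
     (u != v) && (box_col u == box_col v) ==> [disjoint F u & F v]].

Definition S2 : bool :=
  [forall u, forall v, (box_row u == box_row v) && (box_col u < box_col v)%N ==>
     [forall x in F u, forall y in F v, (y <= x)%N]].

(* u is the left box, v the right box, w the third box. *)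
Definition type_A u v w : bool :=
  [&& box_row u == box_row v, box_col v == (box_col u).+1, (box_row v < box_row w)%N,
      box_col w == box_col v & (s (box_row w) <= s (box_row v))%N].

Definition type_B u v w : bool :=
  [&& box_row u == box_row v, box_col v == (box_col u).+1, (box_row w < box_row u)%N,
      box_col w == box_col u & (s (box_row w) < s (box_row u))%N].

Definition inversion (be al ga : nat) : bool :=
  ((ga < al <= be) || (al <= be < ga))%N.

Definition S3 : bool :=
  [forall u, forall v, forall w,
     type_A u v w || type_B u v w ==>
       inversion (anchor u) (anchor v) (anchor w)].

(* Adding the entry e to the box v does not violate (S.2). *)
Definition can_hold (e : 'I_n) v : bool :=
  [forall w, (box_row w == box_row v) ==>
     ((box_col w < box_col v)%N ==> [forall x in F w, (e <= x)%N]) &&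
     ((box_col v < box_col w)%N ==> [forall y in F w, (y <= e)%N])].

Definition S4 : bool :=
  [forall u, forall e in free_entries u, forall v,
     [&& box_col v == box_col u, (e < anchor v)%N & can_hold e v] ==>
       (anchor u <= anchor v)%N].

Definition S5 : bool := [forall u, (box_col u == 0%N) ==> (anchor u == box_row u)].

Definition wt : 'X_{1..n} := [multinom #|[set u | i \in F u]| | i < n].

Definition excess : nat := (\sum_u #|free_entries u|)%N.

End Conditions.

(* The filling with a basement added on the left; the entry n - i + 1 of the
   i-th row of the basement is rev_ord after renumbering from 0. *)
Definition augment s (F : filling s) : filling (fun i => (s i).+1) :=
  [ffun u => if unlift ord0 (tagged u) is Some j
             then F (Tagged (fun i => 'I_(s i)) j) else [set rev_ord (tag u)]].

Definition atomSSF (a : 'X_{1..n}) (F : filling a) : bool :=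
  [&& nonempty_boxes F, S1 F, S2 F, S3 F, S4 F & S5 F].

Definition rev_shape (a : 'X_{1..n}) : 'I_n -> nat := fun i => a (rev_ord i).

Definition lascouxSSF (a : 'X_{1..n}) (F : filling (rev_shape a)) : bool :=
  let G := augment F in [&& nonempty_boxes G, S1 G, S2 G, S3 G & S4 G].

End Fillings.

Section Glides.

Variable n : nat.

(* A weak komposition is a pair (b, red), where red is the set of positions of
   the red entries. *)
Definition is_kompo (b : 'X_{1..n}) (red : {set 'I_n}) : bool :=
  [forall k in red, (0 < b k)%N].

Definition nz_positions (a : 'X_{1..n}) : seq 'I_n :=
  [seq k <- enum 'I_n | (0 < a k)%N].

(* The positions i_{j-1} + 1, ..., i_j (counted from 1) are the ordinals k with
   i_{j-1} <= k < i_j.  The integers i_j can be taken in 'I_n.+1, as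
   i_j <= n_j <= n. *)
Definition glide (a b : 'X_{1..n}) (red : {set 'I_n}) : bool :=
  let l := size (nz_positions a) in
  is_kompo b red &&
  [exists i : {ffun 'I_l.+1 -> 'I_n.+1},
     [&& i ord0 == 0%N :> nat,
         [forall k : 'I_n, (i ord_max <= k)%N ==> (b k == 0%N)]
       & [forall j : 'I_l,
            let lo := i (widen_ord (leqnSn l) j) in
            let hi := i (lift ord0 j) in
            let nj := tnth (in_tuple (nz_positions a)) j in
            let B := [set k : 'I_n | (lo <= k < hi)%N] in
            [&& (lo < hi)%N,
                ((\sum_(k in B) b k)%N == a nj + #|red :&: B|)%N,
                (hi <= nj.+1)%N
              & [forall k in B,
                   (0 < b k)%N && [forall k' in B, (k' < k)%N ==> (b k' == 0%N)]
                     ==> (k \notin red)]]]]].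

End Glides.

Section Polynomials.

Variable n : nat.
Implicit Types a b : 'X_{1..n}.

Definition lascoux_atom a : {mpoly {poly int}[n]} :=
  \sum_(F : filling a | atomSSF F) ('X ^+ excess F : {poly int}) *: 'X_[wt F].

(* The weight and the number of free entries of F ignore the basement. *)
Definition lascoux a : {mpoly {poly int}[n]} :=
  \sum_(F : filling (rev_shape a) | lascouxSSF F)
    ('X ^+ excess F : {poly int}) *: 'X_[wt F].

(* b^+ = a^+ forces mdeg b = mdeg a, hence the finite range of summation; for
   the same reason b^+ = alpha forces mdeg b = sumn alpha below. *)
Definition quasi_lascoux a : {mpoly {poly int}[n]} :=
  \sum_(b : 'X_{1..n < (mdeg a).+1} | dominates b a && (pos_part b == pos_part a))
    lascoux_atom b.

Definition quasi_grothendieck (alpha : seq nat) : {mpoly {poly int}[n]} :=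
  \sum_(b : 'X_{1..n < (sumn alpha).+1} | pos_part b == alpha) lascoux_atom b.

Definition beta0 (f : {mpoly {poly int}[n]}) : {mpoly int[n]} :=
  map_mpoly (horner_eval 0) f.

Definition demazure_atom a : {mpoly int[n]} := beta0 (lascoux_atom a).

Definition quasikey a : {mpoly int[n]} :=
  \sum_(b : 'X_{1..n < (mdeg a).+1} | dominates b a && (pos_part b == pos_part a))
    demazure_atom b.

(* A glide b of a has total size mdeg a + #|red|, hence at most mdeg a + n. *)
Definition glide_poly a : {mpoly {poly int}[n]} :=
  \sum_(b : 'X_{1..n < (mdeg a + n).+1}) \sum_(red : {set 'I_n} | glide a b red)
    ('X ^+ #|red| : {poly int}) *: 'X_[b].

End Polynomials.

(* Main.v *)
(* Read the entries of a set-valued filling from the largest to the smallest,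
   entries of the same value being read from left to right: one gets a word
   whose letters carry a column and a mark telling anchors from free entries.
   The only thing to remember while reading is the vector of lengths of the rows
   of anchors: an anchor of column c lengthens a row of length c, and a free
   entry of column c is allowed as soon as some row has length c + 1.  For a
   Lascoux atom the anchor goes to the lowest possible row.  For a Lascoux
   polynomial the same word, read from the smallest entry, empties the shape a,
   always from the first possible row.  Comparing the two processes letter by
   letter shows that the Lascoux polynomial of a is the sum of the atoms of all
   b whose key is below that of a; among those with a given positive part there
   is a least one in dominance order, hence a sum of quasiLascoux polynomials.

   The composition b^+ depends only on the columns and marks of the word, not on
   its values, whence quasisymmetry.  Fixing the columns and marks after merging
   the letters that share a box, the values vary exactly as in a glide
   polynomial.  The two bases follow from unitriangularity with respect to
   dominance. *)
Require Import Defs.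
From HB Require Import structures.
From mathcomp Require Import all_boot all_order all_algebra.
From mathcomp Require Import mpoly zify.

Set Implicit Arguments.
Unset Strict Implicit.
Unset Printing Implicit Defensive.

Import Order.TTheory GRing.Theory Num.Theory.

Local Open Scope ring_scope.

(** * Words *)

(** The obstacle is (S.3): a triple compares two rows through their lengths in the final shape,
    which is unknown while a word is being read. It is replaced by a condition on the state in which
    a single anchor arrives; this equivalence, [insertionP] for atoms and [augment_local] with a
    basement, is proved by induction along the rows. Words carry no row labels: the rows of the
    anchors are recovered from the choice rule, forwards for [insertion] and backwards from the
    final state for [removal], and the rows of the free letters from (S.4). A filling is then the
    same thing as its word, each sum over fillings is the generating function of a set of words, and
    an identity between such sums reduces to an equivalence of predicates on words. The two
    processes are compared only through the counting functions [cnt]. For a fixed positive part all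
    of these are governed by the one that counts nonempty rows, which turns dominance, key
    comparison and the bounds of glides into inequalities between counting functions. *)

Section Words.

Variable n : nat.

Local Notation letter := ('I_n * (nat * bool))%type.
Local Notation state := 'X_{1..n}.

(* The letter (v, (c, mk)) is an entry v of column c, an anchor if mk holds.
   Equal entries are ordered from right to left, so that the anchors of a row
   decrease strictly. *)
Definition ltl (l l' : letter) : bool :=
  (l.1 < l'.1)%N || ((l.1 == l'.1) && (l'.2.1 < l.2.1)%N).

Lemma ltl_trans : transitive ltl.
Proof.
move=> [[y hy] [cy my]] [[x hx] [cx mx]] [[z hz] [cz mz]].
rewrite /ltl -!val_eqE /=; lia.
Qed.

Lemma ltl_irr : irreflexive ltl.
Proof. by move=> [x [c m]]; rewrite /ltl /= !ltnn andbF. Qed.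

(** [ch b v c p] allows the anchor [v] of column [c] to lengthen row [p] when the row lengths are
    [b]. Atoms and Lascoux polynomials differ only in this rule. *)
Definition choice_rule := state -> 'I_n -> nat -> 'I_n -> bool.

(* Letters are read from the end of the word; the state lists the lengths of the
   rows of anchors.  A row of length c + 1 is exactly one whose box in column c
   can receive the free letter (v, c) without violating (S.2). *)
Inductive run (ch : choice_rule) : seq letter -> state -> Prop :=
| run_nil : run ch [::] 0%MM
| run_anchor v c p X b : run ch X b -> b p = c -> ch b v c p ->
    run ch ((v, (c, true)) :: X) (b + U_(p))%MM
| run_free v c p X b : run ch X b -> b p = c.+1 ->
    run ch ((v, (c, false)) :: X) b.

Local Notation zletter := (letter * 'I_n)%type.

(* The words of [run] where each letter also records its row; the last premise
   of [zrun_free] is (S.4). *)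
Inductive zrun (ch : choice_rule) : seq zletter -> state -> Prop :=
| zrun_nil : zrun ch [::] 0%MM
| zrun_anchor v c p Z b : zrun ch Z b -> b p = c -> ch b v c p ->
    zrun ch ((v, (c, true), p) :: Z) (b + U_(p))%MM
| zrun_free v c p Z b : zrun ch Z b -> b p = c.+1 ->
    (forall r v1 v2, b r = c.+1 -> (v1, (c, true), p) \in Z ->
       (v2, (c, true), r) \in Z -> (v1 <= v2)%N) ->
    zrun ch ((v, (c, false), p) :: Z) b.

Definition ltz : rel zletter := fun z z' => ltl z.1 z'.1.

Lemma ltz_trans : transitive ltz.
Proof. by move=> y x z; apply: ltl_trans. Qed.

Lemma ltz_irr : irreflexive ltz.
Proof. by move=> z; apply: ltl_irr. Qed.

Lemma sorted_ltz Z : sorted ltz Z = sorted ltl (map fst Z).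
Proof. by rewrite sorted_map. Qed.

Lemma sorted_cons_ltz z Z : sorted ltz (z :: Z) ->
  sorted ltz Z /\ {in Z, forall z', ltz z z'}.
Proof.
move=> h; split; first exact: path_sorted h.
by move: h => /= /(order_path_min ltz_trans)/allP.
Qed.

(** This is (S.1) for words: the order is strict on pairs of a value and a column, so a sorted word
    cannot repeat such a pair. *)
Lemma sorted_ltz_inj Z z z' : sorted ltz Z -> z \in Z -> z' \in Z ->
  z.1.1 = z'.1.1 -> z.1.2.1 = z'.1.2.1 -> z = z'.
Proof.
move=> sZ zZ zZ' ev ec.
have N : forall a b : zletter, a.1.1 = b.1.1 -> a.1.2.1 = b.1.2.1 -> ltz a b = false.
  by move=> a b e1 e2; rewrite /ltz /ltl e1 e2 !ltnn andbF.
elim: Z sZ zZ zZ' => // y Z IH /sorted_cons_ltz[sZ mZ].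
rewrite !inE => /orP[/eqP zy|zZ] /orP[/eqP zy'|zZ']; first by rewrite zy zy'.
- by move: (mZ _ zZ'); rewrite -zy (N z z').
- by move: (mZ _ zZ); rewrite -zy' (N z' z).
- exact: IH.
Qed.

Definition hasA (Z : seq zletter) r j :=
  has (fun z : zletter => [&& z.1.2.2, z.2 == r & z.1.2.1 == j]) Z.

Lemma hasAP Z r j : reflect (exists v, (v, (j, true), r) \in Z) (hasA Z r j).
Proof.
apply: (iffP hasP) => [[[[v [c mk]] p] zZ /= /and3P[hm /eqP <- /eqP <-]]|[v vZ]].
  by exists v; rewrite hm in zZ.
by exists (v, (j, true), r) => //=; rewrite !eqxx.
Qed.

(** Field by field: the anchors fill the diagram of [b], every other entry of a box is below its
    anchor, a box has one anchor, and (S.2) holds. *)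
Record zinv (Z : seq zletter) (b : state) : Prop := {
  zi_has : forall r j, hasA Z r j = (j < b r)%N;
  zi_anc : forall v c mk p, (v, (c, mk), p) \in Z ->
     exists2 v', (v', (c, true), p) \in Z &
        if mk then v = v' else (v < v')%N;
  zi_uni : forall v v' c p, (v, (c, true), p) \in Z ->
     (v', (c, true), p) \in Z -> v = v';
  zi_row : forall v v' c c' mk mk' p, (v, (c, mk), p) \in Z ->
     (v', (c', mk'), p) \in Z -> (c < c')%N -> (v' <= v)%N }.

Lemma zinv_col Z b v c mk p : zinv Z b -> (v, (c, mk), p) \in Z -> (c < b p)%N.
Proof.
move=> i /(zi_anc i)[v' vZ _]; rewrite -(zi_has i).
by apply/hasAP; exists v'.
Qed.

(** The new letter is at most every letter already read and goes to the last box of its row or just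
    after it, so (S.2) is a mere comparison of values. A free letter shares the column of its
    anchor, and there [ltl] is strict in the value. *)
Lemma zrun_inv ch Z b : sorted ltz Z -> zrun ch Z b -> zinv Z b.
Proof.
move=> sZ rZ; elim: rZ sZ => [|v c p {}Z {}b rZ IH bp chb|v c p {}Z {}b rZ IH bp mn].
- by move=> _; split=> // r j; rewrite mnm0E.
- move=> /sorted_cons_ltz[sZ mZ]; have i := IH sZ.
  have H (v1 : 'I_n) c1 mk1 : (v1, (c1, mk1), p) \in Z -> (c1 < c)%N.
    by move/(zinv_col i); rewrite bp.
  split.
  + move=> r j /=; rewrite -/(hasA Z r j) (zi_has i) mnmDE mnm1E.
    case: (eqVneq p r) => [<-|_] /=; last by rewrite addn0.
    by rewrite bp addn1 ltnS (leq_eqVlt j) (eq_sym c).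
  + move=> v1 c1 mk p1; rewrite inE => /orP[/eqP[-> -> -> ->]|].
      by exists v => //; rewrite inE eqxx.
    by move/(zi_anc i)=> [v' vZ e]; exists v' => //; rewrite inE vZ orbT.
  + move=> v1 v2 c1 p1; rewrite !inE => /orP[/eqP[-> -> ->]|h1] /orP[/eqP[]|h2].
    * by move=> ->.
    * by have := H _ _ _ h2; rewrite ltnn.
    * by move=> _ e1 e2; rewrite e1 e2 in h1; have := H _ _ _ h1; rewrite ltnn.
    * exact: (zi_uni i) h1 h2.
  + move=> v1 v2 c1 c2 mk1 mk2 p1.
    rewrite !inE => /orP[/eqP[-> -> _ ->]|h1] /orP[/eqP[]|h2].
    * by move=> _ ->; rewrite ltnn.
    * by move=> lt; have := H _ _ _ h2; lia.
    * move=> -> -> _ ep _; move: (mZ _ h1); rewrite ep in h1; move: (H _ _ _ h1).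
      by rewrite /ltz /ltl /= -val_eqE /=; lia.
    * exact: (zi_row i) h1 h2.
- move=> /sorted_cons_ltz[sZ mZ]; have i := IH sZ.
  have H (v1 : 'I_n) c1 mk1 : (v1, (c1, mk1), p) \in Z -> (c1 <= c)%N.
    by move/(zinv_col i); rewrite bp.
  have hp : hasA Z p c by rewrite (zi_has i) bp.
  split.
  + by move=> r j /=; rewrite -/(hasA Z r j) (zi_has i).
  + move=> v1 c1 mk p1; rewrite inE => /orP[/eqP[-> -> -> ->]|].
      case/hasAP: hp => v' vZ; exists v'; first by rewrite inE vZ orbT.
      by move: (mZ _ vZ); rewrite /ltz /ltl /= ltnn andbF orbF.
    by move/(zi_anc i)=> [v' vZ e]; exists v' => //; rewrite inE vZ orbT.
  + move=> v1 v2 c1 p1; rewrite !inE !xpair_eqE !andbF /=; exact: (zi_uni i).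
  + move=> v1 v2 c1 c2 mk1 mk2 p1.
    rewrite !inE => /orP[/eqP[-> -> _ ->]|h1] /orP[/eqP[]|h2].
    * by move=> _ ->; rewrite ltnn.
    * by move=> lt; have := H _ _ _ h2; lia.
    * move=> -> -> _ ep lt; move: (mZ _ h1); rewrite ep in h1; move: (H _ _ _ h1).
      by rewrite /ltz /ltl /= -val_eqE /=; lia.
    * exact: (zi_row i) h1 h2.
Qed.

Lemma zrun_suffix ch Z1 Z2 b : zrun ch (Z1 ++ Z2) b -> exists b', zrun ch Z2 b'.
Proof.
elim: Z1 b => [|z Z1 IH] b /=; first by exists b.
by move=> h; inversion h; subst; apply: IH; eassumption.
Qed.

Lemma zrun_run ch Z b : zrun ch Z b -> run ch (map fst Z) b.
Proof.
elim=> [|v c p {}Z {}b _ IH bp chb|v c p {}Z {}b _ IH bp _] /=.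
- exact: run_nil.
- exact: run_anchor.
- exact: run_free IH bp.
Qed.

Lemma run_zrun ch X b : sorted ltl X -> run ch X b ->
  exists2 Z, zrun ch Z b & map fst Z = X.
Proof.
move=> sX rX; elim: rX sX => [|v c p {}X {}b _ IH bp chb|v c p {}X {}b _ IH bp] /=.
- by exists [::] => //; apply: zrun_nil.
- move=> /path_sorted/IH[Z rZ eZ].
  by exists ((v, (c, true), p) :: Z); [apply: zrun_anchor | rewrite /= eZ].
- move=> h; have sX := path_sorted h; have [Z rZ eZ] := IH sX.
  have sZ : sorted ltz Z by rewrite sorted_ltz eZ.
  have i := zrun_inv sZ rZ.
  have A r : b r = c.+1 -> {v' : 'I_n | (v', (c, true), r) \in Z}.
    move=> br; apply/sigW/hasAP; by rewrite (zi_has i) br.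
  (* [f r] is the anchor of row [r] in column [c]; among the rows of length [c.+1], the one that
     minimizes it is the row prescribed by (S.4). The default [v] is never reached on those rows. *)
  pose f r := odflt v [pick v' : 'I_n | (v', (c, true), r) \in Z].
  have [q bq mq] := arg_minnP (fun r => f r : nat) (P := fun r => b r == c.+1) (i0 := p) (introT eqP bp).
  have fE r v1 : (v1, (c, true), r) \in Z -> f r = v1.
    move=> h1; rewrite /f; case: pickP => [v' h'|/(_ v1)]; last by rewrite h1.
    exact: (zi_uni i) h' h1.
  exists ((v, (c, false), q) :: Z); last by rewrite /= eZ.
  apply: zrun_free => //; first exact/eqP.
  move=> r v1 v2 br /fE <- /fE <-; apply: mq; exact/eqP.
Qed.

Definition mon (X : seq letter) : state :=
  [multinom count (fun l : letter => l.1 == i) X | i < n].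

Definition wgt (X : seq letter) : {mpoly {poly int}[n]} :=
  ('X ^+ count (fun l : letter => ~~ l.2.2) X : {poly int}) *: 'X_[mon X].

(** The columns of letters are unbounded, so words do not form a finite type. The existential
    duplicate-free list makes [f] the sum over all words satisfying [P], and [P] alone determines
    it. *)
Definition gf (P : seq letter -> Prop) (f : {mpoly {poly int}[n]}) :=
  exists2 l : seq (seq letter), uniq l & (forall X, X \in l <-> P X) /\
     f = \sum_(X <- l) wgt X.

Lemma gf_eq P Q f g : gf P f -> gf Q g -> (forall X, P X <-> Q X) -> f = g.
Proof.
move=> [l ul [hl ->]] [l' ul' [hl' ->]] h; apply: perm_big.
apply: uniq_perm => // X; apply/idP/idP.
  by move/hl/h/hl'.
by move/hl'/h/hl.
Qed.

End Words.

(** * Fillings and words *)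

Section Fillings.

Variable n : nat.

Local Notation letter := ('I_n * (nat * bool))%type.
Local Notation zletter := (letter * 'I_n)%type.
Local Notation state := 'X_{1..n}.

Section Shape.

Variable s : 'I_n -> nat.

(** A total function of row and column, empty outside the shape, avoids transport along the
    dependent type of boxes. *)
Definition entries (F : filling s) (r : 'I_n) (j : nat) : {set 'I_n} :=
  if insub j is Some k then F (@Tagged _ r (fun i => 'I_(s i)) k) else set0.

Lemma entriesE F (u : box s) : entries F (box_row u) (box_col u) = F u.
Proof. by case: u => r k; rewrite /entries /box_row /box_col /= valK. Qed.

Lemma box_exists r j : (j < s r)%N -> exists u : box s, box_row u = r /\ box_col u = j.
Proof. by move=> h; exists (Tagged (fun i => 'I_(s i)) (Ordinal h)). Qed.

Lemma entries_out F r j : (s r <= j)%N -> entries F r j = set0.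
Proof. by move=> h; rewrite /entries insubF // ltnNge h. Qed.

Lemma box_col_lt (u : box s) : (box_col u < s (box_row u))%N.
Proof. by case: u => r k; rewrite /box_col /box_row /=. Qed.

Lemma box_inj (u v : box s) : box_row u = box_row v -> box_col u = box_col v -> u = v.
Proof.
case: u v => r k [r' k']; rewrite /box_row /box_col /= => e; subst r'.
by move=> /val_inj ->.
Qed.

End Shape.

Definition anc (g : 'I_n -> nat -> {set 'I_n}) r j : nat := \max_(e in g r j) e.

Lemma anc_ge (g : 'I_n -> nat -> {set 'I_n}) r j (e : 'I_n) : e \in g r j -> (e <= anc g r j)%N.
Proof. by exact: leq_bigmax_cond. Qed.

Lemma anc_in (g : 'I_n -> nat -> {set 'I_n}) r j : g r j != set0 ->
  exists2 e : 'I_n, e \in g r j & anc g r j = e.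
Proof.
move=> /set0Pn[e0 h0]; rewrite /anc.
have := @eq_bigmax_cond _ (mem (g r j)) (fun e : 'I_n => e : nat).
by case=> [|e he ->]; [apply/card_gt0P; exists e0 | exists e].
Qed.

(** In [sk_free] the test of (S.2) looks only at the next column: boxes to the left are above the
    anchor of the receiving box, which exceeds [e], and boxes further right are below those of the
    next column. *)
Record skyline (s : 'I_n -> nat) (g : 'I_n -> nat -> {set 'I_n}) : Prop := {
  sk_shape : forall r j, (g r j != set0) = (j < s r)%N;
  sk_col : forall r r' j e, e \in g r j -> e \in g r' j -> r = r';
  sk_row : forall r j j' (x y : 'I_n), (j < j')%N -> x \in g r j -> y \in g r j' ->
     (y <= x)%N;
  sk_free : forall r r' j (e : 'I_n), e \in g r j -> (e < anc g r j)%N ->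
     (j < s r')%N -> (e < anc g r' j)%N ->
     (forall y : 'I_n, y \in g r' j.+1 -> (y <= e)%N) -> (anc g r j <= anc g r' j)%N }.

Lemma skylineP s (F : filling s) :
  reflect (skyline s (entries F)) [&& nonempty_boxes F, S1 F, S2 F & S4 F].
Proof.
have boxof r j e : e \in entries F r j -> exists u : box s, [/\ box_row u = r, box_col u = j & e \in F u].
  move=> h; have [u [er ej]] : exists u : box s, box_row u = r /\ box_col u = j.
    by apply: box_exists; case: ltnP => // /entries_out E; rewrite E inE in h.
  by exists u; split=> //; rewrite -entriesE er ej.
have ancE u : anchor F u = anc (entries F) (box_row u) (box_col u) by rewrite /anc entriesE.
apply: (iffP and4P) => [[/forallP h0 /forallP h1 /forallP h2 /forallP h4]|[k0 k1 k2 k4]].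
- have k0 : forall r j, (entries F r j != set0) = (j < s r)%N.
    move=> r j; case: ltnP => [/box_exists[u [<- <-]]|/entries_out ->].
      by rewrite entriesE h0.
    by rewrite eqxx.
  have k2 r j j' (x y : 'I_n) : (j < j')%N -> x \in entries F r j ->
      y \in entries F r j' -> (y <= x)%N.
    move=> lt /boxof[u [er ej hx]] /boxof[u' [er' ej' hy]].
    have /forallP/(_ u') := h2 u; rewrite er er' ej ej' eqxx lt /=.
    by move=> /forall_inP/(_ _ hx)/forall_inP/(_ _ hy).
  split=> //.
  + move=> r r' j e /boxof[u [<- ej he]] /boxof[u' [<- ej' he']].
    have /forallP/(_ u')/implyP := h1 u.
    have [-> //|ne] := eqVneq u u'.
    rewrite ej ej' eqxx => /(_ isT); rewrite disjoint_subset => /subsetP/(_ _ he).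
    by rewrite !inE he'.
  + move=> r r' j e he ea jr' ea' hh.
    have [u [er ej heu]] := boxof _ _ _ he.
    have [u' [er' ej']] := box_exists jr'.
    have /forall_inP/(_ e) := h4 u; rewrite inE ancE er ej heu neq_ltn ea /=.
    move=> /(_ isT)/forallP/(_ u')/implyP; rewrite ancE er' ej' eqxx ea' /=; apply.
    apply/forallP => w; apply/implyP => /eqP ew.
    apply/andP; split; apply/implyP=> lt; apply/forall_inP => x hx.
      have [|e' he' ae'] := @anc_in (entries F) r' j; first by rewrite k0.
      rewrite (leq_trans (ltnW ea')) // ae'.
      by apply: (k2 r' (box_col w) j) => //; [rewrite -ej' | rewrite -er' -ew entriesE].
    case: (ltngtP j.+1 (box_col w)) => [lt'|lt'|e1].
    * have js : (j.+1 < s r')%N.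
        by apply: (ltn_trans lt'); rewrite -er' -ew box_col_lt.
      have [|e' he' ae'] := @anc_in (entries F) r' j.+1; first by rewrite k0.
      apply: leq_trans (hh _ he').
      by apply: (k2 r' j.+1 (box_col w)) => //; rewrite -er' -ew entriesE.
    * by rewrite ej' in lt; lia.
    * by apply: hh; rewrite e1 -er' -ew entriesE.
- split; apply/forallP => u.
  + by rewrite -entriesE k0 box_col_lt.
  + apply/forallP => v; apply/implyP => /andP[ne /eqP ec].
    rewrite disjoint_subset; apply/subsetP => e; rewrite !inE => he.
    apply/negP => he'; case/negP: ne; apply/eqP/box_inj => //.
    by apply: (k1 _ _ (box_col u) e); rewrite ?entriesE // ec entriesE.
  + apply/forallP => v; apply/implyP => /andP[/eqP er lt].
    apply/forall_inP => x hx; apply/forall_inP => y hy.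
    by apply: (k2 (box_row u) _ _ x y lt); [rewrite entriesE|rewrite er entriesE].
  + apply/forall_inP => e; rewrite inE => /andP[he ne].
    apply/forallP => v; apply/implyP => /and3P[/eqP ec ea /forallP hh].
    have le : (e < anchor F u)%N.
      by rewrite ltn_neqAle ne ancE; apply: anc_ge; rewrite entriesE.
    rewrite !ancE ec; apply: (k4 _ _ _ e).
    * by rewrite entriesE.
    * by rewrite -ancE.
    * by rewrite -ec box_col_lt.
    * by rewrite -ec -ancE.
    * move=> y; rewrite -ec => /boxof[w [er ej hy]].
      have /implyP := hh w; rewrite er eqxx => /(_ isT)/andP[_ /implyP].
      by rewrite ej leqnn => /(_ isT)/forall_inP/(_ _ hy).
Qed.

Definition zentry s (F : filling s) (u : box s) (e : 'I_n) : zletter :=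
  (e, (box_col u, (e : nat) == anchor F u), box_row u).

(** Sorting needs a total relation, so the strict [ltz] is replaced by the negation of its converse;
    (S.1) makes the outcome strictly sorted again. *)
Definition zword s (F : filling s) : seq zletter :=
  sort (fun z z' => ~~ ltz z' z)
    [seq zentry F u e | u <- enum (box s), e <- enum (F u)].

Lemma mem_zword s (F : filling s) v c mk r :
  ((v, (c, mk), r) \in zword F) =
    (v \in entries F r c) && (mk == ((v : nat) == anc (entries F) r c)).
Proof.
rewrite mem_sort; apply/allpairsPdep/andP => [[u [e [_ he [-> -> -> ->]]]]|[he /eqP ->]].
  by rewrite mem_enum in he; rewrite entriesE he /anc entriesE.
have jr : (c < s r)%N by case: ltnP => // /entries_out E; rewrite E inE in he.
have [u [er ej]] := box_exists jr; exists u, v; split.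
- by rewrite mem_enum.
- by rewrite mem_enum -entriesE er ej.
- by rewrite /zentry er ej /anchor /anc -er -ej entriesE.
Qed.

Lemma sorted_zword s (F : filling s) : skyline s (entries F) -> sorted (@ltz n) (zword F).
Proof.
move=> sk.
set le := fun z z' : zletter => ~~ ltz z' z.
have leE z z' : le z z' = (z.1.1 < z'.1.1)%N || (z.1.1 == z'.1.1) && (z'.1.2.1 <= z.1.2.1)%N.
  by rewrite /le /ltz /ltl -!val_eqE /=; lia.
have tot : total le by move=> z z'; rewrite !leE -!val_eqE /=; lia.
have tr : transitive le by move=> y x z; rewrite !leE -!val_eqE /=; lia.
have := sort_sorted tot [seq zentry F u e | u <- enum (box s), e <- enum (F u)].
rewrite -/le -/(zword F) => h.
have u1 : uniq (map (fun z : zletter => (z.1.1, z.1.2.1)) (zword F)).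
  rewrite map_inj_in_uniq; last first.
    move=> [[v [c mk]] r] [[v' [c' mk']] r']; rewrite !mem_zword /=.
    move=> /andP[h1 /eqP e1] /andP[h2 /eqP e2] [e3 e4]; subst v' c'.
    by have er := sk_col sk h1 h2; subst r'; rewrite e1 e2.
  rewrite sort_uniq allpairs_uniq_dep ?enum_uniq //.
    by move=> u _; rewrite enum_uniq.
  move=> [u e] [u' e'] _ _ /= [-> ec _ er].
  by have -> := box_inj er ec.
move: h u1; rewrite (sorted_pairwise tr) (sorted_pairwise (@ltz_trans n)).
rewrite uniq_pairwise pairwise_map => h1 h2.
have : pairwise [rel z z' : zletter | le z z' && ((z.1.1, z.1.2.1) != (z'.1.1, z'.1.2.1))] (zword F).
  by rewrite pairwise_relI h1.
apply: sub_pairwise => -[[v [c mk]] r] [[v' [c' mk']] r'].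
rewrite /= leE /ltz /ltl /= xpair_eqE -!val_eqE /=; lia.
Qed.

(* [ch] holds at each anchor, in the state where it is read. *)
Definition local_choice (ch : choice_rule n) s (g : 'I_n -> nat -> {set 'I_n}) :=
  forall (v : 'I_n) c p (b : state), v \in g p c -> (v : nat) = anc g p c ->
    (forall r j, (j < b r)%N =
       (j < s r)%N && ((v < anc g r j)%N || ((v : nat) == anc g r j) && (j < c)%N)) ->
    ch b v c p.

(** Induction on the part already read. By strict sorting it consists of all entries [ltz]-above the
    current letter, so the state can be computed from the anchors, as [local_choice] requires. *)
Lemma zword_suffix ch s (F : filling s) : skyline s (entries F) ->
  local_choice ch s (entries F) -> forall Z1 Z2, zword F = Z1 ++ Z2 ->
  exists2 b, zrun ch Z2 b & forall r j, hasA Z2 r j = (j < b r)%N.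
Proof.
move=> sk hch Z1 Z2; have sZ := sorted_zword sk; set g := entries F in sk hch *.
elim: Z2 Z1 => [|[[v [c mk]] p] Z2 IH] Z1 eZ.
  by exists 0%MM; [apply: zrun_nil | move=> r j; rewrite mnm0E].
have [|b rZ hb] := IH (rcons Z1 (v, (c, mk), p)); first by rewrite cat_rcons.
have sZ2 : sorted (@ltz n) ((v, (c, mk), p) :: Z2).
  by move: sZ; rewrite eZ => /cat_sorted2[].
have zin : (v, (c, mk), p) \in zword F by rewrite eZ mem_cat inE eqxx orbT.
have memZ2 z : (z \in Z2) = (z \in zword F) && ltz (v, (c, mk), p) z.
  apply/idP/andP => [zZ|[]].
    by split; [rewrite eZ mem_cat inE zZ !orbT | case: (sorted_cons_ltz sZ2) => _; apply].
  rewrite eZ mem_cat inE => /or3P[zZ|/eqP ->|] //; last by rewrite ltz_irr.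
  move=> lt; move: sZ; rewrite eZ (sorted_pairwise (@ltz_trans n)) pairwise_cat.
  move=> /andP[/allrelP/(_ _ _ zZ (mem_head _ _)) lt' _].
  by have := ltz_trans lt lt'; rewrite ltz_irr.
have hA r j : hasA Z2 r j =
    (j < s r)%N && ((v < anc g r j)%N || ((v : nat) == anc g r j) && (j < c)%N).
  apply/hasAP/andP => [[v']|[jr lt]].
    rewrite memZ2 mem_zword -/g /ltz /ltl /= => /andP[/andP[hv /eqP e] lt].
    split; last by rewrite -val_eqE /= in lt; lia.
    by rewrite -(sk_shape sk); apply/set0Pn; exists v'.
  rewrite -(sk_shape sk) in jr; have [e he ae] := anc_in jr.
  exists e; rewrite memZ2 mem_zword -/g he ae eqxx /ltz /ltl /= -val_eqE /=; lia.
have [vg mkE] : v \in g p c /\ mk = ((v : nat) == anc g p c).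
  by move: zin; rewrite mem_zword => /andP[? /eqP].
have cp : (c < s p)%N by rewrite -(sk_shape sk); apply/set0Pn; exists v.
have low j : (j < c)%N -> (v <= anc g p j)%N.
  move=> jc; have [|e he ae] := @anc_in g p j.
    by rewrite (sk_shape sk); lia.
  by rewrite ae; apply: (sk_row sk jc he vg).
have high j : (c < j)%N -> (j < s p)%N -> (anc g p j <= v)%N.
  move=> jc js; have [|e he ae] := @anc_in g p j; first by rewrite (sk_shape sk).
  by rewrite ae; apply: (sk_row sk jc vg he).
have eqN x y : (forall j, (j < x)%N = (j < y)%N) -> x = y.
  by move=> h; have := h x; have := h y; rewrite !ltnn; lia.
move/esym in mkE; case: mk mkE eZ sZ2 zin memZ2 => mkE eZ sZ2 zin memZ2.
- exists (b + U_(p))%MM.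
    have bp : b p = c.
      apply: eqN => j; rewrite -hb hA; apply/andP/idP => [[js]|jc].
        case: (ltngtP j c) => // [cj|e]; last by rewrite e (eqP mkE) ltnn andbF.
        by have := high _ cj js; lia.
      by split; [lia | have := low _ jc; lia].
    by apply: zrun_anchor => //; apply: hch => //; [exact/eqP | move=> r j; rewrite -hb hA].
  move=> r j; rewrite /= -/(hasA Z2 r j) hb mnmDE mnm1E.
  have [<-|_] := eqVneq p r; last by rewrite addn0.
  rewrite -hb hA addn1 /=.
  have -> : (j < (b p).+1)%N = (j <= c)%N.
    have -> : b p = c; last by rewrite ltnS.
    apply: eqN => k; rewrite -hb hA; apply/andP/idP => [[js]|jc].
      case: (ltngtP k c) => // [cj|e]; last by rewrite e (eqP mkE) ltnn andbF.
      by have := high _ cj js; lia.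
    by split; [lia | have := low _ jc; lia].
  rewrite eq_sym; case: (ltngtP j c) => [jc|cj|//] /=.
    by have := low _ jc; lia.
  case: (ltnP j (s p)) => //= js; have := high _ cj js; lia.
- exists b; last by move=> r j; rewrite /= -/(hasA Z2 r j) hb.
  have va : (v < anc g p c)%N by rewrite ltn_neqAle mkE anc_ge.
  have bp : b p = c.+1.
    apply: eqN => j; rewrite -hb hA ltnS; apply/andP/idP => [[js]|].
      case: (ltngtP j c) => // cj.
      by have := high _ cj js; lia.
    rewrite leq_eqVlt => /orP[/eqP -> //|jc]; first by rewrite cp va.
    by split; [lia | have := low _ jc; lia].
  apply: zrun_free => // r v1 v2 br; rewrite !memZ2 !mem_zword -/g.
  move=> /andP[/andP[h1 /eqP/esym/eqP e1] lt1] /andP[/andP[h2 /eqP/esym/eqP e2] lt2].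
  rewrite e1 e2; apply: (sk_free sk vg va).
  + by rewrite -(sk_shape sk); apply/set0Pn; exists v2.
  + by rewrite -e2; move: lt2; rewrite /ltz /ltl /= -val_eqE /=; lia.
  (* Row [r] has length [c.+1] in this state, so its anchor in the next column is still unread and
     is at most [v]. *)
  + move=> y hy; have := hb r c.+1; rewrite br ltnn hA.
    have -> /= : (c.+1 < s r)%N by rewrite -(sk_shape sk); apply/set0Pn; exists y.
    have := anc_ge hy; lia.
Qed.

Definition fill_of (Z : seq zletter) (r : 'I_n) (j : nat) : {set 'I_n} :=
  [set e : 'I_n | has (fun z : zletter => [&& z.1.1 == e, z.1.2.1 == j & z.2 == r]) Z].

Lemma fill_ofP Z r j e : reflect (exists mk, (e, (j, mk), r) \in Z) (e \in fill_of Z r j).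
Proof.
rewrite inE; apply: (iffP hasP) => [[[[v [c mk]] p] zZ /= /and3P[/eqP <- /eqP <- /eqP <-]]|[mk zZ]].
  by exists mk.
by exists (e, (j, mk), r) => //=; rewrite !eqxx.
Qed.

Lemma anc_fill_of Z b v c p : zinv Z b -> (v, (c, true), p) \in Z ->
  anc (fill_of Z) p c = v.
Proof.
move=> i vZ; apply/eqP; rewrite eqn_leq; apply/andP; split.
  apply/bigmax_leqP => e /fill_ofP[mk eZ].
  have [v' v'Z] := zi_anc i eZ; rewrite (zi_uni i vZ v'Z).
  by case: mk {eZ} => [->|/ltnW].
by apply: anc_ge; apply/fill_ofP; exists true.
Qed.

(** Each condition on a letter is read off by cutting the run at that letter: what was read before
    is exactly what is [ltz]-above it. *)
Lemma zrun_skyline ch Z b : sorted (@ltz n) Z -> zrun ch Z b ->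
  skyline b (fill_of Z) /\ local_choice ch b (fill_of Z).
Proof.
move=> sZ rZ; have i := zrun_inv sZ rZ.
have split_at z : z \in Z -> exists Z2 b2, [/\ zrun ch (z :: Z2) b2,
     sorted (@ltz n) (z :: Z2) &
     forall z', (z' \in Z2) = (z' \in Z) && ltz z z'].
  move=> zZ; have := rZ; have := sZ; move: (zZ); case/splitPr => Z1 Z2 s' r'.
  have [b2 r2] := zrun_suffix r'; have [_ s2] := cat_sorted2 s'.
  exists Z2, b2; split=> // z'.
  apply/idP/andP => [h|[]].
    by rewrite mem_cat inE h !orbT; case: (sorted_cons_ltz s2) => _ ->.
  rewrite mem_cat inE => /or3P[h|/eqP ->|] //; last by rewrite ltz_irr.
  move: s'; rewrite (sorted_pairwise (@ltz_trans n)) pairwise_cat.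
  move=> /andP[/allrelP/(_ _ _ h (mem_head _ _)) lt' _] lt.
  by have := ltz_trans lt lt'; rewrite ltz_irr.
have k0 r j : (fill_of Z r j != set0) = (j < b r)%N.
  rewrite -(zi_has i); apply/set0Pn/hasAP => [[e /fill_ofP[mk /(zi_anc i)[v' h _]]]|[v h]].
    by exists v'.
  by exists v; apply/fill_ofP; exists true.
split; first split => //.
- move=> r r' j e /fill_ofP[mk h1] /fill_ofP[mk' h2].
  by case: (sorted_ltz_inj sZ h1 h2 erefl erefl).
- move=> r j j' x y lt /fill_ofP[mk h1] /fill_ofP[mk' h2].
  exact: (zi_row i) h1 h2 lt.
- move=> r r' j e /fill_ofP[mk h1].
  have [v' hv' hm] := zi_anc i h1; rewrite (anc_fill_of i hv') => lt jr'.
  have mkF : mk = false by case: mk hm {h1} => // e'; rewrite e' ltnn in lt.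
  subst mk; rewrite -(zi_has i) in jr'; have [v2 hv2] := hasAP _ _ _ jr'.
  rewrite (anc_fill_of i hv2) => lt2 hy.
  have [Z2 [b2 [r2 s2 m2]]] := split_at _ h1.
  inversion r2 as [| |v1 c1 p1 Z1 b1 rZ2 bp mn]; subst.
  have [sZ2 _] := sorted_cons_ltz s2; have i2 := zrun_inv sZ2 rZ2.
  apply: (mn r' v' v2).
  + apply/eqP; rewrite eqn_leq; apply/andP; split.
      rewrite leqNgt -(zi_has i2); apply/negP => /hasAP[y]; rewrite m2 => /andP[yZ].
      have yf : y \in fill_of Z r' j.+1 by apply/fill_ofP; exists true.
      have := hy _ yf; rewrite /ltz /ltl /= -val_eqE /=; lia.
    by rewrite -(zi_has i2); apply/hasAP; exists v2; rewrite m2 hv2 /ltz /ltl /= lt2.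
  + by rewrite m2 hv' /ltz /ltl /= lt.
  + by rewrite m2 hv2 /ltz /ltl /= lt2.
- move=> v c p b' /fill_ofP[mk h1] va hb.
  have mkT : mk = true.
    have [v' hv'] := zi_anc i h1; rewrite (anc_fill_of i hv') in va.
    by case: mk {h1} => //; rewrite -va ltnn.
  subst mk; have [Z2 [b2 [r2 s2 m2]]] := split_at _ h1.
  inversion r2 as [|v1 c1 p1 Z1 b1 rZ2 bp chb|]; subst.
  have [sZ2 _] := sorted_cons_ltz s2; have i2 := zrun_inv sZ2 rZ2.
  suff -> : b' = b1 by [].
  apply/mnmP => r.
  have E j : (j < b' r)%N = (j < b1 r)%N.
    rewrite hb -(zi_has i) -(zi_has i2 r j); apply/andP/idP => [[/hasAP[v' hv']]|/hasAP[v']].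
      rewrite (anc_fill_of i hv') => lt; apply/hasAP; exists v'; rewrite m2 hv' /ltz /ltl /= -val_eqE /=; lia.
    rewrite m2 => /andP[hv']; rewrite /ltz /ltl /= (anc_fill_of i hv') -val_eqE /= => lt.
    by split; [apply/hasAP; exists v' | lia].
  by have := E (b' r); have := E (b1 r); rewrite !ltnn; lia.
Qed.

End Fillings.

(** * Sums over fillings as generating functions of words *)

Section GeneratingFunctions.

Variable n : nat.

Local Notation letter := ('I_n * (nat * bool))%type.
Local Notation zletter := (letter * 'I_n)%type.
Local Notation state := 'X_{1..n}.

Lemma gf_iff (P Q : seq letter -> Prop) f : gf P f -> (forall X, P X <-> Q X) -> gf Q f.
Proof.
by move=> [l ul [hl ->]] h; exists l => //; split=> // X; split=> [/hl/h|/h/hl].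
Qed.

Lemma count_zword (s : 'I_n -> nat) (F : filling s) (p : pred letter) :
  count p (map fst (zword F)) = (\sum_u \sum_(e in F u) p (zentry F u e).1)%N.
Proof.
rewrite count_map -sum1_count big_mkcond /=.
rewrite (perm_big _ (permEl (perm_sort _ _))) big_allpairs_dep /= big_enum /=.
apply: eq_bigr => u _; rewrite big_enum /=; apply: eq_bigr => e _.
by case: (p _).
Qed.

Lemma wgt_zword (s : 'I_n -> nat) (F : filling s) :
  wgt (map fst (zword F)) = ('X ^+ excess F : {poly int}) *: 'X_[wt F].
Proof.
rewrite /wgt; congr ('X ^+ _ *: 'X_[_]).
  rewrite count_zword; apply: eq_bigr => u _.
  rewrite -sum1_card big_mkcond [in RHS]big_mkcond /=; apply: eq_bigr => e _.
  by rewrite inE; case: (e \in F u) => //=; case: eqP.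
apply/mnmP => i; rewrite !mnmE count_zword -sum1_card.
rewrite [in RHS]big_mkcond /=; apply: eq_bigr => u _; rewrite inE.
rewrite big_mkcond /= (bigD1 i) //= eqxx big1 ?addn0; first by case: ifP.
by move=> e /negPf ->; case: ifP.
Qed.

Lemma eq_of_ltn x y : (forall j, (j < x)%N = (j < y)%N) -> x = y.
Proof. by move=> h; have := h x; have := h y; rewrite !ltnn; lia. Qed.

Lemma zrun_zword ch (s : 'I_n -> nat) (F : filling s) (b : state) : s =1 b -> skyline s (entries F) ->
  local_choice ch s (entries F) -> zrun ch (zword F) b.
Proof.
move=> sb sk hch; have [//|b' rb' hb'] := @zword_suffix _ ch s F sk hch [::] (zword F).
suff <- : b' = b by [].
apply/mnmP => r; apply: eq_of_ltn => j; rewrite -hb' -sb -(sk_shape sk).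
apply/hasAP/idP => [[v]|h].
  by rewrite mem_zword => /andP[h _]; apply/set0Pn; exists v.
by have [v hv e] := anc_in h; exists v; rewrite mem_zword hv e eqxx.
Qed.

(** The last hypothesis lets words forget their rows. It fixes the common final state [b] because
    [removal_rev] determines rows only backwards from it. *)
Lemma fillings_gf ch (s : 'I_n -> nat) (b : state) (P : pred (filling s)) : s =1 b ->
  (forall F, P F <-> skyline s (entries F) /\ local_choice ch s (entries F)) ->
  (forall Z Z', sorted (@ltz n) Z -> zrun ch Z b -> zrun ch Z' b ->
     map fst Z = map fst Z' -> Z = Z') ->
  gf (fun X => sorted (@ltl n) X /\ run ch X b)
     (\sum_(F | P F) ('X ^+ excess F : {poly int}) *: 'X_[wt F]).
Proof.
move=> sb hP det; exists [seq map fst (zword F) | F <- enum P].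
  rewrite map_inj_in_uniq ?enum_uniq // => F F'; rewrite !mem_enum => /hP[sk ch1] /hP[sk' ch2] eX.
  have eZ : zword F = zword F'.
    by apply: det => //; [apply: sorted_zword | apply: zrun_zword | apply: zrun_zword].
  apply/ffunP => u; rewrite -!entriesE; apply/setP => e.
  apply/idP/idP => he.
    have := mem_zword F e (box_col u) (e == anc (entries F) (box_row u) (box_col u) :> nat) (box_row u).
    by rewrite he eqxx eZ mem_zword => /andP[].
  have := mem_zword F' e (box_col u) (e == anc (entries F') (box_row u) (box_col u) :> nat) (box_row u).
  by rewrite he eqxx -eZ mem_zword => /andP[].
split; last by rewrite big_map big_enum /=; apply: eq_bigr => F _; rewrite wgt_zword.
move=> X; split=> [/mapP[F]|[sX rX]].
  rewrite mem_enum => /hP[sk ch1] ->; split.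
    by rewrite -sorted_ltz; apply: sorted_zword.
  exact: zrun_run (zrun_zword sb sk ch1).
have [Z rZ eZ] := run_zrun sX rX; have sZ : sorted (@ltz n) Z by rewrite sorted_ltz eZ.
have i := zrun_inv sZ rZ.
pose F : filling s := [ffun u => fill_of Z (box_row u) (box_col u)].
have [sk ch1] := zrun_skyline sZ rZ.
have eF : entries F =2 fill_of Z.
  move=> r j; case: (ltnP j (s r)) => jr.
    by have [u [<- <-]] := box_exists jr; rewrite entriesE ffunE.
  rewrite entries_out //; apply/esym/eqP; apply: contraTT jr.
  by rewrite (sk_shape sk) sb -ltnNge.
have aF r j : anc (entries F) r j = anc (fill_of Z) r j by rewrite /anc eF.
have skF : skyline s (entries F).
  case: sk => k0 k1 k2 k4; split.
  - by move=> r j; rewrite eF k0 sb.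
  - by move=> r r' j e; rewrite !eF; apply: k1.
  - by move=> r j j' x y; rewrite !eF; apply: k2.
  - by move=> r r' j e; rewrite !eF !aF sb; apply: k4.
have chF : local_choice ch s (entries F).
  move=> v c p b'; rewrite !eF aF => h1 h2 h3; apply: ch1 => //.
  by move=> r j; rewrite h3 aF sb.
apply/mapP; exists F; first by rewrite mem_enum; apply/hP.
rewrite -eZ; suff -> : Z = zword F by [].
apply: (irr_sorted_eq (@ltz_trans n) (@ltz_irr n) sZ (sorted_zword skF)).
move=> [[v [c mk]] p]; rewrite mem_zword eF aF; apply/idP/andP => [h|[/fill_ofP[mk' h] /eqP em]].
  split; first by apply/fill_ofP; exists mk.
  have [v' hv' e] := zi_anc i h; rewrite (anc_fill_of i hv').
  by case: mk e {h} => [->|]; rewrite ?eqxx // => /ltn_eqF ->.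
have [v' hv' e] := zi_anc i h; rewrite (anc_fill_of i hv') in em.
suff -> : mk = mk' by [].
by rewrite em; case: mk' e {h} => [->|]; rewrite ?eqxx // => /ltn_eqF ->.
Qed.

(* (S.3) and (S.5): see [insertionP]. *)
Definition insertion : choice_rule n := fun b v c p =>
  if c is 0 then p == v else [forall r : 'I_n, (r < p)%N ==> (b r != c)].

(* (S.3) with basement, rows being named by their basement entry. *)
Definition removal : choice_rule n := fun b v c p =>
  [forall r : 'I_n, (r < p)%N ==> (b r != c.+1)] && ((c == 0%N) ==> (v <= p)%N).

(* [removal] with the original numbering of rows, bottom to top. *)
Definition removal_rev : choice_rule n := fun b v c p =>
  [forall r : 'I_n, (p < r)%N ==> (b r != c.+1)] && ((c == 0%N) ==> (v <= rev_ord p)%N).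

(** Both rows carry the least anchor of column [c] among the candidates, hence the same value in the
    same column, hence they are the same row. *)
Lemma zfree_det v c p p' (Z : seq zletter) (b : state) : sorted (@ltz n) Z ->
  zinv Z b -> b p = c.+1 -> b p' = c.+1 ->
  (forall r v1 v2, b r = c.+1 -> (v1, (c, true), p) \in Z ->
       (v2, (c, true), r) \in Z -> (v1 <= v2)%N) ->
  (forall r v1 v2, b r = c.+1 -> (v1, (c, true), p') \in Z ->
       (v2, (c, true), r) \in Z -> (v1 <= v2)%N) ->
  (v, (c, false), p) = (v, (c, false), p') :> zletter.
Proof.
move=> sZ i bp bp' h h'.
have /hasAP[v1 h1] : hasA Z p c by rewrite (zi_has i) bp.
have /hasAP[v2 h2] : hasA Z p' c by rewrite (zi_has i) bp'.
have e : v1 = v2.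
  by apply/val_inj/eqP; rewrite eqn_leq (h _ _ _ bp' h1 h2) (h' _ _ _ bp h2 h1).
by rewrite e in h1; have [->] := sorted_ltz_inj sZ h1 h2 erefl erefl.
Qed.

Lemma zrun_cons ch v c mk p Z (b : state) : zrun ch ((v, (c, mk), p) :: Z) b ->
  exists2 b0, zrun ch Z b0 &
    if mk then [/\ b = (b0 + U_(p))%MM, b0 p = c & ch b0 v c p]
    else [/\ b = b0, b0 p = c.+1 &
      forall r v1 v2, b0 r = c.+1 -> (v1, (c, true), p) \in Z ->
       (v2, (c, true), r) \in Z -> (v1 <= v2)%N].
Proof.
by move=> h; inversion h; subst; (eexists; [eassumption|by []]).
Qed.

Lemma insertion_det Z Z' b b' : sorted (@ltz n) Z -> zrun insertion Z b ->
  zrun insertion Z' b' -> map fst Z = map fst Z' -> Z = Z' /\ b = b'.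
Proof.
elim: Z Z' b b' => [|[[v [c mk]] p] Z IH] [|[[v' [c' mk']] p'] Z'] b b' //.
  by move=> _ h h'; inversion h; inversion h'.
move=> sZ /zrun_cons[b0 r0 h] /zrun_cons[b1 r1 h'] [ev ec em eZ]; subst v' c' mk'.
have [sZ1 _] := sorted_cons_ltz sZ.
have [e1 e2] := IH _ _ _ sZ1 r0 r1 eZ; subst Z' b1.
case: mk h h' sZ => -[-> bp ch1] [-> bp' ch2] sZ.
  suff -> : p = p' by [].
  case: c ch1 ch2 bp bp' {sZ} => [|c]; first by move=> /eqP -> /eqP ->.
  move=> /forallP h /forallP h' bp bp'; apply/val_inj; case: (ltngtP p p') => // lt.
    by have := h' p; rewrite lt bp eqxx.
  by have := h p'; rewrite lt bp' eqxx.
by split=> //; congr (_ :: _); apply: zfree_det (zrun_inv sZ1 r0) _ _ _ _.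
Qed.

(** Seen from the state after an anchor, its row [p] is the last one of length [c.+1], so rows are
    recovered by peeling off the smallest letter. *)
Lemma removal_rev_det Z Z' b : sorted (@ltz n) Z -> zrun removal_rev Z b ->
  zrun removal_rev Z' b -> map fst Z = map fst Z' -> Z = Z'.
Proof.
elim: Z Z' b => [|[[v [c mk]] p] Z IH] [|[[v' [c' mk']] p'] Z'] b //.
move=> sZ /zrun_cons[b0 r0 h] /zrun_cons[b1 r1 h'] [ev ec em eZ]; subst v' c' mk'.
have [sZ1 _] := sorted_cons_ltz sZ.
case: mk h h' sZ => -[eb bp ch1] [eb' bp' ch2] sZ.
  have E r : (b0 r + (p == r) = b1 r + (p' == r))%N.
    by rewrite -!mnm1E -!mnmDE -eb -eb'.
  have ep : p = p'.
    move: ch1 ch2 => /andP[/forallP h1 _] /andP[/forallP h2 _].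
    apply/val_inj; case: (ltngtP p p') => // lt.
      have := h2 p; have := h1 p'; have := E p; have := E p'; move: bp bp' lt.
      by rewrite !eqxx -!val_eqE /=; lia.
    have := h2 p; have := h1 p'; have := E p; have := E p'; move: bp bp' lt.
    by rewrite !eqxx -!val_eqE /=; lia.
  subst p'; have e1 : b1 = b0 by apply/mnmP => r; have := E r; lia.
  by subst b1; rewrite (IH _ _ sZ1 r0 r1 eZ).
subst b0 b1; have e := IH _ _ sZ1 r0 r1 eZ; subst Z'; congr (_ :: _).
exact: zfree_det (zrun_inv sZ1 r0) _ _ _ _.
Qed.

End GeneratingFunctions.

(** * Inversion triples *)

Section Triples.

Variable n : nat.

Local Notation letter := ('I_n * (nat * bool))%type.
Local Notation state := 'X_{1..n}.

Lemma S3P (s : 'I_n -> nat) (F : filling s) :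
  reflect
   ((forall (r p : 'I_n) j, (r < p)%N -> (s p <= s r)%N -> (j.+1 < s p)%N ->
      inversion (anc (entries F) r j) (anc (entries F) r j.+1) (anc (entries F) p j.+1)) /\
    (forall (r p : 'I_n) j, (r < p)%N -> (s r < s p)%N -> (j < s r)%N ->
      inversion (anc (entries F) p j) (anc (entries F) p j.+1) (anc (entries F) r j)))
   (S3 F).
Proof.
have ancE u : anchor F u = anc (entries F) (box_row u) (box_col u) by rewrite /anc entriesE.
apply: (iffP idP) => [h|[hA hB]].
  have {}h u v w : type_A u v w || type_B u v w -> inversion (anchor F u) (anchor F v) (anchor F w).
    by move: h => /forallP/(_ u)/forallP/(_ v)/forallP/(_ w)/implyP.
  split=> r p j rp sp jp.
    have [u [er ec]] := @box_exists _ s r j ltac:(lia).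
    have [v [er' ec']] := @box_exists _ s r j.+1 ltac:(lia).
    have [w [er2 ec2]] := @box_exists _ s p j.+1 ltac:(lia).
    have := h u v w; rewrite !ancE /type_A er er' er2 ec ec' ec2 !eqxx rp sp /=.
    exact.
  have [u [er ec]] := @box_exists _ s p j ltac:(lia).
  have [v [er' ec']] := @box_exists _ s p j.+1 ltac:(lia).
  have [w [er2 ec2]] := @box_exists _ s r j ltac:(lia).
  have := h u v w; rewrite !ancE /type_B er er' er2 ec ec' ec2 !eqxx rp sp orbT /=.
  exact.
apply/forallP => u; apply/forallP => v; apply/forallP => w; apply/implyP.
rewrite !ancE => /orP[] /and5P[/eqP e1 /eqP e2 lt /eqP e3 e4].
  rewrite e3 e2 e1; apply: hA => //.
  by rewrite -e2 -e3 box_col_lt.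
rewrite e3 e2 -e1; apply: hB => //; first by rewrite -e3 box_col_lt.
Qed.

(** Anchors weakly decrease along a row and ties go to the left column, so the boxes read before
    [(v, c)] form an initial segment of each row. This supplies the state at which [local_choice]
    can be applied. *)
Lemma local_state (s : 'I_n -> nat) (g : 'I_n -> nat -> {set 'I_n}) (v c : nat) : skyline s g ->
  exists b : state, forall r j, (j < b r)%N =
     (j < s r)%N && ((v < anc g r j)%N || (v == anc g r j) && (j < c)%N).
Proof.
move=> sk.
pose P r j := (v < anc g r j)%N || (v == anc g r j) && (j < c)%N.
exists [multinom count (P r) (iota 0 (s r)) | r < n] => r j; rewrite mnmE -/(P r j).
have dn i k : (i < k)%N -> (k < s r)%N -> P r k -> P r i.
  move=> ik ks; rewrite /P.
  have [|e he ->] := @anc_in _ g r k; first by rewrite (sk_shape sk).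
  have [|e' he' ->] := @anc_in _ g r i; first by rewrite (sk_shape sk); lia.
  have := sk_row sk ik he' he; lia.
elim: (s r) dn => [|m IH] dn; first by [].
rewrite -[in iota _ _]addn1 iotaD count_cat /= add0n addn0.
have {}IH := IH (fun i k ik km => dn i k ik ltac:(lia)).
case Pm : (P r m) => /=; last first.
  rewrite addn0 IH ltnS (leq_eqVlt j).
  by case: (eqVneq j m) => [->|_] //=; rewrite Pm ltnn.
have /eqP -> : count (P r) (iota 0 m) == size (iota 0 m).
  rewrite -all_count; apply/allP => i; rewrite mem_iota /= add0n => im.
  by apply: dn Pm; lia.
rewrite size_iota addn1; case: (ltngtP j m) => jm; rewrite ?ltnS.
- by rewrite ltnW // (dn j m) //; lia.
- by rewrite leqNgt jm.
- by rewrite jm leqnn Pm.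
Qed.

Section Skyline.

Variables (s : 'I_n -> nat) (g : 'I_n -> nat -> {set 'I_n}).
Hypothesis sk : skyline s g.

Lemma anc_val r j : (j < s r)%N -> exists2 e : 'I_n, e \in g r j & anc g r j = e.
Proof. by move=> h; apply: anc_in; rewrite (sk_shape sk). Qed.

Lemma anc_row r j k : (j <= k)%N -> (k < s r)%N -> (anc g r k <= anc g r j)%N.
Proof.
rewrite leq_eqVlt => /orP[/eqP -> //|jk] ks.
have [e he ->] := anc_val ks; have [|e' he' ->] := @anc_val r j; first by lia.
exact: (sk_row sk jk he' he).
Qed.

Lemma anc_neq (r p : 'I_n) j : (r < p)%N -> (j < s r)%N -> (j < s p)%N -> anc g r j != anc g p j.
Proof.
move=> rp jr jp; have [e he ->] := anc_val jr; have [e' he' ->] := anc_val jp.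
apply: contraTneq rp => ee; rewrite -leqNgt.
by rewrite -(val_inj ee) in he'; rewrite (sk_col sk he he').
Qed.

(** When the anchor of row [p] in column [c.+1] arrives, no lower row may have length [c.+1]: a
    lower row that already has its anchor of column [c] must also have that of column [c.+1]. Type A
    triples express this directly, type B triples only after an induction along the rows. *)
Lemma insertionP :
  (local_choice (@insertion n) s g) <->
  [/\ forall r, (0 < s r)%N -> anc g r 0 = r :> nat,
    forall (r p : 'I_n) j, (r < p)%N -> (s p <= s r)%N -> (j.+1 < s p)%N ->
      inversion (anc g r j) (anc g r j.+1) (anc g p j.+1) &
    forall (r p : 'I_n) j, (r < p)%N -> (s r < s p)%N -> (j < s r)%N ->
      inversion (anc g p j) (anc g p j.+1) (anc g r j)].
Proof.
split=> [h|[h5 hA hB] v c p b hv ev hb].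
- have G (r p : 'I_n) c : (r < p)%N -> (c.+1 < s p)%N -> (c < s r)%N ->
      (anc g p c.+1 <= anc g r c)%N -> (c.+1 < s r)%N /\ (anc g p c.+1 < anc g r c.+1)%N.
    move=> rp cp cr le; have [v hv ev] := anc_val cp.
    have [b hb] := local_state v c.+1 sk.
    have /forallP/(_ r) := h v c.+1 p b hv (esym ev) hb.
    rewrite rp /= => ne; have := hb r c; have := hb r c.+1.
    rewrite -ev cr ltnn ltnSn andbF orbF andbT /=.
    case: (ltnP c.+1 (s r)) => /= _; lia.
  split.
  + move=> r sr; have [v hv ev] := anc_val sr; have [b hb] := local_state v 0 sk.
    by have := h v 0%N r b hv (esym ev) hb; rewrite /= ev => /eqP ->.
  + move=> r p j rp sp jp; have := G r p j rp jp ltac:(lia).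
    have := @anc_neq r p j.+1 rp ltac:(lia) jp.
    have := @anc_row r j j.+1 ltac:(lia) ltac:(lia).
    rewrite /inversion; lia.
  + move=> r p j rp sp jr; have := G r p j rp ltac:(lia) jr.
    have := @anc_row p j j.+1 ltac:(lia) ltac:(lia).
    suff : (anc g p j.+1 <= anc g r j)%N -> False by rewrite /inversion; lia.
    move=> le; have [j1 lt1] := G r p j rp ltac:(lia) jr le.
    (* A bad type B triple propagates to the right until the end of row [p], which would make row
       [r] at least as long. *)
    have X k : (j.+1 + k < s p)%N -> (j.+1 + k < s r)%N /\ (anc g p (j.+1 + k) < anc g r (j.+1 + k))%N.
      elim: k => [|k IH]; first by rewrite addn0.
      rewrite addnS => kp; have [kr lt] := IH ltac:(lia).
      apply: G => //.
      have := @anc_row p (j.+1 + k) (j.+1 + k).+1 ltac:(lia) kp; lia.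
    have := X (s p - j.+2)%N ltac:(lia); lia.
- rewrite /insertion.
  have cp : (c < s p)%N by rewrite -(sk_shape sk); apply/set0Pn; exists v.
  case: c cp hv ev hb => [|c] cp hv ev hb; first by rewrite -val_eqE /= ev h5.
  apply/forallP => r; apply/implyP => rp; apply/negP => /eqP br.
  have := hb r c; have := hb r c.+1; rewrite br ltnn !ltnSn andbF orbF andbT ev.
  move=> n1 /esym/andP[cr le].
  have {}le : (anc g p c.+1 <= anc g r c)%N by lia.
  case: (leqP (s p) (s r)) => sr.
    have := hA r p c rp sr cp; have := @anc_neq r p c.+1 rp ltac:(lia) cp; move: n1.
    have -> : (c.+1 < s r)%N by lia.
    rewrite /inversion; lia.
  have lt : (anc g p c < anc g r c)%N by have := hB r p c rp sr cr; rewrite /inversion; lia.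
  (* Type B triples push the inequality leftwards to the first column, where (S.5) contradicts
     [r < p]. *)
  have X k : (k <= c)%N -> (anc g p (c - k) < anc g r (c - k))%N.
    elim: k => [|k IH] kc; first by rewrite subn0.
    have := IH ltac:(lia); have -> : (c - k = (c - k.+1).+1)%N by lia.
    have := hB r p (c - k.+1)%N rp sr ltac:(lia).
    have := @anc_row r (c - k.+1)%N (c - k.+1).+1 ltac:(lia) ltac:(lia).
    rewrite /inversion; lia.
  have := X c (leqnn c); rewrite subnn !h5; lia.
Qed.

(** A higher row whose box in column [c] is read before that of [q] must not stand at length [c.+1]
    at that moment, so it already has its next anchor. *)
Lemma removal_revP :
  (local_choice (@removal_rev n) s g) <->
  (forall r, (0 < s r)%N -> (anc g r 0 <= rev_ord r)%N) /\
  (forall (q p : 'I_n) c, (q < p)%N -> (c < s q)%N -> (c < s p)%N -> (anc g q c < anc g p c)%N ->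
     (c.+1 < s p)%N /\ (anc g q c < anc g p c.+1)%N).
Proof.
split=> [h|[h0 h1] v c p b hv ev hb].
- split=> [r sr|q p c qp cq cp lt].
    have [v hv ev] := anc_val sr; have [b hb] := local_state v 0 sk.
    by have /andP[_ ] := h v 0%N r b hv (esym ev) hb; rewrite /= ev.
  have [v hv ev] := anc_val cq; have [b hb] := local_state v c sk.
  have /andP[/forallP/(_ p) + _] := h v c q b hv (esym ev) hb.
  rewrite qp /= => ne; have := hb p c; have := hb p c.+1.
  rewrite cp ltnn andbF orbF /= -ev lt.
  case: (ltnP c.+1 (s p)) => /= _; last by lia.
  have -> : (c.+1 < c)%N = false by lia.
  rewrite andbF orbF; lia.
- have cp : (c < s p)%N by rewrite -(sk_shape sk); apply/set0Pn; exists v.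
  rewrite /removal_rev; apply/andP; split; last first.
    by apply/implyP => /eqP c0; subst c; rewrite ev h0.
  apply/forallP => r; apply/implyP => pr; apply/negP => /eqP br.
  have := hb r c; have := hb r c.+1; rewrite br !ltnn leqnn ev andbF orbF.
  have -> : (c.+1 < c)%N = false by lia.
  rewrite andbF orbF => n1 /esym/andP[cr lt].
  have := h1 p r c pr cp cr lt; lia.
Qed.

End Skyline.

Lemma entries_augment (s : 'I_n -> nat) (F : filling s) r j :
  entries (augment F) r j = if j is j'.+1 then entries F r j' else [set rev_ord r].
Proof.
case: j => [|j].
  rewrite /entries insubT /= /augment ffunE /=.
  set k := (X in unlift _ X); have -> : k = ord0 by apply/val_inj.
  by rewrite unlift_none.
case: (ltnP j (s r)) => js; last by rewrite !entries_out.
rewrite /entries insubT /= insubT /= /augment ffunE /=.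
set k := (X in unlift _ X).
have -> : k = lift ord0 (Ordinal js) by apply/val_inj.
by rewrite liftK.
Qed.

Lemma rev_ord_lt (r p : 'I_n) : (rev_ord r < rev_ord p)%N = (p < r)%N.
Proof. by rewrite /=; have := ltn_ord r; have := ltn_ord p; lia. Qed.

(** The basement decreases upwards. For a higher row that is not longer, type A triples carry this
    inequality rightwards along the row, so the situation forbidden by the local rule never arises;
    for a longer one a type B triple is the rule itself. *)
Lemma augment_local (s : 'I_n -> nat) (F : filling s) (G := augment F) :
  [&& nonempty_boxes G, S1 G, S2 G, S3 G & S4 G] <->
  skyline s (entries F) /\ local_choice (@removal_rev n) s (entries F).
Proof.
have -> : [&& nonempty_boxes G, S1 G, S2 G, S3 G & S4 G] =
    [&& nonempty_boxes G, S1 G, S2 G & S4 G] && S3 G.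
  by do ?case: (_ G).
have eG := @entries_augment s F.
have a0 r : anc (entries G) r 0 = rev_ord r by rewrite /anc eG big_set1.
have aS r j : anc (entries G) r j.+1 = anc (entries F) r j by rewrite /anc eG.
split.
- move=> /andP[/skylineP sk /S3P[hA hB]].
  have skF : skyline s (entries F).
    split.
    + by move=> r j; have := sk_shape sk r j.+1; rewrite eG ltnS.
    + by move=> r r' j e; have := @sk_col _ _ _ sk r r' j.+1 e; rewrite !eG.
    + move=> r j j' x y lt; have := @sk_row _ _ _ sk r j.+1 j'.+1 x y lt.
      by rewrite !eG.
    + move=> r r' j e; have := @sk_free _ _ _ sk r r' j.+1 e.
      by rewrite !aS !eG ltnS.
  split=> //; apply/(removal_revP skF); split=> [r sr|q p c qp cq cp lt].
    by have := @anc_row _ _ sk r 0 1 isT ltac:(cbv beta; lia); rewrite aS a0.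
  case: (leqP (s p) (s q)) => sq.
    have X j : (j < (s p).+1)%N -> (anc (entries G) p j < anc (entries G) q j)%N.
      elim: j => [_|j IH js]; first by rewrite !a0 rev_ord_lt.
      have := IH ltac:(cbv beta; lia); have := hA q p j qp sq js.
      have := @anc_row _ _ sk p j j.+1 ltac:(cbv beta; lia) ltac:(cbv beta; lia).
      rewrite /inversion; lia.
    by have := X c.+1 cp; rewrite !aS; lia.
  have := hB q p c.+1 qp sq ltac:(cbv beta; lia); rewrite !aS.
  by rewrite /inversion; lia.
- move=> [skF /(removal_revP skF)[h0 h1]].
  have sk : skyline (fun r => (s r).+1) (entries G).
    split.
    + move=> r [|j]; rewrite eG.
        by apply/set0Pn; exists (rev_ord r); rewrite inE.
      by rewrite (sk_shape skF) ltnS.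
    + move=> r r' [|j] e; rewrite !eG /=; last exact: (sk_col skF).
      by rewrite !inE => /eqP -> /eqP/rev_ord_inj.
    + move=> r [|j] [|j'] x y; rewrite !eG // ?ltnS.
        rewrite inE => _ /eqP -> hy.
        have s0 : (j' < s r)%N by rewrite -(sk_shape skF); apply/set0Pn; exists y.
        apply: leq_trans (h0 r ltac:(cbv beta; lia)); apply: leq_trans (anc_ge hy) _.
        exact: (anc_row skF).
      exact: (sk_row skF).
    + move=> r r' [|j] e; rewrite ?aS ?eG ?ltnS; last exact: (sk_free skF).
      by rewrite a0 inE => /eqP ->; rewrite ltnn.
  apply/andP; split; first exact/skylineP.
  apply/S3P; split=> [r p j rp sp jp|r p j rp sp jr].
    (* The induction starts at the right end of row [p]: a larger anchor there would, by the local
       rule, require a box beyond the end of row [p]. *)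
    have X k : (k < s p)%N -> (anc (entries F) p (s p - k.+1) < anc (entries F) r (s p - k.+1))%N.
      elim: k => [|k IH] ks.
        have := h1 r p (s p - 1)%N rp ltac:(cbv beta; lia) ltac:(cbv beta; lia).
        have := @anc_neq _ _ skF r p (s p - 1)%N rp ltac:(cbv beta; lia) ltac:(cbv beta; lia); lia.
      have := IH ltac:(cbv beta; lia); have -> : (s p - k.+1 = (s p - k.+2).+1)%N by lia.
      have := h1 r p (s p - k.+2)%N rp ltac:(cbv beta; lia) ltac:(cbv beta; lia).
      have := @anc_neq _ _ skF r p (s p - k.+2)%N rp ltac:(cbv beta; lia) ltac:(cbv beta; lia).
      have := @anc_row _ _ skF r (s p - k.+2)%N (s p - k.+2).+1 ltac:(cbv beta; lia) ltac:(cbv beta; lia); lia.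
    have := X (s p - j.+1)%N ltac:(cbv beta; lia).
    have -> : (s p - (s p - j.+1).+1 = j)%N by lia.
    have := @anc_row _ _ sk r j j.+1 ltac:(cbv beta; lia) ltac:(cbv beta; lia); rewrite !aS /inversion; lia.
  have := @anc_row _ _ sk p j j.+1 ltac:(cbv beta; lia) ltac:(cbv beta; lia).
  case: j jr => [|j] jr; rewrite /inversion !aS.
    by rewrite !a0; have := rev_ord_lt p r; rewrite rp; lia.
  have := h1 r p j rp ltac:(cbv beta; lia) ltac:(cbv beta; lia).
  have := @anc_neq _ _ skF r p j rp ltac:(cbv beta; lia) ltac:(cbv beta; lia); lia.
Qed.

Lemma lascoux_local (a : state) (F : filling (rev_shape a)) :
  lascouxSSF F <->
  skyline (rev_shape a) (entries F) /\ local_choice (@removal_rev n) (rev_shape a) (entries F).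
Proof. exact: augment_local. Qed.

Lemma atom_local (a : state) (F : filling a) :
  atomSSF F <-> skyline a (entries F) /\ local_choice (@insertion n) a (entries F).
Proof.
rewrite /atomSSF.
have -> : [&& nonempty_boxes F, S1 F, S2 F, S3 F, S4 F & S5 F] =
    [&& nonempty_boxes F, S1 F, S2 F & S4 F] && (S3 F && S5 F).
  by rewrite -!andbA; do ?bool_congr; rewrite andbCA.
have h5 : S5 F <-> (forall r, (0 < a r)%N -> anc (entries F) r 0 = r :> nat).
  split=> [/forallP h r sr|h].
    have [u [er ec]] := box_exists sr.
    by have := h u; rewrite ec eqxx /= /anchor -entriesE er ec => /eqP.
  apply/forallP => u; apply/implyP => /eqP uc.
  have := h (box_row u); rewrite -uc => e.
  by rewrite /anchor -entriesE -/(anc _ _ _) e ?box_col_lt.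
split.
  move=> /and3P[/skylineP sk /S3P[hA hB] /h5 h]; split=> //.
  by apply/(insertionP sk).
move=> [sk /(insertionP sk)[h hA hB]].
by apply/and3P; split; [apply/skylineP|apply/S3P|apply/h5].
Qed.

End Triples.

(** * Lascoux polynomials and atoms *)

Section Key.

Variable n : nat.

Local Notation letter := ('I_n * (nat * bool))%type.
Local Notation state := 'X_{1..n}.

Lemma run_cons ch v c mk X (b : state) : run ch ((v, (c, mk)) :: X) b ->
  exists2 b0, run ch X b0 &
    if mk then exists p, [/\ b = (b0 + U_(p))%MM, b0 p = c & ch b0 v c p]
    else b = b0 /\ exists p, b0 p = c.+1.
Proof.
move=> h; inversion h; subst; (eexists; [eassumption|]); first by exists p.
by split=> //; exists p.
Qed.

Lemma run_nilE ch (b : state) : run ch [::] b -> b = 0%MM.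
Proof. by move=> h; inversion h. Qed.

Lemma run_mdeg ch X (b : state) : run ch X b ->
  mdeg b = count (fun l : letter => l.2.2) X.
Proof.
elim=> [|v c p {}X {}b _ IH _ _|v c p {}X {}b _ IH _] /=; first by rewrite mdeg0.
  by rewrite mdegD mdeg1 IH addnC.
by rewrite IH.
Qed.

Lemma sorted_cons_ltl l X : sorted (@ltl n) (l :: X) ->
  sorted (@ltl n) X /\ {in X, forall l', ltl l l'}.
Proof.
move=> h; split; first exact: path_sorted h.
by move: h => /= /(order_path_min (@ltl_trans n))/allP.
Qed.

Lemma lascoux_atom_gf (a : state) :
  gf (fun X => sorted (@ltl n) X /\ run (@insertion n) X a) (lascoux_atom a).
Proof.
apply: fillings_gf => //; first exact: atom_local.
by move=> Z Z' sZ r1 r2 e; have [] := insertion_det sZ r1 r2 e.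
Qed.

Definition mrev (b : state) : state := [multinom b (rev_ord i) | i < n].

Lemma mrevE b i : mrev b i = b (rev_ord i).
Proof. by rewrite mnmE. Qed.

Lemma mrevK : involutive mrev.
Proof. by move=> b; apply/mnmP => i; rewrite !mnmE rev_ordK. Qed.

Lemma run_mrev X b : run (@removal_rev n) X b <-> run (@removal n) X (mrev b).
Proof.
have R0 : mrev 0 = 0%MM by apply/mnmP => i; rewrite !mnmE.
have RD b0 p : mrev (b0 + U_(p)) = (mrev b0 + U_(rev_ord p))%MM.
  by apply/mnmP => i; rewrite !mnmE -(inj_eq rev_ord_inj) rev_ordK.
have Rc b0 v c p : removal_rev b0 v c p = removal (mrev b0) v c (rev_ord p).
  rewrite /removal_rev /removal; congr (_ && _).
  apply/forallP/forallP => h r.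
    have -> : (r < rev_ord p)%N = (p < rev_ord r)%N.
      by rewrite /=; have := ltn_ord r; have := ltn_ord p; lia.
    by have := h (rev_ord r); rewrite mrevE.
  by have := h (rev_ord r); rewrite mrevE rev_ordK rev_ord_lt.
split.
- elim=> [|v c p {}X {}b _ IH bp chb|v c p {}X {}b _ IH bp].
  + by rewrite R0; apply: run_nil.
  + by rewrite RD; apply: run_anchor => //; rewrite ?mrevE ?rev_ordK // -Rc.
  + by apply: (@run_free _ _ v c (rev_ord p) _ _ IH); rewrite mrevE rev_ordK bp.
- rewrite -{2}(mrevK b).
  elim=> [|v c p {}X b0 _ IH bp chb|v c p {}X b0 _ IH bp].
  + by rewrite R0; apply: run_nil.
  + rewrite RD; apply: run_anchor => //; rewrite ?mrevE ?rev_ordK //.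
    by rewrite Rc mrevK rev_ordK.
  + by apply: (@run_free _ _ v c (rev_ord p) _ _ IH); rewrite mrevE rev_ordK bp.
Qed.

Lemma lascoux_gf (a : state) :
  gf (fun X => sorted (@ltl n) X /\ run (@removal n) X a) (lascoux a).
Proof.
apply: (@gf_iff _ (fun X => sorted (@ltl n) X /\ run (@removal_rev n) X (mrev a))); last first.
  by move=> X; rewrite run_mrev mrevK.
apply: fillings_gf; first by move=> r; rewrite mnmE.
  exact: lascoux_local.
by move=> Z Z'; apply: removal_rev_det.
Qed.

(** For fixed [j], the counting function of the set of rows with at least [j] boxes, that is, of
    column [j] of the key of [a]. Comparing two such sets componentwise amounts to comparing these
    functions. *)
Definition cnt (a : state) (j t : nat) : nat := \sum_(r < n | (r < t)%N) (j <= a r)%N.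

Lemma cntD b p j t : cnt (b + U_(p)) j t = (cnt b j t + ((j == (b p).+1) && (p < t)))%N.
Proof.
rewrite /cnt (eq_bigr (fun r => (j <= b r) + ((p == r) && (j == (b p).+1)))%N); last first.
  move=> r _; rewrite mnmDE mnm1E; case: (eqVneq p r) => [->|_] /=; last by rewrite !addn0.
  by lia.
rewrite big_split /=; congr (_ + _)%N.
case: (ltnP p t) => pt.
  rewrite (bigD1 p) //= eqxx big1 ?addn0 ?andbT //.
  by move=> r /andP[_ /negPf]; rewrite eq_sym => ->.
rewrite andbF big1 // => r rt; suff -> : (p == r) = false by [].
by rewrite -val_eqE /=; lia.
Qed.

Lemma cnt_mono b j k t : (j <= k)%N -> (cnt b k t <= cnt b j t)%N.
Proof. by move=> jk; apply: leq_sum => r _; case: (leqP k (b r)) => // /(leq_trans jk) ->. Qed.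

Lemma cnt_eq (b : state) c (t : nat) : (forall r : 'I_n, (r < t)%N -> b r != c) -> cnt b c t = cnt b c.+1 t.
Proof. by move=> h; apply: eq_bigr => r /h ne; rewrite leq_eqVlt eq_sym (negPf ne). Qed.

(** Only the totals enter, and [keyle] equates them: a row of a required length exists in both
    states or in neither. *)
Lemma cnt_lt (b : state) c : (exists p, b p = c) <-> (cnt b c.+1 n < cnt b c n)%N.
Proof.
split=> [[p bp]|].
  rewrite /cnt (bigD1 p) //= [in X in (_ < X)%N](bigD1 p) //= bp ltnn leqnn.
  by rewrite add0n add1n ltnS; apply: leq_sum => r _; case: ltnP => // /ltnW ->.
move=> lt; case: (pickP (fun p => b p == c)) => [p /eqP|no]; first by exists p.
by move: lt; rewrite (@cnt_eq b c n) ?ltnn // => r _; rewrite no.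
Qed.

(* For each j, the set of rows of [b] with at least j boxes is componentwise
   below that of [a]. *)
Definition keyle (b a : state) :=
  (forall j t, (cnt a j t <= cnt b j t)%N) /\ (forall j, cnt a j n = cnt b j n).

(** Rows are opened only by their own index; comparing this letter with the current one bounds the
    rows in use from below. *)
Lemma insertion_first X (b : state) r : run (@insertion n) X b -> (0 < b r)%N ->
  (r, (0%N, true)) \in X.
Proof.
elim=> [|v c p {}X {}b _ IH bp chb|v c p {}X {}b _ IH bp]; first by rewrite mnm0E.
  rewrite mnmDE mnm1E; case: (eqVneq p r) => [e|_].
    subst r; case: c bp chb => [|c] bp chb.
      by rewrite /insertion in chb; rewrite (eqP chb) mem_head.
    by move=> _; rewrite inE IH ?orbT // bp.
  by rewrite addn0 => /IH h; rewrite inE h orbT.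
by move=> /IH h; rewrite inE h orbT.
Qed.

Lemma ex_first (b : state) c p : b p = c ->
  exists2 q : 'I_n, b q = c & forall r : 'I_n, (r < q)%N -> b r != c.
Proof.
move=> bp; have [q /eqP bq mq] := arg_minnP (fun r : 'I_n => r : nat) (P := fun r => b r == c) (i0 := p) (introT eqP bp).
exists q => // r rq; apply: contraTneq rq => br; rewrite -leqNgt.
by apply: mq; apply/eqP.
Qed.

(* Reading the letters of [X] from the largest one grows [b] by [insertion];
   reading them from the smallest one empties [a] by [removal].  One letter
   changes a single level of [b] and of [a], and keeps [keyle] in both
   directions. *)
Lemma run_removalP X a : sorted (@ltl n) X ->
  run (@removal n) X a <-> exists2 b, run (@insertion n) X b & keyle b a.
Proof.
elim: X a => [|[v [c mk]] X IH] a.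
  move=> _; split=> [/run_nilE ->|[b /run_nilE -> [_ h]]].
    by exists 0%MM => //; apply: run_nil.
  suff -> : a = 0%MM by apply: run_nil.
  apply/mnmP => r; rewrite mnm0E; have := h 1%N; rewrite /cnt.
  rewrite [X in _ = X]big1 => [|i _]; last by rewrite mnm0E.
  by move=> /eqP; rewrite sum_nat_eq0 => /forall_inP/(_ r (ltn_ord r)); case: (a r).
move=> sX; have [sX1 mX] := sorted_cons_ltl sX.
(* In the first column, the letter opening a row in use is [ltl]-above [v] and hence strictly
   larger. *)
have low b r : run (@insertion n) X b -> (0 < b r)%N -> c = 0%N -> (v < r)%N.
  move=> rb br c0; have := mX _ (insertion_first rb br).
  by rewrite c0 /ltl /= ltnn andbF orbF.
case: mk sX mX => sX mX; last first.
  split.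
    move=> /run_cons[a' ra [-> [q aq]]]; have [b rb kb] := (IH _ sX1).1 ra.
    have [|p bp] := (cnt_lt b c.+1).2.
      by case: kb => _ h; rewrite -!h; apply/cnt_lt; exists q.
    by exists b => //; apply: run_free rb bp.
  move=> [b /run_cons[b' rb [-> [p bp]]] kb].
  have ra : run (@removal n) X a by apply/(IH _ sX1); exists b'.
  have [|q aq] := (cnt_lt a c.+1).2.
    by case: kb => _ h; rewrite !h; apply/cnt_lt; exists p.
  exact: run_free ra aq.
split.
- move=> /run_cons[a' ra [q [-> aq cha]]]; have [b' rb [k1 k2]] := (IH _ sX1).1 ra.
  suff [p [bp chb kb]] : exists p, [/\ b' p = c, insertion b' v c p &
      forall j t, (cnt (a' + U_(q)) j t <= cnt (b' + U_(p)) j t)%N].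
    exists (b' + U_(p))%MM; first exact: run_anchor.
    by split=> // j; rewrite !cntD k2 aq bp !ltn_ord.
  move: cha => /andP[/forallP ch1 ch2].
  case: c aq ch1 ch2 low {sX mX} => [|c] aq ch1 ch2 low.
    exists v; split.
    + by apply/eqP; rewrite -leqn0 leqNgt; apply/negP => /(low _ _ rb)/(_ erefl); rewrite ltnn.
    + by rewrite /insertion.
    + move=> j t; rewrite !cntD aq; have := k1 j t.
      have -> : b' v = 0%N.
        by apply/eqP; rewrite -leqn0 leqNgt; apply/negP => /(low _ _ rb)/(_ erefl); rewrite ltnn.
      by rewrite /= in ch2; lia.
  have [|p0 bp0] := (cnt_lt b' c.+1).2; first by rewrite -!k2; apply/cnt_lt; exists q.
  have [p bp mp] := ex_first bp0; exists p; split=> //.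
    by apply/forallP => r; apply/implyP; apply: mp.
  move=> j t; rewrite !cntD aq bp; have := k1 j t.
  (* Only level [c.+2] changes. Up to row [p], the first of length [c.+1], levels [c.+1] and [c.+2]
     of [b'] agree, so the inequality is inherited from level [c.+1]. *)
  case: (eqVneq j c.+2) => [->|_] /=; last by lia.
  case: (ltnP p t) => pt; first by case: (q < t)%N; lia.
  have := @cnt_eq b' c.+1 t (fun r rt => mp r (leq_trans rt pt)).
  have := k1 c.+1 t; have := @cnt_mono (a' + U_(q)) c.+1 c.+2 t (leqnSn _).
  rewrite !cntD aq eqxx; lia.
- move=> [b /run_cons[b' rb [p [-> bp chb]]] [k1 k2]].
  have [|q0 aq0] := (cnt_lt a c.+1).2.
    by rewrite !k2; apply/cnt_lt; exists p; rewrite mnmDE mnm1E eqxx bp addn1.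
  have [q aq mq] := ex_first aq0.
  pose a' := (a - U_(q))%MM; have ea : a = (a' + U_(q))%MM.
    by rewrite submK // lep1mP aq.
  have aq' : a' q = c by rewrite mnmBE mnm1E eqxx aq subn1.
  rewrite ea; apply: run_anchor => //.
    apply/(IH _ sX1); exists b' => //; split=> [j t|j]; last first.
      by have := k2 j; rewrite ea !cntD aq' bp !ltn_ord; lia.
    have := k1 j t; rewrite ea !cntD aq' bp.
    (* The mirror argument: up to row [q], levels [c.+1] and [c.+2] of [a] agree. *)
    case: (eqVneq j c.+1) => [->|_] /=; last by lia.
    case: (ltnP q t) => qt; first by case: (p < t)%N; lia.
    have := @cnt_eq a c.+1 t (fun r rt => mq r (leq_trans rt qt)).
    have := k1 c.+2 t; have := @cnt_mono b' c.+1 c.+2 t (leqnSn _).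
    rewrite ea !cntD aq' bp !eqxx; lia.
  rewrite /removal; apply/andP; split.
    apply/forallP => r; apply/implyP => rq; have := mq r rq.
    by rewrite mnmBE mnm1E; case: (eqVneq q r) => [e|_]; [rewrite e ltnn in rq|rewrite subn0].
  (* If [q < v], the rows of [b'] up to [q] are empty while row [q] of [a] is not, against
     [keyle]. *)
  apply/implyP => /eqP c0; rewrite leqNgt; apply/negP => qv.
  have := k1 1%N q.+1; rewrite ea !cntD aq' bp c0 eqxx ltnSn.
  have -> : cnt b' 1 q.+1 = 0%N.
    apply: big1 => r rq; case: (posnP (b' r)) => [_ //|br].
    by have := low _ _ rb br c0; lia.
  move: chb; rewrite /insertion c0 => /eqP ->; lia.
Qed.

End Key.

(** * Lascoux polynomials as sums of atoms; dominance for a fixed positive part *)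

Section Grouping.

Variable n : nat.

Local Notation letter := ('I_n * (nat * bool))%type.
Local Notation state := 'X_{1..n}.

Lemma gf_sum (I : finType) (Q : pred I) (P : I -> seq letter -> Prop) f :
  (forall i j X, P i X -> P j X -> i = j) -> (forall i, Q i -> gf (P i) (f i)) ->
  gf (fun X => exists2 i, Q i & P i X) (\sum_(i | Q i) f i).
Proof.
move=> dis hf.
suff H r : uniq r -> gf (fun X => exists2 i, (i \in r) && Q i & P i X) (\sum_(i <- r | Q i) f i).
  have := H (index_enum I) (index_enum_uniq I).
  move/gf_iff; apply=> X; split=> -[i]; first by move=> /andP[_ Qi]; exists i.
  by exists i; first rewrite mem_index_enum.
elim: r => [_|i r IH /= /andP[ir ur]].
  by exists [::] => //; split; [move=> X; split=> // -[] | rewrite !big_nil].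
rewrite big_cons; have [l ul [hl el]] := IH ur; case: ifPn => Qi; last first.
  exists l => //; split=> // X; rewrite hl; split=> -[j].
    by move=> /andP[jr Qj] Pj; exists j => //; rewrite inE jr orbT.
  rewrite inE => /andP[/orP[/eqP ->|jr] Qj] Pj; first by rewrite Qj in Qi.
  by exists j => //; rewrite jr.
have [li uli [hli eli]] := hf i Qi; exists (li ++ l).
  rewrite cat_uniq uli ul andbT; apply/hasPn => X /hl[j /andP[jr Qj] Pj].
  by apply/negP => /hli Pi; rewrite (dis _ _ _ Pi Pj) jr in ir.
split; last by rewrite big_cat /= -el -eli.
move=> X; rewrite mem_cat; split=> [/orP[/hli Pi|/hl[j /andP[jr Qj] Pj]]|[j]].
- by exists i => //; rewrite mem_head.
- by exists j => //; rewrite inE jr orbT.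
- rewrite inE => /andP[/orP[/eqP ->|jr] Qj] Pj; first by apply/orP; left; apply/hli.
  by apply/orP; right; apply/hl; exists j => //; rewrite jr.
Qed.

Lemma mnm_le_mdeg (b : state) r : (b r <= mdeg b)%N.
Proof. by rewrite mdegE (bigD1 r) //= leq_addr. Qed.

Definition keyleb (b a : state) : bool :=
  [forall t : 'I_n.+1, forall j : 'I_(mdeg a + mdeg b).+2,
     (cnt a j t <= cnt b j t)%N && (cnt a j n == cnt b j n)].

Lemma cnt_out (b : state) j t : (mdeg b < j)%N -> cnt b j t = 0%N.
Proof.
by move=> h; apply: big1 => r _; have := mnm_le_mdeg b r; lia.
Qed.

Lemma keylebP b a : reflect (keyle b a) (keyleb b a).
Proof.
apply: (iffP idP) => [h|[k1 k2]]; last first.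
  by apply/forallP => t; apply/forallP => j; rewrite k1 k2 /=.
have {}h j t : (t <= n)%N -> (cnt a j t <= cnt b j t)%N /\ cnt a j n = cnt b j n.
  move=> tn; case: (ltnP j (mdeg a + mdeg b).+2) => jm; last first.
    by rewrite !cnt_out //; lia.
  have /forallP/(_ (Ordinal jm))/andP[h1 /eqP h2] := (forallP h) (Ordinal (tn : t < n.+1)%N).
  by split.
split=> [j t|j]; last by have [] := h j n (leqnn n).
case: (leqP t n) => tn; first by have [] := h j t tn.
have E (c : state) : cnt c j t = cnt c j n.
  by apply: eq_bigl => r; rewrite ltn_ord (ltn_trans (ltn_ord r) tn).
by rewrite !E; have [] := h j n (leqnn n).
Qed.

Lemma insertion_det_word X (b b' : state) : sorted (@ltl n) X ->
  run (@insertion n) X b -> run (@insertion n) X b' -> b = b'.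
Proof.
move=> sX r1 r2.
have [Z rZ eZ] := run_zrun sX r1; have [Z' rZ' eZ'] := run_zrun sX r2.
have sZ : sorted (@ltz n) Z by rewrite sorted_ltz eZ.
by have [] := insertion_det sZ rZ rZ' (etrans eZ (esym eZ')).
Qed.

Lemma lascoux_atoms (a : state) : lascoux a =
  \sum_(b : 'X_{1..n < (mdeg a).+1} | keyleb b a) lascoux_atom b.
Proof.
have G := @gf_sum 'X_{1..n < (mdeg a).+1} (fun b => keyleb b a)
  (fun b X => sorted (@ltl n) X /\ run (@insertion n) X b) (@lascoux_atom n).
apply: gf_eq (lascoux_gf a) (G _ _) _ => {G}.
- by move=> b b' X [sX r1] [_ r2]; apply/val_inj; apply: insertion_det_word r1 r2.
- move=> b _; exact: lascoux_atom_gf.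
move=> X /=; split=> [[sX rX]|[b kb [sX rb]]].
  have [b rb kb] := (run_removalP a sX).1 rX.
  have db : (mdeg b < (mdeg a).+1)%N by rewrite (run_mdeg rb) (run_mdeg rX).
  by exists (BMultinom db) => //; apply/keylebP.
by split=> //; apply/(run_removalP a sX); exists b => //; apply/keylebP.
Qed.

(** A sum that ignores zeros sees only the nonempty rows, and those among the first [t] hold the
    first [cnt b 1 t] parts. With the positive part fixed, every such statistic depends on [cnt b 1]
    alone. *)
Lemma pos_sum (f : nat -> nat) (b : state) t : f 0%N = 0%N ->
  (\sum_(r < n | (r < t)%N) f (b r) = \sum_(x <- take (cnt b 1 t) (pos_part b)) f x)%N.
Proof.
move=> f0.
have E (g : nat -> nat) t' : (t' <= n)%N ->
    (\sum_(r < n | (r < t')%N) g (b r) = \sum_(x <- take t' b) g x)%N.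
  move=> tn; rewrite [RHS](big_nth 0%N) size_takel ?size_tuple // big_mkord.
  rewrite (big_ord_widen n (fun i => g (nth 0%N (take t' b) i)) tn).
  by apply: eq_bigr => r rt; rewrite nth_take // (mnm_nth 0%N).
have M (g : nat -> nat) : (\sum_(r < n | (r < t)%N) g (b r) = \sum_(r < n | (r < minn t n)%N) g (b r))%N.
  by apply: eq_bigl => r; rewrite leq_min ltn_ord andbT.
have cE : cnt b 1 t = count (leq 1) (take (minn t n) b).
  rewrite /cnt (M (fun x => (1 <= x)%N : nat)) (E (fun x => (1 <= x)%N : nat)) ?geq_minr // -sum1_count.
  by rewrite [RHS]big_mkcond /=; apply: eq_bigr => x _; case: (0 < x)%N.
rewrite M E ?geq_minr // cE /pos_part.
have -> : take (count (leq 1) (take (minn t n) b)) [seq k <- b | (0 < k)%N] =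
          [seq k <- take (minn t n) b | (0 < k)%N].
  rewrite -{2}(cat_take_drop (minn t n) b) filter_cat take_size_cat //.
  by rewrite size_filter.
by rewrite big_filter [RHS]big_mkcond /=; apply: eq_bigr => -[|x] _.
Qed.

Definition psum (b : state) t : nat := \sum_(r < n | (r < t)%N) b r.

Lemma dominatesP (b a : state) :
  reflect (forall t, (psum a t <= psum b t)%N) (dominates b a).
Proof.
apply: (iffP forallP) => [h [|t]|h k].
- by rewrite /psum !big1.
- case: (ltnP t n) => tn; first by have := h (Ordinal tn).
  case: (posnP n) => [n0|n0]; first by rewrite /psum big1 // => -[r rn]; exfalso; lia.
  have E (c : state) : psum c t.+1 = (\sum_(r < n | (r <= n.-1)%N) c r)%N.
    by apply: eq_bigl => r; have := ltn_ord r; lia.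
  have n1 : (n.-1 < n)%N by lia.
  by rewrite !E; have := h (Ordinal n1).
- exact: h k.+1.
Qed.

Lemma psumS (b : state) (r : 'I_n) : psum b r.+1 = (psum b r + b r)%N.
Proof.
rewrite /psum (bigD1 r) //= addnC; congr (_ + _)%N; apply: eq_bigl => i.
by rewrite -val_eqE /=; lia.
Qed.

Lemma psum_inj (a b : state) : (forall t, psum a t = psum b t) -> a = b.
Proof. by move=> h; apply/mnmP => r; have := psumS a r; rewrite !h psumS; lia. Qed.

Lemma dominates_refl (a : state) : dominates a a.
Proof. exact/dominatesP. Qed.

Lemma dominates_trans (b a c : state) : dominates a b -> dominates b c -> dominates a c.
Proof.
by move=> /dominatesP h /dominatesP h'; apply/dominatesP => t; apply: leq_trans (h' t) (h t).
Qed.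

(** A strictly increasing numerical rank for dominance: it serves to select minimal elements and to
    make the triangular reduction terminate. *)
Definition height (b : state) : nat := \sum_(t < n.+1) psum b t.

Lemma psum_out (b : state) t : (n <= t)%N -> psum b t = psum b n.
Proof. by move=> nt; apply: eq_bigl => r; have := ltn_ord r; lia. Qed.

Lemma dominates_height (b a : state) : dominates b a -> (height a <= height b)%N.
Proof. by move=> /dominatesP h; apply: leq_sum => t _. Qed.

Lemma dominates_eq (b a : state) : dominates b a -> (height b <= height a)%N -> b = a.
Proof.
move=> /dominatesP h le; apply: psum_inj => t.
have E : forall t : 'I_n.+1, psum b t = psum a t.
  move=> t'; have := h t'; rewrite leq_eqVlt => /orP[/eqP -> //|lt].
  suff : (height a < height b)%N by lia.
  rewrite /height (bigD1 t') //= [X in (_ < X)%N](bigD1 t') //= -addSn.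
  by apply: leq_add => //; apply: leq_sum.
case: (ltnP t n.+1) => tn; first exact: E (Ordinal tn).
rewrite !(@psum_out _ t) 1?ltnW //; exact: E ord_max.
Qed.

Lemma psum_pos (b : state) t : psum b t = sumn (take (cnt b 1 t) (pos_part b)).
Proof. by rewrite /psum (@pos_sum id) // sumnE. Qed.

Lemma cnt_pos (b : state) j t : (0 < j)%N ->
  cnt b j t = count (leq j) (take (cnt b 1 t) (pos_part b)).
Proof.
move=> j0; rewrite /cnt (@pos_sum (fun x => (j <= x)%N)) -/(cnt b 1 t); last by case: j j0.
by rewrite -sum1_count [RHS]big_mkcond /=; apply: eq_bigr => x _; case: (j <= x)%N.
Qed.

Lemma cnt_size (b : state) : cnt b 1 n = size (pos_part b).
Proof.
rewrite /cnt /pos_part size_filter -sum1_count.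
rewrite big_tuple [RHS]big_mkcond /= [LHS]big_mkcond /=; apply: eq_bigr => r _.
by rewrite ltn_ord mnm_tnth; case: (tnth b r).
Qed.

Lemma cnt_ge n' (b : state) t : (cnt b n' t <= cnt b n' n)%N.
Proof.
rewrite /cnt big_mkcond [X in (_ <= X)%N]big_mkcond /=; apply: leq_sum => r _.
by rewrite ltn_ord; case: ifP.
Qed.

(** Partial sums are sums of initial parts, and since parts are positive they grow strictly with the
    number of parts. *)
Lemma dominates_cnt (b a : state) : pos_part b = pos_part a ->
  dominates b a <-> (forall t, (cnt a 1 t <= cnt b 1 t)%N).
Proof.
move=> e; split=> [/dominatesP h t|h]; last first.
  apply/dominatesP => t; rewrite !psum_pos e -(cat_take_drop (cnt a 1 t) (take (cnt b 1 t) _)).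
  by rewrite sumn_cat take_takel // leq_addr.
rewrite leqNgt; apply/negP => lt; have := h t; rewrite !psum_pos e leqNgt => /negP; apply.
set s := take (cnt a 1 t) _.
have sz : size s = cnt a 1 t by rewrite size_takel // -cnt_size cnt_ge.
have -> : take (cnt b 1 t) (pos_part a) = take (cnt b 1 t) s by rewrite /s take_takel // ltnW.
have hp : all (leq 1) s by apply/allP => x /mem_take; rewrite mem_filter => /andP[].
rewrite -[in X in (_ < X)%N](cat_take_drop (cnt b 1 t) s) sumn_cat -[X in (X < _)%N]addn0 ltn_add2l.
have : (0 < size (drop (cnt b 1 t) s))%N by rewrite size_drop sz subn_gt0.
case E : (drop (cnt b 1 t) s) => [//|x s'] _ /=.
have /(allP hp) : x \in s by apply: (@mem_drop (cnt b 1 t)); rewrite E mem_head.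
by lia.
Qed.

End Grouping.

Lemma nnegp_Xn k : ('X ^+ k : {poly int}) \is a polyOver Num.nneg.
Proof. by apply/polyOverP => i; rewrite coefXn; case: eqP. Qed.

Lemma nnegp_nat (b : bool) : (b%:R : {poly int}) \is a polyOver Num.nneg.
Proof.
by apply/polyOverP => i; case: b; rewrite ?coef1 ?coef0 //; case: eqP.
Qed.

Lemma nnegp_sum (I : Type) (r : seq I) (P : pred I) (F : I -> {poly int}) :
  (forall i, P i -> F i \is a polyOver Num.nneg) ->
  \sum_(i <- r | P i) F i \is a polyOver Num.nneg.
Proof.
move=> h; apply/polyOverP => k; rewrite coef_sum -topredE /=.
by apply: sumr_ge0 => i /h/polyOverP/(_ k).
Qed.

(** * Lascoux polynomials as sums of quasiLascoux polynomials *)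

Section Refine.

Variable n : nat.

Local Notation letter := ('I_n * (nat * bool))%type.
Local Notation state := 'X_{1..n}.

Lemma cnt_sat (b : state) j t : (n <= t)%N -> cnt b j t = cnt b j n.
Proof. by move=> nt; apply: eq_bigl => r; have := ltn_ord r; lia. Qed.

Lemma cnt1_take (b : state) t : (t <= n)%N ->
  cnt b 1 t = size [seq k <- take t b | (0 < k)%N].
Proof.
move=> tn; rewrite size_filter -sum1_count big_mkcond /=.
rewrite (big_nth 0%N) size_takel ?size_tuple // big_mkord.
rewrite (big_ord_widen n (fun i => if (0 < nth 0%N (take t b) i)%N then 1%N else 0%N) tn).
by apply: eq_bigr => r rt; rewrite nth_take // (mnm_nth 0%N); case: (nth 0%N b r).
Qed.

Lemma cnt1S (b : state) t : (cnt b 1 t <= cnt b 1 t.+1 <= (cnt b 1 t).+1)%N.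
Proof.
case: (ltnP t n) => tn; last by rewrite !(@cnt_sat b 1) ?leqnn //; lia.
rewrite !cnt1_take // ?(ltnW tn) // (take_nth 0%N) ?size_tuple // filter_rcons.
by case: ifP => _; rewrite ?size_rcons leqnn leqnSn.
Qed.

Lemma mdeg_pos (b : state) : mdeg b = sumn (pos_part b).
Proof.
rewrite mdegE -[X in sumn X]take_size -cnt_size -psum_pos.
by apply: eq_bigl => r; rewrite ltn_ord.
Qed.

(* The pointwise minimum of the two counting functions still increases by steps
   of at most one, so it is the counting function of some [m]. *)
Lemma pos_meet (b1 b2 : state) : pos_part b1 = pos_part b2 ->
  exists2 m : state, pos_part m = pos_part b1 &
    forall t, cnt m 1 t = minn (cnt b1 1 t) (cnt b2 1 t).
Proof.
move=> e; set al := pos_part b1.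
pose k t := minn (cnt b1 1 t) (cnt b2 1 t).
have k0 : k 0%N = 0%N by rewrite /k /cnt big1 // min0n.
have kS t : (k t <= k t.+1 <= (k t).+1)%N.
  by have := cnt1S b1 t; have := cnt1S b2 t; rewrite /k; lia.
have kal t : (k t <= size al)%N.
  by rewrite /k /al -cnt_size; have := @cnt_ge n 1 b1 t; lia.
have alp i : (i < size al)%N -> (0 < nth 0%N al i)%N.
  by move=> /(mem_nth 0%N); rewrite mem_filter => /andP[].
pose f t := if (k t < k t.+1)%N then nth 0%N al (k t) else 0%N.
have F t : [seq x <- mkseq f t | (0 < x)%N] = take (k t) al.
  elim: t => [|t IH]; first by rewrite k0 take0.
  rewrite mkseqS filter_rcons IH /f; have := kS t; have := kal t.+1.
  case: (ltnP (k t) (k t.+1)) => lt kl kk /=.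
    by rewrite alp; [rewrite -take_nth; [congr take; lia|lia]|lia].
  by rewrite /=; congr take; lia.
pose m : state := [multinom f r | r < n].
have mE : m = mkseq f n :> seq nat.
  apply: (@eq_from_nth _ 0%N); rewrite size_tuple ?size_mkseq // => i ni.
  by rewrite -(mnm_nth 0%N m (Ordinal ni)) mnmE nth_mkseq.
have kn : k n = size al by rewrite /k /al [in RHS](esym (cnt_size b1)) !cnt_size e minnn.
exists m; first by rewrite {1}/pos_part mE F kn take_size.
have ct t : (t <= n)%N -> cnt m 1 t = k t.
  move=> tn; rewrite cnt1_take // mE.
  have -> : take t (mkseq f n) = mkseq f t.
    by rewrite /mkseq -map_take take_iota (minn_idPl tn).
  by rewrite F size_takel.
move=> t; case: (leqP t n) => tn; first exact: ct.
by rewrite !(@cnt_sat _ 1 t) ?ct // ltnW.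
Qed.

Lemma count_take_mono (T : Type) (p : pred T) (s : seq T) i j : (i <= j)%N ->
  (count p (take i s) <= count p (take j s))%N.
Proof.
by move=> ij; rewrite -[in X in (_ <= X)%N](cat_take_drop i (take j s)) take_takel // count_cat leq_addr.
Qed.

Lemma cnt0 (b b' : state) t : cnt b 0 t = cnt b' 0 t.
Proof. by apply: eq_bigr => r _. Qed.

Lemma keyle_mdeg (b a : state) : keyle b a -> mdeg b = mdeg a.
Proof.
move=> [_ h].
have E (c : state) M : (mdeg c <= M)%N -> mdeg c = (\sum_(j < M) cnt c j.+1 n)%N.
  move=> cM; rewrite /cnt exchange_big mdegE /= [RHS]big_mkcond /=.
  apply: eq_bigr => r _; rewrite ltn_ord.
  have : (c r <= M)%N by apply: leq_trans (mnm_le_mdeg c r) cM.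
  move: (c r) => x; elim: M {cM} => [|M IH]; first by rewrite big_ord0; case: x.
  rewrite leq_eqVlt => /orP[/eqP ->|xM].
    by rewrite (eq_bigr (fun=> 1%N)) ?sum1_card ?card_ord // => j _; rewrite ltn_ord.
  by rewrite big_ord_recr /= -IH // ltnNge -ltnS xM addn0.
apply: etrans (E b (mdeg a + mdeg b)%N (leq_addl _ _)) _.
apply: etrans _ (esym (E a (mdeg a + mdeg b)%N (leq_addr _ _))).
by apply: eq_bigr => j _; rewrite h.
Qed.

(** With the positive part fixed, going up in dominance raises [cnt _ 1], and each higher level
    counts large parts in a longer prefix. *)
Lemma keyle_up (b j a : state) : pos_part b = pos_part j -> dominates b j ->
  keyle j a -> keyle b a.
Proof.
move=> e /(dominates_cnt e) h [k1 k2]; split=> [i t|i].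
  case: i => [|i]; first by rewrite (cnt0 a b).
  apply: leq_trans (k1 _ _) _; rewrite !(@cnt_pos n _ i.+1) // e.
  exact: count_take_mono.
case: i => [|i]; first by rewrite (cnt0 a b).
by rewrite k2 !(@cnt_pos n _ i.+1) // !cnt_size e.
Qed.

(** Up to each row [t], the parts placed by [m] are those placed by [b1] or those placed by [b2], so
    there all levels agree with one of the two. *)
Lemma keyle_meet (b1 b2 m a : state) :
  pos_part m = pos_part b1 -> pos_part m = pos_part b2 ->
  (forall t, cnt m 1 t = minn (cnt b1 1 t) (cnt b2 1 t)) ->
  keyle b1 a -> keyle b2 a -> keyle m a.
Proof.
move=> e1 e2 h [k1 k1'] [k2 _]; split=> [[|i] t|[|i]].
- by rewrite (cnt0 a m).
- have := k1 i.+1 t; have := k2 i.+1 t.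
  rewrite !(@cnt_pos n _ i.+1 t) // -?e1 -?e2 h.
  by rewrite /minn; case: ifP.
- by rewrite (cnt0 a m).
- by rewrite k1' !(@cnt_pos n _ i.+1) // !cnt_size e1.
Qed.

(** For a fixed positive part, the indices of atoms under a key are closed under going up
    ([keyle_up]) and under meets ([keyle_meet]), so they are all the compositions above one of them.
    The coefficients are therefore 0 or 1. *)
Lemma lascoux_refines : refines (@lascoux n) (@quasi_lascoux n).
Proof.
move=> a; set B : finType := 'X_{1..n < (mdeg a).+1}.
pose P (b : B) := keyleb b a.
pose C (b b' : B) := P b' && (pos_part b' == pos_part b).
pose rep b := [arg min_(b' < b | C b b') height b'].
have repP b : P b -> C b (rep b) /\ (forall b', C b b' -> dominates b' (rep b)).
  move=> Pb; rewrite /rep; case: arg_minnP => [|j Cj mj]; first by rewrite /C Pb /=.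
  split=> // b' Cb'; have /andP[Pj /eqP ej] := Cj; have /andP[Pb' /eqP eb'] := Cb'.
  (* An element of least height lies below every [b']: its meet with [b'] is still in the class and
     cannot be lower. *)
  have [m em hm] := @pos_meet b' j (etrans eb' (esym ej)).
  have km : keyle m a.
    apply: keyle_meet hm _ _ => //; try exact/keylebP.
    by rewrite em eb' ej.
  have dm : (mdeg m < (mdeg a).+1)%N by rewrite (keyle_mdeg km).
  have Cm : C b (BMultinom dm).
    by rewrite /C /P /=; apply/andP; split; [apply/keylebP|rewrite em eb'].
  have ejm : bmnm j = m.
    apply: dominates_eq (mj _ Cm).
    by apply/dominates_cnt => [|t]; rewrite ?em ?ej ?eb' // hm geq_minr.
  rewrite ejm; apply/dominates_cnt => [|t]; first by rewrite em.
  by rewrite hm geq_minl.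
pose hit (j : state) := [exists b : B, P b && (bmnm (rep b) == j)].
exists [seq bmnm j | j <- enum B], (fun j => (hit j)%:R); split.
- by rewrite map_inj_uniq ?enum_uniq //; apply: val_inj.
- by move=> j; apply: nnegp_nat.
rewrite lascoux_atoms (partition_big rep predT) //= big_map big_enum /=.
apply: eq_bigr => j _; rewrite /hit; case: existsP => [[b0 /andP[Pb0 /eqP/val_inj rb0]]|no]; last first.
  rewrite scale0r big1 // => b /andP[Pb /eqP rb]; case: no; exists b.
  by apply/andP; split; [exact: Pb|rewrite rb eqxx].
rewrite scale1r /quasi_lascoux.
have [/andP[Pj ej] dj] := repP _ Pb0; rewrite rb0 in Pj ej dj.
have mj : mdeg j = mdeg a by apply: keyle_mdeg; apply/keylebP.
rewrite mj; apply: eq_bigl => b; apply/andP/andP => [[Pb /eqP rb]|[db /eqP eb]].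
  have [/andP[_ /eqP e] h] := repP _ Pb; rewrite rb in e h.
  by rewrite e eqxx; split=> //; apply: h; rewrite /C eqxx andbT.
have Pb : P b by apply/keylebP; apply: (keyle_up eb db); apply/keylebP.
split=> //; apply/eqP/val_inj => /=.
have [/andP[Pr /eqP er] h] := repP _ Pb.
apply: dominates_eq.
  by apply: dj; rewrite /C Pr er eb (eqP ej) /=.
by apply: dominates_height; apply: h; rewrite /C Pj eb eqxx.
Qed.

End Refine.

Lemma sum_collect (R : nzRingType) (V : lmodType R) (I : eqType) (l : seq (R * I)) (v : I -> V) :
  \sum_(x <- l) x.1 *: v x.2 =
  \sum_(i <- undup (map snd l)) (\sum_(x <- l | x.2 == i) x.1) *: v i.
Proof.
transitivity (\sum_(i <- undup (map snd l)) \sum_(x <- l) (if x.2 == i then x.1 *: v i else 0)).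
  rewrite exchange_big /= big_seq [RHS]big_seq; apply: eq_bigr => x xl.
  rewrite (bigD1_seq x.2) ?undup_uniq ?mem_undup ?map_f //= eqxx big1 ?addr0 //.
  by move=> i /negPf; rewrite eq_sym => ->.
by apply: eq_bigr => i _; rewrite -big_mkcond scaler_suml.
Qed.

Lemma refines_intro n (I J : eqType) (w : I -> {mpoly {poly int}[n]}) (v : J -> {mpoly {poly int}[n]}) :
  (forall a, exists2 l : seq ({poly int} * J),
     {in l, forall x, x.1 \is a polyOver Num.nneg} & w a = \sum_(x <- l) x.1 *: v x.2) ->
  refines w v.
Proof.
move=> h a; have [l hl ->] := h a.
exists (undup (map snd l)), (fun i => \sum_(x <- l | x.2 == i) x.1); split.
- exact: undup_uniq.
- by move=> i; rewrite big_seq_cond; apply: nnegp_sum => x /andP[/hl].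
- exact: sum_collect.
Qed.

(** * Triangularity and bases *)

Section Triangular.

Variable n : nat.

Local Notation letter := ('I_n * (nat * bool))%type.
Local Notation state := 'X_{1..n}.

Lemma quasi_refines_atoms : refines (@quasi_lascoux n) (@lascoux_atom n).
Proof.
move=> a; exists [seq bmnm b | b <- enum {: 'X_{1..n < (mdeg a).+1}}].
exists (fun b => (dominates b a && (pos_part b == pos_part a))%:R); split.
- by rewrite map_inj_uniq ?enum_uniq //; apply: val_inj.
- by move=> b; apply: nnegp_nat.
rewrite big_map big_enum /= /quasi_lascoux big_mkcond; apply: eq_bigr => b _.
by case: ifP; rewrite ?scale1r ?scale0r.
Qed.

Lemma psumD (a b : state) t : psum (a + b) t = (psum a t + psum b t)%N.
Proof. by rewrite /psum -big_split; apply: eq_bigr => r _; rewrite mnmDE. Qed.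

Lemma psum1 (p : 'I_n) t : psum U_(p) t = (p < t)%N.
Proof.
rewrite /psum big_mkcond (bigD1 p) //= mnm1E eqxx big1 ?addn0; first by case: (p < t)%N.
by move=> r; rewrite mnm1E eq_sym => /negPf ->; case: ifP.
Qed.

Lemma mon_cons v x X : mon ((v, x) :: X) = (U_(v) + mon X)%MM :> state.
Proof. by apply/mnmP => i; rewrite mnmDE mnm1E !mnmE. Qed.

(** Beyond the first column, row [p] was opened by the letter [p], read before [v]. *)
Lemma insertion_le v c mk X (b : state) p : sorted (@ltl n) ((v, (c, mk)) :: X) ->
  run (@insertion n) X b -> b p = c -> insertion b v c p -> (v <= p)%N.
Proof.
move=> sX rX bp; case: c sX bp => [|c] sX bp /=; first by move=> /eqP ->.
move=> _; have [_ mX] := sorted_cons_ltl sX.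
have := mX _ (insertion_first rX (r := p) _); rewrite bp => /(_ isT).
by rewrite /ltl /= -val_eqE /=; lia.
Qed.

(** An anchor adds to the weight at [v] what it adds to the shape at [p], and [v <= p]; free letters
    only add weight. *)
Lemma insertion_dominates X (b : state) : sorted (@ltl n) X ->
  run (@insertion n) X b -> dominates (mon X) b.
Proof.
move=> sX rX; apply/dominatesP => t.
elim: rX sX => [|v c p {}X {}b rX IH bp chb|v c p {}X {}b rX IH bp] sX.
- by rewrite /psum big1 // => r _; rewrite mnm0E.
- have [sX1 _] := sorted_cons_ltl sX; have := insertion_le sX rX bp chb.
  by rewrite mon_cons !psumD !psum1; have := IH sX1; lia.
- have [sX1 _] := sorted_cons_ltl sX.
  by rewrite mon_cons !psumD; have := IH sX1; lia.
Qed.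

(** Equality of weight and shape leaves no room for a free letter, nor for an anchor outside the row
    of its own value. The word of the leading monomial is thereby unique. *)
Lemma insertion_tight X (b : state) : sorted (@ltl n) X ->
  run (@insertion n) X b -> mon X = b ->
  forall v c mk, ((v, (c, mk)) \in X) = mk && (c < b v)%N.
Proof.
move=> sX rX; elim: rX sX => [|v c p {}X {}b rX IH bp chb|v c p {}X {}b rX IH bp] sX.
- by move=> _ v c mk; rewrite mnm0E andbF.
- have [sX1 _] := sorted_cons_ltl sX; have vp := insertion_le sX rX bp chb.
  have /dominatesP dom := insertion_dominates sX1 rX.
  rewrite mon_cons => e.
  have ep : v = p.
    apply/val_inj/eqP; rewrite eqn_leq vp /=; have := dom v.+1.
    by have := congr1 (fun m : state => psum m v.+1) e; rewrite !psumD !psum1 ltnSn; lia.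
  subst p; have eb : mon X = b.
    by apply/mnmP => r; have := congr1 (fun m : state => m r) e; rewrite !mnmDE; lia.
  move=> v1 c1 mk1; rewrite inE (IH sX1 eb) mnmDE mnm1E !xpair_eqE.
  case: (eqVneq v1 v) => [->|_] /=; last by rewrite addn0.
  by rewrite bp; case: mk1; rewrite ?andbF ?andbT //=; lia.
- have [sX1 _] := sorted_cons_ltl sX; have /dominatesP/(_ n) := insertion_dominates sX1 rX.
  rewrite mon_cons => le e; have := congr1 (fun m : state => psum m n) e.
  by rewrite !psumD !psum1 ltn_ord; lia.
Qed.

Lemma insertion_tight_ex (a : state) : exists X,
  [/\ sorted (@ltl n) X, run (@insertion n) X a & mon X = a].
Proof.
(* The word in which every row is filled with its own index is built from the top row down; [cut t]
   keeps the rows from [t] on. *)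
pose cut t : state := [multinom (if (t <= r)%N then a r else 0%N) | r < n].
suff H k : (k <= n)%N -> exists X, [/\ sorted (@ltl n) X, run (@insertion n) X (cut (n - k)%N),
    mon X = cut (n - k)%N & {in X, forall l : letter, (n - k <= l.1)%N}].
  have [X []] := H n (leqnn n); rewrite subnn.
  have -> : cut 0%N = a by apply/mnmP => r; rewrite mnmE.
  by move=> *; exists X.
elim: k => [_|k IH kn].
  exists [::]; rewrite subn0; have -> : cut n = 0%MM.
    by apply/mnmP => r; rewrite mnmE mnm0E leqNgt ltn_ord.
  by split=> //; apply: run_nil.
have [X [sX rX mX lX]] := IH (ltnW kn).
have hk : (n - k.+1 < n)%N by lia.
pose t : 'I_n := Ordinal hk.
have tE : (n - k = t.+1)%N by rewrite /=; lia.
have -> : (n - k.+1 = t)%N by [].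
rewrite tE in rX mX lX.
suff G c : (c <= a t)%N -> exists Y, [/\ sorted (@ltl n) Y,
    run (@insertion n) Y (cut t.+1 + U_(t) *+ c)%MM, mon Y = (cut t.+1 + U_(t) *+ c)%MM &
    {in Y, forall l : letter, (t < l.1)%N || ((l.1 == t) && (l.2.1 < c)%N)}].
  have [Y [sY rY mY lY]] := G (a t) (leqnn _).
  have eC : (cut t.+1 + U_(t) *+ a t)%MM = cut t.
    apply/mnmP => r; rewrite mnmDE mulmnE mnm1E !mnmE.
    case: (eqVneq t r) => [<-|ne] /=; first by rewrite ltnn leqnn mul1n.
    by rewrite mul0n addn0; rewrite -val_eqE /= in ne; rewrite ltn_neqAle ne.
  rewrite eC in rY mY; exists Y; split=> // l /lY.
  by rewrite -val_eqE /=; lia.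
elim: c => [_|c IHc ca].
  by exists X; rewrite mulm0n addm0; split=> // l /lX => ->.
have [Y [sY rY mY lY]] := IHc (ltnW ca).
exists ((t, (c, true)) :: Y).
have e1 : (cut t.+1 + U_(t) *+ c.+1 = cut t.+1 + U_(t) *+ c + U_(t))%MM.
  by rewrite mulmSr addmA.
split.
- rewrite /= (path_sortedE (@ltl_trans n)) sY andbT; apply/allP => l /lY.
  by rewrite /ltl /= eq_sym.
- rewrite e1; apply: run_anchor rY _ _.
    by rewrite mnmDE mulmnE mnm1E !mnmE eqxx ltnn mul1n.
  case: c {IHc ca mY lY e1} => [|c]; rewrite /insertion //.
  apply/forallP => r; apply/implyP => rt.
  rewrite mnmDE mulmnE mnm1E !mnmE ltnNge (ltnW rt) /=.
  by have /negPf -> : t != r by rewrite -val_eqE /= eq_sym (ltn_eqF rt).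
- by rewrite mon_cons mY e1 addmC.
- move=> l; rewrite inE => /orP[/eqP ->|/lY]; first by rewrite eqxx ltnSn orbT.
  by move=> /orP[->//|/andP[-> /ltnW h]]; rewrite ltnS h orbT.
Qed.

Lemma gf_mcoeff (P : seq letter -> Prop) f m : gf P f -> f@_m != 0 -> exists2 X, P X & mon X = m.
Proof.
move=> [l _ [hl ->]]; rewrite raddf_sum /= => ne.
case: (boolP (has (fun X => mon X == m) l)) => [/hasP[X /hl PX /eqP e]|/hasPn no].
  by exists X.
case/eqP: ne; rewrite big_seq big1 // => X /no /negPf e.
by rewrite /wgt mcoeffZ mcoeffX e mulr0.
Qed.

Lemma atom_lead (a : state) : (lascoux_atom a)@_a = 1.
Proof.
have [l ul [hl ->]] := lascoux_atom_gf a.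
have [X0 [s0 r0 m0]] := insertion_tight_ex a.
have X0l : X0 \in l by apply/hl.
rewrite raddf_sum /= (bigD1_seq X0) //= big1_seq ?addr0.
  rewrite /wgt mcoeffZ mcoeffX m0 eqxx mulr1.
  have -> : count (fun l0 : letter => ~~ l0.2.2) X0 = 0%N.
    apply/eqP; rewrite -leqn0 leqNgt -has_count; apply/hasPn => -[v [c mk]].
    by rewrite (insertion_tight s0 r0 m0) => /andP[-> _].
  by rewrite expr0.
move=> X /andP[ne /hl[sX rX]]; rewrite /wgt mcoeffZ mcoeffX.
case: eqP => [e|_]; last by rewrite mulr0.
case/eqP: ne; apply: (irr_sorted_eq (@ltl_trans n) (@ltl_irr n) sX s0).
by move=> [v [c mk]]; rewrite (insertion_tight sX rX e) (insertion_tight s0 r0 m0).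
Qed.

Lemma insertion_col X (b : state) : run (@insertion n) X b ->
  {in X, forall l : letter, exists p, (l.2.1 < b p)%N}.
Proof.
elim=> [|v c p {}X {}b rX IH bp chb|v c p {}X {}b rX IH bp] // l.
  rewrite inE => /orP[/eqP ->|/IH[p' h]].
    by exists p; rewrite mnmDE mnm1E eqxx bp addn1.
  by exists p'; rewrite mnmDE; lia.
rewrite inE => /orP[/eqP ->|/IH //].
by exists p; rewrite bp.
Qed.

(** The bound on exponents holds because equal entries lie in different columns, and there are at
    most [m] columns. *)
Lemma atom_supp (a b : state) : (lascoux_atom a)@_b != 0 ->
  dominates b a /\ (forall m, (forall r, (a r <= m)%N) -> forall r, (b r <= m)%N).
Proof.
move=> /(gf_mcoeff (lascoux_atom_gf a))[X [sX rX] <-]; split.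
  exact: insertion_dominates.
move=> m am r; rewrite mnmE -size_filter.
set Y := [seq l <- X | _].
have uY : uniq [seq l.2.1 | l <- Y].
  rewrite map_inj_in_uniq.
    exact/filter_uniq/(sorted_uniq (@ltl_trans n) (@ltl_irr n) sX).
  move=> l l'; rewrite !mem_filter => /andP[/eqP e1 h1] /andP[/eqP e2 h2] e.
  have [Z rZ eZ] := run_zrun sX rX; have sZ : sorted (@ltz n) Z by rewrite sorted_ltz eZ.
  move: h1 h2; rewrite -eZ => /mapP[z zZ ez] /mapP[z' zZ' ez'].
  by rewrite ez ez' (sorted_ltz_inj sZ zZ zZ') // -?ez -?ez' // e1 e2.
rewrite -(size_map (fun l : letter => l.2.1)) -(size_iota 0 m); apply: uniq_leq_size => // c.
move=> /mapP[l]; rewrite mem_filter => /andP[_ /(insertion_col rX)[p h]] ->.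
by rewrite mem_iota; have := am p; lia.
Qed.

Lemma quasi_supp (a b : state) : (quasi_lascoux a)@_b != 0 ->
  dominates b a /\ (forall m, (forall r, (a r <= m)%N) -> forall r, (b r <= m)%N).
Proof.
rewrite /quasi_lascoux raddf_sum /= => ne.
suff [a' /andP[da' /eqP pa'] h] : exists2 a' : state, dominates a' a && (pos_part a' == pos_part a) &
    (lascoux_atom a')@_b != 0.
  have [d1 b1] := atom_supp h; split; first exact: dominates_trans d1 da'.
  move=> m am; apply: b1 => r; case: (posnP (a' r)) => [-> //|r0].
  have : a' r \in pos_part a' by rewrite mem_filter r0 mnm_tnth mem_tnth.
  by rewrite pa' mem_filter => /andP[_ /tnthP[i ->]]; rewrite -mnm_tnth.
case: (pickP (fun b' : 'X_{1..n < (mdeg a).+1} =>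
    (dominates b' a && (pos_part b' == pos_part a)) && ((lascoux_atom b')@_b != 0))).
  by move=> b' /andP[h1 h2]; exists b'.
move=> no; case/eqP: ne; rewrite big1 // => b' h; have := no b'.
by rewrite h => /negbFE/eqP.
Qed.

Lemma quasi_lead (a : state) : (quasi_lascoux a)@_a = 1.
Proof.
rewrite /quasi_lascoux raddf_sum /= (bigD1 (BMultinom (ltnSn (mdeg a)))) /=; last first.
  by rewrite dominates_refl eqxx.
rewrite atom_lead big1 ?addr0 // => b /andP[/andP[db _]] ne.
apply/eqP; apply: contraNT ne => /atom_supp[d _].
by apply/eqP/val_inj; apply: dominates_eq db _; apply: dominates_height.
Qed.

Definition in_span (p : {mpoly {poly int}[n]}) := exists l : seq ({poly int} * state),
  p = \sum_(x <- l) x.1 *: quasi_lascoux x.2.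

Lemma in_spanZ c p : in_span p -> in_span (c *: p).
Proof.
move=> [l ->]; exists [seq (c * x.1, x.2) | x <- l].
by rewrite big_map scaler_sumr; apply: eq_bigr => x _; rewrite scalerA.
Qed.

Lemma in_spanD p q : in_span p -> in_span q -> in_span (p + q).
Proof. by move=> [l ->] [l' ->]; exists (l ++ l'); rewrite big_cat. Qed.

Lemma in_span_sum (I : eqType) (r : seq I) (F : I -> {mpoly {poly int}[n]}) :
  {in r, forall i, in_span (F i)} -> in_span (\sum_(i <- r) F i).
Proof.
elim: r => [|i r IH] h; first by exists [::]; rewrite !big_nil.
rewrite big_cons; apply: in_spanD; first by apply: h; rewrite mem_head.
by apply: IH => j jr; apply: h; rewrite inE jr orbT.
Qed.

Lemma height_bound (b : state) m : (forall r, b r <= m)%N -> (height b <= n.+1 * (n * m))%N.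
Proof.
move=> h; rewrite /height -[n.+1 in X in (_ <= X)%N]card_ord -sum_nat_const.
apply: leq_sum => t _; rewrite -[n in X in (_ <= X)%N]card_ord -sum_nat_const /psum big_mkcond /=.
by apply: leq_sum => r _; case: ifP.
Qed.

Lemma monomial_quasi (a : state) : 'X_[a] = quasi_lascoux a +
    \sum_(b <- msupp (quasi_lascoux a) | b != a) (- (quasi_lascoux a)@_b) *: 'X_[b].
Proof.
have aS : a \in msupp (quasi_lascoux a) by rewrite mcoeff_msupp quasi_lead oner_neq0.
rewrite {1}(mpolyE (quasi_lascoux a)) (bigD1_seq a) ?msupp_uniq //=.
rewrite quasi_lead scale1r -addrA -big_split big1 ?addr0 // => b _.
by rewrite /= -scalerDl addrN scale0r.
Qed.

(* Each column of a filling contains a given entry at most once, so the box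
   [0, m]^n of exponents is stable: the triangular reduction stays in it and
   stops although degrees increase. *)
Lemma monomial_in_span (a : state) : in_span 'X_[a].
Proof.
pose m := mdeg a; have am r : (a r <= m)%N by apply: mnm_le_mdeg.
move: m am => m am.
(* The decreasing measure is the distance from the height of [a] to a bound for all heights in the
   box of exponents at most [m]. *)
have [k hk] : exists k, (n.+1 * (n * m) - height a < k)%N by eexists; exact: ltnSn.
move: hk am; elim: k a => [//|k IH] a hk am.
rewrite monomial_quasi -big_filter; apply: in_spanD.
  by exists [:: (1, a)]; rewrite big_seq1 scale1r.
apply: in_span_sum => b; rewrite mem_filter mcoeff_msupp => /andP[ne /quasi_supp[db bm]].
have lt : (height a < height b)%N.
  by rewrite ltnNge; apply/negP => /(dominates_eq db) e; rewrite e eqxx in ne.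
have hb := height_bound (bm m am).
by apply/in_spanZ/IH; [lia|exact: bm].
Qed.

(** At an index of least height among those with nonzero [c], the coefficient of the sum comes from
    that index alone, by triangularity. *)
Lemma quasi_independent (s : seq state) (c : state -> {poly int}) : uniq s ->
  \sum_(i <- s) c i *: quasi_lascoux i = 0 -> {in s, forall i, c i = 0}.
Proof.
move=> us e a0 a0s; apply/eqP/negPn/negP => ca0.
pose P k := has (fun a => (c a != 0) && (height a == k)) s.
have exP : exists k, P k by exists (height a0); apply/hasP; exists a0; rewrite ?ca0 ?eqxx.
case: (ex_minnP exP) => k /hasP[a as' /andP[ca /eqP ha]] mk.
have := congr1 (mcoeff a) e; rewrite mcoeff0 raddf_sum /= (bigD1_seq a) //=.
rewrite mcoeffZ quasi_lead mulr1 big1_seq ?addr0; first by move=> e'; rewrite e' eqxx in ca.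
move=> b /andP[ne bs]; rewrite mcoeffZ; case: (eqVneq (c b) 0) => [->|cb]; first by rewrite mul0r.
case: (eqVneq (quasi_lascoux b)@_a 0) => [->|/quasi_supp[d _]]; first by rewrite mulr0.
case/eqP: ne; apply/esym/(dominates_eq d).
by rewrite ha; apply: mk; apply/hasP; exists b => //; rewrite cb eqxx.
Qed.

Lemma quasi_basis : is_basis (fun _ => True) (@quasi_lascoux n).
Proof.
split=> //; first exact: quasi_independent.
move=> p _; suff [l ->] : in_span p.
  exists (undup (map snd l)), (fun i => \sum_(x <- l | x.2 == i) x.1).
  exact: sum_collect.
rewrite (mpolyE p); apply: in_span_sum => b _.
exact/in_spanZ/monomial_in_span.
Qed.

End Triangular.

(** * Positive parts and quasisymmetry *)

Fixpoint bump (c : nat) (s : seq nat) : seq nat :=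
  if s is x :: s' then if x == c then c.+1 :: s' else x :: bump c s' else [::].

(* The action of a word on the positive part of the state: it only depends on
   the columns and marks. *)
Fixpoint comp_run (P : seq (nat * bool)) : option (seq nat) :=
  if P is (c, mk) :: P' then
    if comp_run P' is Some mu then
      if mk then
        if c is 0 then Some (1%N :: mu) else if c \in mu then Some (bump c mu) else None
      else if c.+1 \in mu then Some mu else None
    else None
  else Some [::].

Lemma bump_cat c s1 s2 : c \notin s1 -> bump c (s1 ++ c :: s2) = s1 ++ c.+1 :: s2.
Proof.
elim: s1 => [|x s IH] /=; first by rewrite eqxx.
by rewrite inE negb_or eq_sym => /andP[/negPf -> /IH ->].
Qed.

Section Composition.

Variable n : nat.

Local Notation letter := ('I_n * (nat * bool))%type.
Local Notation state := 'X_{1..n}.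

Lemma mem_pos (b : state) x : (x \in pos_part b) <-> (0 < x)%N /\ exists p, b p = x.
Proof.
rewrite mem_filter; split=> [/andP[x0 /tnthP[p e]]|[-> [p <-]]].
  by split=> //; exists p; rewrite mnm_tnth.
by rewrite mnm_tnth mem_tnth.
Qed.

Lemma seq_addU (b : state) p : (b + U_(p))%MM = take p b ++ (b p).+1 :: drop p.+1 b :> seq nat.
Proof.
have pn : (p < size b)%N by rewrite size_tuple.
apply: (@eq_from_nth _ 0%N) => [|i].
  rewrite size_cat /= size_drop (size_takel (ltnW pn)) !size_tuple card_ord.
  by have := ltn_ord p; lia.
rewrite size_tuple => ni; rewrite -(mnm_nth 0%N _ (Ordinal ni)) mnmDE mnm1E nth_cat.
rewrite size_takel ?(ltnW pn) // -val_eqE /= (mnm_nth 0%N b) /=.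
case: (ltngtP i p) => ip.
- by rewrite nth_take // addn0.
- have -> : (i - p = (i - p.+1).+1)%N by lia.
  by rewrite /= nth_drop subnKC // addn0.
- by rewrite ip subnn /= (mnm_nth 0%N b) addn1.
Qed.

Lemma seq_split (b : state) (p : 'I_n) : b = take p b ++ b p :: drop p.+1 b :> seq nat.
Proof.
by rewrite -[LHS](cat_take_drop p) (drop_nth 0%N) ?size_tuple // (mnm_nth 0%N).
Qed.

Lemma mem_take_state (b : state) (p : 'I_n) x : x \in take p b ->
  exists2 r : 'I_n, (r < p)%N & b r = x.
Proof.
move=> /(nthP 0%N)[i]; rewrite size_takel ?size_tuple; last exact: ltnW.
move=> ip; rewrite nth_take // => <-.
by exists (Ordinal (ltn_trans ip (ltn_ord p))); rewrite ?(mnm_nth 0%N).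
Qed.

Lemma pos_new (b : state) p : b p = 0%N -> (forall r : 'I_n, (r < p)%N -> b r = 0%N) ->
  pos_part (b + U_(p))%MM = 1%N :: pos_part b.
Proof.
move=> bp h; rewrite /pos_part seq_addU {3}(seq_split b p) !filter_cat bp /=.
have -> // : [seq k <- take p b | (0 < k)%N] = [::].
apply/eqP; rewrite -size_eq0 size_filter -leqn0 leqNgt -has_count; apply/hasPn => x.
by move=> /mem_take_state[r /h -> <-].
Qed.

Lemma pos_bump (b : state) p c : b p = c -> (0 < c)%N ->
  (forall r : 'I_n, (r < p)%N -> b r != c) ->
  pos_part (b + U_(p))%MM = bump c (pos_part b).
Proof.
move=> bp c0 h; rewrite /pos_part seq_addU {3}(seq_split b p) !filter_cat bp /= c0.
rewrite bump_cat // mem_filter c0 /=; apply/negP => /mem_take_state[r /h].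
by move=> /eqP ne /ne.
Qed.

Lemma insertion_low v c mk X (b : state) : sorted (@ltl n) ((v, (c, mk)) :: X) ->
  run (@insertion n) X b -> c = 0%N -> forall r, (0 < b r)%N -> (v < r)%N.
Proof.
move=> sX rX c0 r br; have [_ mX] := sorted_cons_ltl sX.
have := mX _ (insertion_first rX br).
by rewrite c0 /ltl /= ltnn andbF orbF.
Qed.

(** A row is opened below all rows in use, which puts a new part 1 in front; otherwise the lowest
    row of length [c] grows, that is, the first part equal to [c]. *)
Lemma run_comp X (b : state) : sorted (@ltl n) X -> run (@insertion n) X b ->
  comp_run (map snd X) = Some (pos_part b).
Proof.
move=> sX rX; elim: rX sX => [|v c p {}X {}b rX IH bp chb|v c p {}X {}b rX IH bp] sX /=.
- congr Some; apply/esym/eqP; rewrite -size_eq0 -leqn0 leqNgt -has_predT.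
  by apply/hasPn => x /mem_pos[x0 [p]]; rewrite mnm0E => e; rewrite -e in x0.
- have [sX1 _] := sorted_cons_ltl sX; rewrite IH //.
  case: c bp chb sX => [|c] bp chb sX.
    have low := insertion_low sX rX erefl.
    rewrite /insertion in chb; rewrite (eqP chb) in bp *.
    rewrite pos_new // => r rv; apply/eqP; rewrite -leqn0 leqNgt; apply/negP => /low; lia.
  have -> : c.+1 \in pos_part b by apply/mem_pos; split=> //; exists p.
  by rewrite (pos_bump bp) // => r rp; have /forallP/(_ r) := chb; rewrite rp.
- have [sX1 _] := sorted_cons_ltl sX; rewrite IH //.
  by have -> : c.+1 \in pos_part b by apply/mem_pos; split=> //; exists p.
Qed.

Lemma comp_run_ex X mu : sorted (@ltl n) X -> comp_run (map snd X) = Some mu ->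
  exists2 b : state, run (@insertion n) X b & pos_part b = mu.
Proof.
move=> sX e; suff [b rb] : exists b, run (@insertion n) X b.
  by exists b => //; have := run_comp sX rb; rewrite e => -[].
elim: X mu sX e => [|[v [c mk]] X IH] mu sX /=; first by exists 0%MM; apply: run_nil.
have [sX1 _] := sorted_cons_ltl sX.
case E : (comp_run _) => [nu|] //; have [b rb] := IH _ sX1 E.
move: E; rewrite (run_comp sX1 rb) => -[<-].
case: mk sX => sX; last first.
  by case: ifP => // /mem_pos[_ [p bp]] _; exists b; apply: run_free rb bp.
case: c sX => [|c] sX.
  move=> _; have low := insertion_low sX rb erefl.
  exists (b + U_(v))%MM; apply: run_anchor rb _ _; rewrite /insertion //.
  by apply/eqP; rewrite -leqn0 leqNgt; apply/negP => /low; rewrite ltnn.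
case: ifP => // /mem_pos[_ [p0 bp0]] _; have [p bp mp] := ex_first bp0.
exists (b + U_(p))%MM; apply: run_anchor rb bp _.
by apply/forallP => r; apply/implyP; apply: mp.
Qed.

Lemma quasi_lascoux_gf (a : state) :
  gf (fun X => sorted (@ltl n) X /\ exists2 b, run (@insertion n) X b &
        dominates b a /\ pos_part b = pos_part a) (quasi_lascoux a).
Proof.
have G := @gf_sum n 'X_{1..n < (mdeg a).+1}
  (fun b => dominates b a && (pos_part b == pos_part a))
  (fun b X => sorted (@ltl n) X /\ run (@insertion n) X b) (@lascoux_atom n).
apply: gf_iff (G _ _) _ => {G}.
- by move=> b b' X [sX r1] [_ r2]; apply/val_inj; apply: insertion_det_word r1 r2.
- by move=> b _; exact: lascoux_atom_gf.
move=> X /=; split=> [[b /andP[db /eqP pb] [sX rb]]|[sX [b rb [db pb]]]].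
  by split=> //; exists b.
have mb : (mdeg b < (mdeg a).+1)%N by rewrite !mdeg_pos pb.
by exists (BMultinom mb) => //=; rewrite db pb eqxx.
Qed.

Lemma quasi_grothendieck_gf (al : seq nat) :
  gf (fun X => sorted (@ltl n) X /\ comp_run (map snd X) = Some al) (quasi_grothendieck n al).
Proof.
have G := @gf_sum n 'X_{1..n < (sumn al).+1} (fun b => pos_part b == al)
  (fun b X => sorted (@ltl n) X /\ run (@insertion n) X b) (@lascoux_atom n).
apply: gf_iff (G _ _) _ => {G}.
- by move=> b b' X [sX r1] [_ r2]; apply/val_inj; apply: insertion_det_word r1 r2.
- by move=> b _; exact: lascoux_atom_gf.
move=> X /=; split=> [[b /eqP pb [sX rb]]|[sX /(comp_run_ex sX)[b rb pb]]].
  by split=> //; rewrite (run_comp sX rb) pb.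
have mb : (mdeg b < (sumn al).+1)%N by rewrite mdeg_pos pb.
by exists (BMultinom mb) => //=; rewrite pb.
Qed.

Lemma perm_mon (b : state) X : mon X = b ->
  perm_eq (map fst X) (flatten [seq nseq (b i) i | i <- enum 'I_n]).
Proof.
move=> <-; apply/allP => i _ /=; rewrite count_map count_flatten -map_comp.
rewrite sumnE big_map big_enum /= (bigD1 i) //= big1 ?addn0.
  by rewrite count_nseq /= eqxx mul1n mnmE.
by move=> j /negPf ne; rewrite count_nseq /= ne.
Qed.

Lemma mon_eqP X (b : state) : mon X = b <->
  perm_eq (map fst X) (flatten [seq nseq (b i) i | i <- enum 'I_n]).
Proof.
split; first exact: perm_mon.
move=> /permP h; apply/mnmP => i; have := h (pred1 i).
rewrite mnmE count_map => ->; rewrite count_flatten -map_comp.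
rewrite sumnE big_map big_enum /= (bigD1 i) //= big1 ?addn0.
  by rewrite count_nseq /= eqxx mul1n.
by move=> j /negPf ne; rewrite count_nseq /= ne.
Qed.

Lemma pos_part_nz (b : state) : pos_part b = map b (nz_positions b).
Proof.
rewrite /nz_positions -filter_map; congr filter.
apply: (@eq_from_nth _ 0%N) => [|i]; first by rewrite size_tuple size_map size_enum_ord.
rewrite size_tuple => ni; rewrite (nth_map (Ordinal ni)) ?size_enum_ord //.
by rewrite (mnm_nth 0%N) nth_enum_ord.
Qed.

Lemma sorted_nz (b : state) : sorted (fun i j : 'I_n => (i < j)%N) (nz_positions b).
Proof.
apply: sorted_filter; first by move=> y x z; apply: ltn_trans.
by have := iota_ltn_sorted 0 n; rewrite -val_enum_ord sorted_map.
Qed.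

Lemma uniq_nz (b : state) : uniq (nz_positions b).
Proof. by rewrite filter_uniq ?enum_uniq. Qed.

Lemma flatten_nz (b : state) : flatten [seq nseq (b i) i | i <- enum 'I_n] =
  flatten [seq nseq (b i) i | i <- nz_positions b].
Proof.
by rewrite /nz_positions; elim: (enum 'I_n) => //= i s IH; case E : (b i) => [|m] /=; rewrite ?E IH.
Qed.

Section Relabel.

Variables b b' : state.
Hypothesis eb : pos_part b = pos_part b'.

(** On the support of [b], this is the order isomorphism onto the support of [b']. *)
Definition relabel (i : 'I_n) : 'I_n := nth i (nz_positions b') (index i (nz_positions b)).

Let sz : size (nz_positions b) = size (nz_positions b').
Proof. by rewrite -(size_map b) -pos_part_nz eb pos_part_nz size_map. Qed.

Lemma relabel_val i : i \in nz_positions b -> b' (relabel i) = b i.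
Proof.
move=> h; have h1 : (index i (nz_positions b) < size (nz_positions b))%N by rewrite index_mem.
have : nth 0%N (pos_part b') (index i (nz_positions b)) = nth 0%N (pos_part b) (index i (nz_positions b)).
  by rewrite eb.
by rewrite !pos_part_nz !(nth_map i) -?sz // nth_index.
Qed.

Lemma relabel_map : map relabel (nz_positions b) = nz_positions b'.
Proof.
case E : (nz_positions b) => [|x0 s0].
  by move: sz; rewrite E => /esym/size0nil ->.
apply: (@eq_from_nth _ x0) => [|k]; first by rewrite size_map -E.
rewrite size_map => ks; rewrite (nth_map x0) // -E /relabel index_uniq ?E //.
  by apply: set_nth_default; rewrite -sz E.
by rewrite -E filter_uniq ?enum_uniq.
Qed.

Lemma relabel_lt i j : i \in nz_positions b -> j \in nz_positions b -> (i < j)%N ->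
  (relabel i < relabel j)%N.
Proof.
move=> hi hj ij.
have tr : transitive (fun x y : 'I_n => (x < y)%N) by move=> y x z; apply: ltn_trans.
have ii : (index i (nz_positions b) < index j (nz_positions b))%N.
  rewrite ltnNge; apply/negP; rewrite leq_eqVlt => /orP[/eqP e|lt].
    by move: ij; rewrite -{1}(nth_index i hi) -{1}(nth_index i hj) e ltnn.
  have := @sorted_ltn_nth _ _ tr i _ (sorted_nz b) (index j (nz_positions b)) (index i (nz_positions b)).
  by rewrite !inE !index_mem hi hj !nth_index // => /(_ isT isT lt); lia.
rewrite /relabel (set_nth_default i j) -?sz ?index_mem //.
by apply: (@sorted_ltn_nth _ _ tr i _ (sorted_nz b')); rewrite ?inE -?sz ?index_mem.
Qed.

Lemma relabel_word X : sorted (@ltl n) X -> mon X = b ->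
  let X' := [seq (relabel l.1, l.2) | l <- X] in
  [/\ sorted (@ltl n) X', mon X' = b' & map snd X' = map snd X].
Proof.
move=> sX mX X'.
have hX l : l \in X -> l.1 \in nz_positions b.
  move=> lX; rewrite mem_filter mem_enum andbT -mX mnmE -has_count.
  by apply/hasP; exists l.
split; last by rewrite -map_comp.
- rewrite sorted_map; apply: (sub_in_sorted _ (allss X) sX) => l l' lX l'X.
  rewrite /ltl /= => /orP[lt|/andP[/eqP -> ->]].
    by rewrite relabel_lt ?hX.
  by rewrite eqxx orbT.
- apply/mon_eqP; rewrite -map_comp.
  have -> : [seq (fst \o (fun l : letter => (relabel l.1, l.2))) i | i <- X] = map relabel (map fst X).
    by rewrite -map_comp.
  apply: perm_trans (perm_map _ (perm_mon mX)) _.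
  rewrite !flatten_nz -relabel_map map_flatten -!map_comp.
  suff -> : [seq (map relabel \o (fun i => nseq (b i) i)) i | i <- nz_positions b] =
            [seq ((fun i => nseq (b' i) i) \o relabel) i | i <- nz_positions b] by [].
  by apply/eq_in_map => i hi /=; rewrite map_nseq relabel_val.
Qed.

End Relabel.

Lemma relabelK (b b' : state) i : pos_part b = pos_part b' -> i \in nz_positions b ->
  relabel b' b (relabel b b' i) = i.
Proof.
move=> e hi; rewrite /relabel.
have sz : size (nz_positions b) = size (nz_positions b').
  by rewrite -(size_map b) -pos_part_nz e pos_part_nz size_map.
rewrite index_uniq ?uniq_nz -?sz ?index_mem //.
by rewrite (set_nth_default i) ?index_mem // nth_index.
Qed.

(** Relabelling the support is a bijection between the words of weight [b] and those of weight [b'].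
    It leaves columns and marks alone, hence also the composition and the power of [beta]. *)
Lemma quasisymmetric_grothendieck (al : seq nat) : quasisymmetric (quasi_grothendieck n al).
Proof.
have [l ul [hl ->]] := quasi_grothendieck_gf al.
move=> b b' e.
have E (c : state) : (\sum_(X <- l) wgt X)@_c =
    \sum_(X <- [seq X <- l | mon X == c]) 'X ^+ count (fun l0 : letter => ~~ l0.2.2) X.
  rewrite raddf_sum /= big_filter [RHS]big_mkcond /=; apply: eq_bigr => X _.
  by rewrite /wgt mcoeffZ mcoeffX; case: eqP; rewrite ?mulr1 ?mulr0.
rewrite !E.
pose phi (c c' : state) X := [seq (relabel c c' l0.1, l0.2) | l0 : letter <- X].
have phiP (c c' : state) X : pos_part c = pos_part c' -> X \in [seq X <- l | mon X == c] ->
    phi c c' X \in [seq X <- l | mon X == c'] /\ phi c' c (phi c c' X) = X.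
  move=> ec; rewrite mem_filter => /andP[/eqP mX /hl[sX rX]].
  have [s' m' p'] := relabel_word ec sX mX.
  split; first by rewrite mem_filter m' eqxx; apply/hl; rewrite p'.
  rewrite /phi -map_comp -[RHS]map_id; apply/eq_in_map => -[v x] vX /=.
  rewrite relabelK // mem_filter mem_enum andbT -mX mnmE -has_count.
  by apply/hasP; exists (v, x).
have pm : perm_eq [seq X <- l | mon X == b'] (map (phi b b') [seq X <- l | mon X == b]).
  apply: uniq_perm; first exact: filter_uniq.
    rewrite map_inj_in_uniq ?filter_uniq // => X Y hX hY eXY.
    by rewrite -[X](phiP b b' X e hX).2 eXY (phiP b b' Y e hY).2.
  move=> X; apply/idP/mapP => [hX|[Y hY ->]]; last exact: (phiP b b' Y e hY).1.
  by have [h1 h2] := phiP b' b X (esym e) hX; exists (phi b' b X).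
rewrite [RHS](perm_big _ pm) big_map; apply: eq_bigr => X _.
by rewrite count_map.
Qed.

End Composition.

(** * The quasisymmetric members of the basis *)

Section QSym.

Variable n : nat.

Local Notation state := 'X_{1..n}.

Definition right_justified (al : seq nat) : state :=
  [multinom nth 0%N (nseq (n - size al) 0%N ++ al) r | r < n].

Lemma is_comp_pos (a : state) : is_comp n (pos_part a).
Proof.
rewrite /is_comp filter_all /= size_filter.
by apply: leq_trans (count_size _ _) _; rewrite size_tuple.
Qed.

Lemma right_justified_seq al : is_comp n al ->
  right_justified al = nseq (n - size al) 0%N ++ al :> seq nat.
Proof.
move=> /andP[_ sz]; apply: (@eq_from_nth _ 0%N) => [|i].
  by rewrite size_tuple ?card_ord size_cat size_nseq subnK.
rewrite size_tuple ?card_ord => ni.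
by rewrite -(mnm_nth 0%N _ (Ordinal ni)) mnmE.
Qed.

Lemma pos_right_justified al : is_comp n al -> pos_part (right_justified al) = al.
Proof.
move=> h; rewrite /pos_part right_justified_seq // filter_cat; case/andP: h => /all_filterP e _.
by rewrite filter_nseq /= e.
Qed.

(** Only [n - t] rows remain after the first [t], so all but at most [n - t] parts lie before; the
    right-justified composition attains this minimum. *)
Lemma right_justified_min (b : state) : dominates b (right_justified (pos_part b)).
Proof.
have hc := is_comp_pos b.
apply/dominates_cnt => [|t]; first by rewrite pos_right_justified.
have G u : (u <= n)%N -> (cnt b 1 n <= cnt b 1 (n - u) + u)%N.
  elim: u => [|u IH] un; first by rewrite subn0 addn0.
  apply: leq_trans (IH (ltnW un)) _; have := cnt1S b (n - u.+1)%N.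
  have -> : (n - u.+1).+1 = (n - u)%N by lia.
  lia.
case: (ltnP t n) => tn; last first.
  by rewrite !(@cnt_sat n _ 1 t) // !cnt_size pos_right_justified.
rewrite [X in (X <= _)%N]cnt1_take ?(ltnW tn) // right_justified_seq // size_filter.
rewrite take_cat size_nseq; case: ltnP => lt.
  rewrite (@eq_in_count _ _ pred0) ?count_pred0 // => x /mem_take /nseqP[-> _] //.
rewrite count_cat count_nseq /= mul0n add0n.
apply: leq_trans (count_size _ _) _; rewrite size_take.
by have := G (n - t)%N (leq_subr _ _); rewrite subKn ?(ltnW tn) // cnt_size; case: ifP; lia.
Qed.

Lemma quasi_right_justified al : is_comp n al ->
  quasi_grothendieck n al = quasi_lascoux (right_justified al).
Proof.
move=> h; rewrite /quasi_lascoux mdeg_pos pos_right_justified //.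
apply: eq_bigl => b; case: eqP => [e|_]; last by rewrite andbF.
by have := right_justified_min b; rewrite e andbT => ->.
Qed.

(** Quasisymmetry copies the leading coefficient 1 from [a] to its right-justified form, which then
    dominates [a] although it is the least composition with this positive part. *)
Lemma quasi_qsym (a : state) : quasisymmetric (quasi_lascoux a) ->
  a = right_justified (pos_part a).
Proof.
move=> h; have hc := is_comp_pos a.
have e : pos_part a = pos_part (right_justified (pos_part a)) by rewrite pos_right_justified.
have := h _ _ e; rewrite quasi_lead => e1.
have [|d _] := @quasi_supp n a (right_justified (pos_part a)); first by rewrite -e1 oner_neq0.
exact: dominates_eq (right_justified_min a) (dominates_height d).
Qed.

Lemma quasi_cap_qsym (f : {mpoly {poly int}[n]}) :
  (exists a : state, f = quasi_lascoux a) /\ quasisymmetric f <->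
  exists2 alpha : seq nat, is_comp n alpha & f = quasi_grothendieck n alpha.
Proof.
split=> [[[a ->] /quasi_qsym e]|[al hal ->]].
  exists (pos_part a); first exact: is_comp_pos.
  by rewrite quasi_right_justified ?is_comp_pos // -e.
split; last exact: quasisymmetric_grothendieck.
by exists (right_justified al); rewrite quasi_right_justified.
Qed.

Lemma qsym_sum (R : nzRingType) (I : Type) (r : seq I) (c : I -> R) (F : I -> {mpoly R[n]}) :
  (forall i, quasisymmetric (F i)) -> quasisymmetric (\sum_(i <- r) c i *: F i).
Proof.
move=> h a b e; rewrite !raddf_sum /=; apply: eq_bigr => i _.
by rewrite !mcoeffZ (h i _ _ e).
Qed.

(** Independence is inherited through [right_justified]. For generation, the right-justified terms
    in the expansion of [f] are already quasiGrothendieck polynomials, and the other terms must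
    vanish. *)
Lemma qsym_basis : is_basis (@quasisymmetric n {poly int})
  (fun alpha : {alpha : seq nat | is_comp n alpha} => quasi_grothendieck n (val alpha)).
Proof.
split.
- by move=> al; apply: quasisymmetric_grothendieck.
- move=> s c us e.
  pose rj (i : {alpha : seq nat | is_comp n alpha}) := right_justified (val i).
  have pj i : pos_part (rj i) = val i by rewrite pos_right_justified // (valP i).
  have irj : injective rj.
    by move=> i j eij; apply/val_inj; rewrite -!pj eij.
  pose c' (a : state) : {poly int} := if insub (pos_part a) is Some i then c i else 0.
  have cE i : c' (rj i) = c i by rewrite /c' pj valK.
  have := @quasi_independent n (map rj s) c'; rewrite map_inj_uniq // => /(_ us).
  rewrite big_map => h i si; rewrite -cE; apply: h; last exact: map_f.
  rewrite -[RHS]e; apply: eq_bigr => j _.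
  by rewrite cE -quasi_right_justified // (valP j).
- move=> f qf; have [l el] : in_span f.
    rewrite (mpolyE f); apply: in_span_sum => b _; exact/in_spanZ/monomial_in_span.
  pose s := undup (map snd l); pose c i := \sum_(x <- l | x.2 == i) x.1.
  have {}el : f = \sum_(a <- s) c a *: quasi_lascoux a by rewrite el sum_collect.
  pose isrj (a : state) := a == right_justified (pos_part a).
  pose s' := [seq exist (is_comp n) (pos_part a) (is_comp_pos a) | a <- s & isrj a].
  pose g := \sum_(a <- s | ~~ isrj a) c a *: quasi_lascoux a.
  have sE : \sum_(a <- s | isrj a) c a *: quasi_lascoux a =
      \sum_(i <- s') c (right_justified (val i)) *: quasi_grothendieck n (val i).
    rewrite big_map big_filter; apply: eq_bigr => a /eqP ea /=.
    by rewrite quasi_right_justified ?is_comp_pos // -ea.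
  have fE : f = \sum_(a <- s | isrj a) c a *: quasi_lascoux a + g by rewrite el (bigID isrj).
  exists s', (fun i => c (right_justified (val i))).
  rewrite -sE {1}fE -[RHS]addr0; congr (_ + _).
  have qg : quasisymmetric g.
    have -> : g = f - \sum_(i <- s') c (right_justified (val i)) *: quasi_grothendieck n (val i).
      by rewrite -sE {1}fE addrC addKr.
    move=> a b eab; rewrite !mcoeffB (qf _ _ eab).
    congr (_ - _); apply: qsym_sum eab => i; exact: quasisymmetric_grothendieck.
  (* At a remaining index [a] of least height, [g] has a nonzero coefficient, hence also at the
     right-justified form of [a], which must then dominate some remaining index. That index is also
     below [a], so it is [a] itself, which makes [a] right-justified. *)
  suff H : {in s, forall a, ~~ isrj a -> c a = 0}.
    by rewrite /g big_seq_cond big1 // => a /andP[/H h /h ->]; rewrite scale0r.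
  move=> a0 a0s nr0; apply/eqP/negPn/negP => ca0.
  pose P k := has (fun a => [&& c a != 0, ~~ isrj a & height a == k]) s.
  have exP : exists k, P k.
    by exists (height a0); apply/hasP; exists a0; rewrite ?ca0 ?nr0 ?eqxx.
  case: (ex_minnP exP) => k /hasP[a as' /and3P[ca nra /eqP ha]] mk.
  have S b : g@_b != 0 -> exists a', [/\ a' \in s, ~~ isrj a', c a' != 0 & dominates b a'].
    rewrite /g raddf_sum /= => ne.
    case: (boolP (has (fun a' => ~~ isrj a' && ((c a' *: quasi_lascoux a')@_b != 0)) s)).
      move=> /hasP[a' a's /andP[nr]]; rewrite mcoeffZ mulf_eq0 negb_or => /andP[h1 /quasi_supp[h2 _]].
      by exists a'; split.
    move=> /hasPn no; case/eqP: ne; rewrite big_seq_cond big1 // => a' /andP[/no].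
    by case: (isrj a') => //= /negPn/eqP.
  have T a' : a' \in s -> ~~ isrj a' -> c a' != 0 -> dominates a a' -> a' = a.
    move=> h1 h2 h3 h4; apply/esym/(dominates_eq h4).
    by rewrite ha; apply: mk; apply/hasP; exists a'; rewrite ?h3 ?h2 ?eqxx.
  have ga : g@_a != 0.
    rewrite /g raddf_sum /= -big_filter (bigD1_seq a) ?filter_uniq ?undup_uniq //=; last first.
      by rewrite mem_filter nra as'.
    rewrite mcoeffZ quasi_lead mulr1 big1_seq ?addr0 // => a'.
    rewrite mem_filter => /and3P[ne nr h]; apply/eqP; apply: contraNT ne.
    rewrite mcoeffZ mulf_eq0 negb_or => /andP[h1 /quasi_supp[h2 _]].
    by rewrite (T a').
  have e : pos_part a = pos_part (right_justified (pos_part a)).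
    by rewrite pos_right_justified ?is_comp_pos.
  rewrite (qg _ _ e) in ga; have [a' [h1 h2 h3 h4]] := S _ ga.
  have dr := right_justified_min a.
  have ea := T _ h1 h2 h3 (dominates_trans dr h4); subst a'.
  by case/negP: nra; apply/eqP; apply: dominates_eq dr (dominates_height h4).
Qed.

End QSym.

(** * Glides *)

Section GlideWords.

Variable n : nat.

Local Notation gletter := ('I_n * bool)%type.
Local Notation state := 'X_{1..n}.

(* A komposition is encoded by the weakly increasing word of its entries, where
   the first occurrence of a red entry is marked as joined: it shares a box with
   the letter before it. *)
Definition gle : rel gletter := fun y y' =>
  (y.1 < y'.1)%N || ((y.1 == y'.1) && ~~ y'.2).

Lemma gle_trans : transitive gle.
Proof.
by move=> [y j] [x i] [z k]; rewrite /gle /= -!val_eqE /=; case: i; case: j; case: k => /=; lia.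
Qed.

Lemma gle_anti : antisymmetric gle.
Proof.
move=> [y j] [x i]; rewrite /gle /= -!val_eqE /= => h.
have e : y = x by apply/val_inj => /=; lia.
by subst; congr (_, _); case: i h; case: j => //=; lia.
Qed.

Definition unjoined (Y : seq gletter) : bool := if Y is (_, j) :: _ then ~~ j else true.

Definition gmon (Y : seq gletter) : state := [multinom count (fun y : gletter => y.1 == i) Y | i < n].

Definition gred (Y : seq gletter) : {set 'I_n} := [set k | (k, true) \in Y].

Definition gseg (b : state) (red : {set 'I_n}) (k : 'I_n) : seq gletter :=
  if b k is m.+1 then (k, k \in red) :: nseq m (k, false) else [::].

Definition gword (b : state) (red : {set 'I_n}) : seq gletter :=
  flatten [seq gseg b red k | k <- enum 'I_n].

Lemma mem_gseg b red k y : y \in gseg b red k -> y.1 = k /\ (y.2 -> k \in red).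
Proof.
rewrite /gseg; case: (b k) => [|m] //; rewrite inE => /orP[/eqP -> //|/nseqP[-> _]] /=.
by split.
Qed.

Lemma sorted_gword b red : sorted gle (gword b red).
Proof.
rewrite (sorted_pairwise gle_trans) /gword.
have : pairwise (fun i j : 'I_n => (i < j)%N) (enum 'I_n).
  rewrite -sorted_pairwise; last by move=> y x z; apply: ltn_trans.
  by have := iota_ltn_sorted 0 n; rewrite -val_enum_ord sorted_map.
elim: (enum 'I_n) => //= k ks IH /andP[/allP hk /IH {}IH].
rewrite pairwise_cat IH andbT; apply/andP; split.
  apply/allrelP => y y' /mem_gseg[ey _] /flatten_mapP[k' /hk lt /mem_gseg[ey' _]].
  by rewrite /gle ey ey' lt.
rewrite /gseg; case: (b k) => //= m; apply/andP; split.
  by apply/allP => y /nseqP[-> _]; rewrite /gle /= eqxx orbT.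
by elim: m => //= m ->; rewrite andbT; apply/allP => y /nseqP[-> _]; rewrite /gle /= eqxx orbT.
Qed.

Lemma count_gword (p : pred gletter) b red :
  count p (gword b red) = (\sum_(k < n) count p (gseg b red k))%N.
Proof. by rewrite /gword count_flatten -map_comp sumnE big_map big_enum. Qed.

Lemma gmon_gword b red : gmon (gword b red) = b.
Proof.
apply/mnmP => i; rewrite mnmE count_gword (bigD1 i) //= big1 ?addn0.
  rewrite /gseg; case: (b i) => //= m; rewrite eqxx count_nseq /= eqxx; lia.
move=> k ne; apply/eqP; rewrite -leqn0 leqNgt -has_count; apply/hasPn => y.
by move=> /mem_gseg[-> _].
Qed.

Lemma gred_gword b red : is_kompo b red -> gred (gword b red) = red.
Proof.
move=> /forall_inP h; apply/setP => k; rewrite inE; apply/idP/idP => [/flatten_mapP[k' _]|kr].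
  by move=> /mem_gseg[/= <- ]; apply.
apply/flatten_mapP; exists k; first by rewrite mem_enum.
by rewrite /gseg; have := h k kr; case: (b k) => //= m _; rewrite kr mem_head.
Qed.

Lemma sorted_gle_cons y Y : sorted gle (y :: Y) ->
  sorted gle Y /\ {in Y, forall y', gle y y'}.
Proof.
move=> h; split; first exact: path_sorted h.
by move: h => /= /(order_path_min gle_trans)/allP.
Qed.

Lemma count_joined (Y : seq gletter) k : sorted gle Y ->
  count_mem (k, true) Y = ((k, true) \in Y).
Proof.
elim: Y => //= y Y IH /[dup] /sorted_gle_cons[sY hY] _; rewrite IH // inE.
case: (eqVneq y (k, true)) => [e|_] /=; last by [].
suff -> : ((k, true) \in Y) = false by [].
by apply/negP => /hY; rewrite e /gle /= ltnn andbF.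
Qed.

(** A sorted word is determined by its multiset of letters; joined letters are never repeated, so
    [gred] and [gmon] recover all multiplicities. *)
Lemma gword_gmon (Y : seq gletter) : sorted gle Y -> gword (gmon Y) (gred Y) = Y.
Proof.
move=> sY; apply: (sorted_eq gle_trans gle_anti) => //; first exact: sorted_gword.
have split_count (Y' : seq gletter) k : count (fun y : gletter => y.1 == k) Y' =
    (count_mem (k, true) Y' + count_mem (k, false) Y')%N.
  elim: Y' => //= -[v j] Y' ->; rewrite !xpair_eqE /=.
  by case: (v == k); case: j => /=; lia.
have kom : is_kompo (gmon Y) (gred Y).
  apply/forall_inP => k; rewrite inE mnmE => h; rewrite -has_count; apply/hasP.
  by exists (k, true).
have T k : count_mem (k, true) (gword (gmon Y) (gred Y)) = count_mem (k, true) Y.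
  rewrite !count_joined ?sorted_gword //; congr nat_of_bool.
  by have /setP/(_ k) := gred_gword kom; rewrite !inE.
apply/allP => -[k j] _ /=; apply/eqP; case: j; first exact: T.
have := congr1 (fun m : state => m k) (gmon_gword (gmon Y) (gred Y)).
by rewrite /= !mnmE !split_count T => /addnI.
Qed.

Lemma gword_inj b red b' red' : is_kompo b red -> is_kompo b' red' ->
  gword b red = gword b' red' -> b = b' /\ red = red'.
Proof.
move=> k k' e; split; first by rewrite -(gmon_gword b red) e gmon_gword.
by rewrite -(gred_gword k) e gred_gword.
Qed.

(* [us] lists the largest values allowed in the successive boxes; the values
   increase strictly inside a box, and between boxes with distinct bounds. *)
Fixpoint gvalid (us : seq nat) (Y : seq gletter) : bool :=
  if Y is (v, _) :: Y' then
    if us is u :: us' then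
      (v <= u)%N &&
      match Y' with
      | (v', true) :: _ => (v < v')%N && gvalid us Y'
      | (v', false) :: _ =>
          [&& (v <= v')%N, (u < head u us')%N ==> (v < v')%N & gvalid us' Y']
      | [::] => gvalid us' Y'
      end
    else false
  else us == [::].

Lemma gvalid1 u us v j : gvalid (u :: us) [:: (v, j)] = (v <= u)%N && (us == [::]).
Proof. by []. Qed.

Lemma gvalid_joined u us v j v' Y : gvalid (u :: us) [:: (v, j), (v', true) & Y] =
  [&& (v <= u)%N, (v < v')%N & gvalid (u :: us) ((v', true) :: Y)].
Proof. by []. Qed.

Lemma gvalid_new u us v j v' Y : gvalid (u :: us) [:: (v, j), (v', false) & Y] =
  [&& (v <= u)%N, (v <= v')%N, (u < head u us)%N ==> (v < v')%N &
    gvalid us ((v', false) :: Y)].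
Proof. by []. Qed.

Definition gvalidE := (gvalid1, gvalid_joined, gvalid_new).

Lemma gvalid_sorted us Y : gvalid us Y -> sorted gle Y.
Proof.
elim: Y us => // -[v j] Y IH [|u us] //; case: Y IH => [|[v' [] ] Y] IH; rewrite ?gvalidE //.
  by move=> /and3P[_ lt /IH /= ->]; rewrite andbT /gle /= lt.
move=> /and4P[_ le _ /IH /= ->]; rewrite andbT /gle /= andbT -val_eqE orbC.
by rewrite -leq_eqVlt.
Qed.

Lemma gvalid_size us Y : unjoined Y -> gvalid us Y ->
  count (fun y : gletter => ~~ y.2) Y = size us.
Proof.
suff H v j Y' us' : gvalid us' ((v, j) :: Y') -> (count (fun y : gletter => ~~ y.2) Y').+1 = size us'.
  by case: Y => [|[v []] Y] // _; [move=> /eqP -> | move=> /H].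
elim: Y' v j us' => [|[v' j'] Y' IH] v j [|u us'] //.
  by rewrite gvalid1 => /andP[_ /eqP ->].
case: j'; rewrite gvalidE; first by move=> /and3P[_ _ /IH].
by move=> /and4P[_ _ _ /IH] /= <-.
Qed.

(** The blocks of a glide seen on words, without cut points: the sum of a block minus its excess
    counts its unjoined letters, and a black leftmost entry means that the block starts unjoined. *)
Fixpoint gblocks (a : state) (ns : seq 'I_n) (Y : seq gletter) : Prop :=
  if ns is k :: ns' then exists Y1 Y2,
    [/\ Y = Y1 ++ Y2, count (fun y : gletter => ~~ y.2) Y1 = a k,
        {in Y1, forall y : gletter, (y.1 <= k)%N} & unjoined Y1] /\
    {in Y1 & Y2, forall y y' : gletter, (y.1 < y'.1)%N} /\ gblocks a ns' Y2
  else Y = [::].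

Definition bound_word (a : state) (ns : seq 'I_n) : seq nat :=
  flatten [seq nseq (a k) (k : nat) | k <- ns].

Lemma gvalid_cat u us v j M Y1 Y2 : sorted gle ((v, j) :: Y1 ++ Y2) ->
  {in (v, j) :: Y1, forall y : gletter, (y.1 <= u)%N} ->
  {in (v, j) :: Y1 & Y2, forall y y' : gletter, (y.1 < y'.1)%N} ->
  count (fun y : gletter => ~~ y.2) Y1 = M -> unjoined Y2 -> gvalid us Y2 ->
  gvalid (nseq M.+1 u ++ us) ((v, j) :: Y1 ++ Y2).
Proof.
elim: Y1 v j M => [|[v' j'] Y1 IH] v j M sY hu sep /= cM uY gY.
  have vu : (v <= u)%N by apply: (hu (v, j)); rewrite mem_head.
  subst M; case: Y2 sY sep uY gY => [|[v' []] Y2] // sY sep _ gY.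
    by rewrite /= vu.
  have lt : (v < v')%N by apply: (sep (v, j) (v', false)); rewrite mem_head.
  rewrite -[X in is_true X]/(gvalid (u :: us) [:: (v, j), (v', false) & Y2]).
  by rewrite gvalid_new vu lt (ltnW lt) implybT gY.
have [sY1 _] := sorted_gle_cons sY.
have vu : (v <= u)%N by apply: (hu (v, j)); rewrite mem_head.
have hu' : {in (v', j') :: Y1, forall y : gletter, (y.1 <= u)%N}.
  by move=> y h; apply: hu; rewrite inE h orbT.
have sep' : {in (v', j') :: Y1 & Y2, forall y y' : gletter, (y.1 < y'.1)%N}.
  by move=> y y' h; apply: sep; rewrite inE h orbT.
move: sY => /= /andP[]; rewrite {1}/gle /=.
case: j' sY1 hu' sep' cM {hu sep} => sY1 hu' sep' cM.
  rewrite andbF orbF => lt _.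
  rewrite -[X in is_true X]/(gvalid (u :: nseq M u ++ us) [:: (v, j), (v', true) & Y1 ++ Y2]).
  rewrite gvalid_joined vu lt.
  exact: (IH v' true M sY1 hu' sep' cM uY gY).
case: M cM => // M [cM] /= h _.
rewrite -[X in is_true X]/(gvalid (u :: nseq M.+1 u ++ us) [:: (v, j), (v', false) & Y1 ++ Y2]).
rewrite gvalid_new vu [head _ _]/= ltnn.
have -> : (v <= v')%N by move: h; rewrite -val_eqE /=; lia.
exact: (IH v' false M sY1 hu' sep' cM uY gY).
Qed.

(** The bound increases right after the [M.+1] boxes bounded by [u], which forces a strict ascent
    there: this ascent is the separation of two blocks. *)
Lemma gvalid_split u us v j M Y : (us = [::] \/ (u < head u us)%N) ->
  gvalid (nseq M.+1 u ++ us) ((v, j) :: Y) ->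
  exists Y1 Y2, [/\ Y = Y1 ++ Y2, count (fun y : gletter => ~~ y.2) Y1 = M,
    {in (v, j) :: Y1, forall y : gletter, (y.1 <= u)%N} & unjoined Y2] /\
    {in (v, j) :: Y1 & Y2, forall y y' : gletter, (y.1 < y'.1)%N} /\ gvalid us Y2.
Proof.
move=> hus; elim: Y v j M => [|[v' j'] Y IH] v j M.
  rewrite gvalid1 => /andP[vu gY]; exists [::], [::]; case: M gY => // /eqP /= eus.
  by split; [split=> // y; rewrite inE => /eqP -> | rewrite eus].
move=> /[dup] /gvalid_sorted sY.
case: j' sY => sY.
  rewrite gvalid_joined => /and3P[vu lt /(IH v' true M)[Y1 [Y2 [[-> cM hu uY] [sep gY]]]]].
  exists ((v', true) :: Y1), Y2; split; first split=> //.
    by move=> y; rewrite inE => /orP[/eqP -> //|/hu].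
  split=> // y y'; rewrite inE => /orP[/eqP -> h|]; last exact: sep.
  by apply: ltn_trans lt _; apply: (sep (v', true)); rewrite ?mem_head.
case: M => [|M].
  rewrite gvalid_new => /and4P[vu le lt gY]; exists [::], ((v', false) :: Y); split.
    by split=> // y; rewrite inE => /eqP ->.
  split=> //; have vv : (v < v')%N.
    by case: hus gY lt => [-> //|h] _; rewrite h.
  move=> y y'; rewrite !inE => /eqP -> /orP[/eqP -> //|h].
  have [sY1 _] := sorted_gle_cons sY; have [_ /(_ _ h)] := sorted_gle_cons sY1.
  by rewrite /gle /= -val_eqE /=; lia.
rewrite gvalid_new => /and4P[vu le _ /(IH v' false M)[Y1 [Y2 [[-> cM hu uY] [sep gY]]]]].
exists ((v', false) :: Y1), Y2; split; first split=> //.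
- by rewrite /= cM.
- by move=> y; rewrite inE => /orP[/eqP -> //|/hu].
split=> // y y'; rewrite inE => /orP[/eqP -> h|]; last exact: sep.
by apply: leq_ltn_trans le _; apply: (sep (v', false)); rewrite ?mem_head.
Qed.

Lemma gblocksP (a : state) ns Y : sorted (fun i j : 'I_n => (i < j)%N) ns ->
  {in ns, forall k : 'I_n, (0 < a k)%N} -> sorted gle Y ->
  gblocks a ns Y <-> unjoined Y && gvalid (bound_word a ns) Y.
Proof.
elim: ns Y => [|k ns IH] Y sns pos sY.
  by split=> [-> //|]; case: Y sY => // -[v []].
have sns1 := path_sorted sns.
have pos1 : {in ns, forall k : 'I_n, (0 < a k)%N}.
  by move=> i h; apply: pos; rewrite inE h orbT.
have ak : (0 < a k)%N by apply: pos; rewrite mem_head.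
rewrite /bound_word /= -/(bound_word a ns); split.
- move=> [Y1 [Y2 [[eY cM hu uY] [sep bY]]]]; subst Y.
  have [_ sY2] := cat_sorted2 sY.
  have /andP[uY2 gY2] := (IH _ sns1 pos1 sY2).1 bY.
  case: Y1 cM hu uY sep sY => [|[v j] Y1] cM hu uY sep sY; first by rewrite -cM in ak.
  have -> : unjoined (((v, j) :: Y1) ++ Y2) by [].
  case: j cM uY hu sep sY => // cM _ hu sep sY /=.
  by rewrite -cM /=; apply: (@gvalid_cat k _ v false _ Y1 Y2).
- move=> /andP[uY]; case eak : (a k) ak => [//|M] _.
  case: Y sY uY => [|[v j] Y] // sY uY gY.
  have [|Y1 [Y2 [[eY cM hu uY2] [sep gY2]]]] := gvalid_split _ gY.
    case: ns sns pos1 {IH sns1 pos gY} => [|k' ns] /=; first by left.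
    move=> /andP[lt _] /(_ k' (mem_head _ _)); rewrite /bound_word /=.
    by case: (a k') => // m _; right.
  subst Y; exists ((v, j) :: Y1), Y2; split; last first.
    have [_ sY2] := @cat_sorted2 _ gle ((v, j) :: Y1) Y2 sY.
    by split=> //; apply/(IH _ sns1 pos1 sY2); rewrite uY2.
  by split=> //; case: j uY {sY gY hu sep} => //= _; rewrite cM.
Qed.

Lemma filter_segment (Y : seq gletter) lo hi : sorted gle Y -> (lo <= hi)%N ->
  [seq y : gletter <- Y | (lo <= y.1)%N] =
  [seq y : gletter <- Y | (lo <= y.1 < hi)%N] ++ [seq y : gletter <- Y | (hi <= y.1)%N].
Proof.
move=> sY lh; elim: Y sY => //= y Y IH /[dup] /sorted_gle_cons[sY hY] _.
case: (leqP hi y.1) => h.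
  rewrite (leq_trans lh h) /=.
  have hiY : {in Y, forall y' : gletter, (hi <= y'.1)%N}.
    by move=> y' /hY; rewrite /gle -val_eqE /=; lia.
  have -> : [seq y : gletter <- Y | (lo <= y.1 < hi)%N] = [::].
    apply/eqP; rewrite -size_eq0 size_filter -leqn0 leqNgt -has_count.
    by apply/hasPn => y' /hiY; lia.
  congr (_ :: _); rewrite /=; apply: eq_in_filter => y' /hiY h'.
  by rewrite h' (leq_trans lh h').
by rewrite andbT; case: (lo <= y.1)%N => /=; rewrite IH.
Qed.

End GlideWords.

(** * Glide polynomials as generating functions of words *)

Section GlidePolynomials.

Variable n : nat.

Local Notation gletter := ('I_n * bool)%type.
Local Notation state := 'X_{1..n}.

Definition gfrom lo (Y : seq gletter) := [seq y : gletter <- Y | (lo <= y.1)%N].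
Definition gbetween lo hi (Y : seq gletter) := [seq y : gletter <- Y | (lo <= y.1 < hi)%N].

Section Glide.

Variables (b : state) (red : {set 'I_n}).
Hypothesis kom : is_kompo b red.

Let Y := gword b red.
Let sY : sorted (@gle n) Y := sorted_gword b red.

Lemma count_gword_val (c : pred 'I_n) :
  count (fun y : gletter => c y.1) Y = (\sum_(k in [set k | c k]) b k)%N.
Proof.
rewrite count_gword [RHS]big_mkcond /=; apply: eq_bigr => k _; rewrite inE.
rewrite /gseg; case: (b k) => [|m] /=; first by case: ifP.
rewrite count_nseq /=; case: (c k) => //=; lia.
Qed.

Lemma count_gword_red (c : pred 'I_n) :
  count (fun y : gletter => c y.1 && y.2) Y = #|red :&: [set k | c k]|.
Proof.
rewrite count_gword -sum1_card [RHS]big_mkcond /=; apply: eq_bigr => k _; rewrite !inE.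
rewrite /gseg; case E : (b k) => [|m] /=.
  case: ifP => // /andP[kr _]; have /forall_inP/(_ k kr) := kom; rewrite E //.
by rewrite count_nseq /= andbF addn0 andbC; case: (_ && _).
Qed.

Lemma gword_mem k : reflect (exists j, (k, j) \in Y) (0 < b k)%N.
Proof.
apply: (iffP idP) => [|[j h]].
  have -> : b k = gmon Y k by rewrite /Y gmon_gword.
  by rewrite mnmE -has_count => /hasP[[v j] h /eqP /= e]; exists j; rewrite -e.
have -> : b k = gmon Y k by rewrite /Y gmon_gword.
by rewrite mnmE -has_count; apply/hasP; exists (k, j) => //=; exact: eqxx.
Qed.

Lemma gword_red k : (k, true) \in Y = (k \in red).
Proof. by have /setP/(_ k) := gred_gword kom; rewrite inE. Qed.

Lemma count_between lo hi :
  (\sum_(k in [set k : 'I_n | (lo <= k < hi)%N]) b k =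
   count (fun y : gletter => ~~ y.2) (gbetween lo hi Y) +
   #|red :&: [set k : 'I_n | (lo <= k < hi)%N]|)%N.
Proof.
rewrite -(count_gword_val (fun k => (lo <= k < hi)%N)).
rewrite -(count_gword_red (fun k => (lo <= k < hi)%N)) /gbetween count_filter.
elim: (Y) => //= y Y' ->; case: (_ && _) => //=; case: y.2 => /=; lia.
Qed.

Lemma unjoined_between lo hi (B := [set k : 'I_n | (lo <= k < hi)%N]) :
  unjoined (gbetween lo hi Y) =
  [forall k in B, (0 < b k)%N && [forall k' in B, (k' < k)%N ==> (b k' == 0%N)]
                     ==> (k \notin red)].
Proof.
have memB y : (y \in gbetween lo hi Y) = (y.1 \in B) && (y \in Y).
  by rewrite mem_filter inE.
have sB : sorted (@gle n) (gbetween lo hi Y) by apply: sorted_filter => //; exact: gle_trans.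
apply/idP/forall_inP => [uj k kB|h].
  apply/implyP => /andP[bk /forall_inP hk]; apply/negP => kr.
  have := memB (k, true); rewrite kB gword_red kr /=.
  case E : (gbetween lo hi Y) uj sB => [|[v []] Z] //= _ sB.
  rewrite inE xpair_eqE andbF /= => hZ; have [_ /(_ _ hZ)] := sorted_gle_cons (sB : sorted (@gle n) ((v, false) :: Z)).
  rewrite /gle /= andbF orbF => vk.
  have := memB (v, false); rewrite E mem_head => /esym/andP[vB vY].
  have /implyP/(_ vk)/eqP bv := hk v vB.
  have : (0 < b v)%N by apply/gword_mem; exists false.
  by rewrite bv.
case E : (gbetween lo hi Y) => [|[v []] Z] //; exfalso.
have := memB (v, true); rewrite E mem_head gword_red => /esym/andP[vB vr].
have /implyP/(_ _)/negP := h v vB; apply => //.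
have bv : (0 < b v)%N by apply/gword_mem; exists true; rewrite gword_red.
rewrite bv; apply/forall_inP => k kB; apply/implyP => kv.
rewrite -leqn0 leqNgt; apply/negP => /gword_mem[j kY].
have := memB (k, j); rewrite kB kY E inE => /orP[/eqP[e _]|kZ]; first by rewrite e ltnn in kv.
rewrite E in sB; have [_ /(_ _ kZ)] := sorted_gle_cons sB.
by rewrite /gle /= -val_eqE /=; lia.
Qed.

Lemma gfrom_nil lo : gfrom lo Y = [::] <-> forall k : 'I_n, (lo <= k)%N -> b k = 0%N.
Proof.
split=> [e k lk|h].
  apply/eqP; rewrite -leqn0 leqNgt; apply/negP => /gword_mem[j kY].
  have : (k, j) \in gfrom lo Y by rewrite mem_filter lk.
  by rewrite e.
apply/eqP; rewrite -size_eq0 size_filter -leqn0 leqNgt -has_count; apply/hasPn => -[k j] kY.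
apply/negP => /h e; have : (0 < b k)%N by apply/gword_mem; exists j.
by rewrite e.
Qed.

Variable a : state.

Definition gstep lo hi (k : 'I_n) := [/\ (lo < hi)%N,
  count (fun y : gletter => ~~ y.2) (gbetween lo hi Y) = a k, (hi <= k.+1)%N &
  unjoined (gbetween lo hi Y)].

Lemma gblocks_steps (ns : seq 'I_n) lo : {in ns, forall k : 'I_n, (0 < a k)%N} ->
  gblocks a ns (gfrom lo Y) <->
  exists2 hs : seq nat, size hs = size ns &
    (forall j k0, (j < size ns)%N ->
       gstep (nth 0%N (lo :: hs) j) (nth 0%N (lo :: hs) j.+1) (nth k0 ns j)) /\
    gfrom (last lo hs) Y = [::].
Proof.
elim: ns lo => [|k ns IH] lo pos.
  split=> [e|[[|//] _ [_ e]]] //; by exists [::].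
have pos1 : {in ns, forall k : 'I_n, (0 < a k)%N}.
  by move=> i h; apply: pos; rewrite inE h orbT.
split.
- move=> /= [Y1 [Y2 [[eY cM hu uY] [sep bY]]]].
  have : (0 < count (fun y : gletter => ~~ y.2) Y1)%N by rewrite cM pos // mem_head.
  (* The block is nonempty. Cutting it just after its last and largest value [v] yields the integer
     [i_j] of the glide, and [v <= k] is the condition on it. *)
  case/lastP: Y1 eY cM hu uY sep => [|Y1 [v j]] // eY cM hu uY sep _.
  have s12 : sorted (@gle n) (rcons Y1 (v, j) ++ Y2).
    by rewrite -eY; apply: sorted_filter => //; exact: gle_trans.
  have le1 y : y \in rcons Y1 (v, j) -> (y.1 <= v)%N.
    rewrite mem_rcons inE => /orP[/eqP -> //|yY1].
    move: s12; rewrite (sorted_pairwise (@gle_trans n)) pairwise_cat pairwise_rcons.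
    move=> /and3P[_ /andP[/allP/(_ _ yY1) h _] _].
    by move: h; rewrite /gle /= -val_eqE /=; lia.
  have lo1 y : y \in rcons Y1 (v, j) -> (lo <= y.1)%N.
    move=> h; have : y \in gfrom lo Y by rewrite eY mem_cat h.
    by rewrite mem_filter => /andP[].
  have vin : (v, j) \in rcons Y1 (v, j) by rewrite mem_rcons mem_head.
  have lov : (lo <= v)%N := lo1 _ vin.
  have E1 : gbetween lo v.+1 Y = rcons Y1 (v, j).
    have -> : gbetween lo v.+1 Y = [seq y : gletter <- gfrom lo Y | (y.1 < v.+1)%N].
      by rewrite /gbetween /gfrom -filter_predI; apply: eq_filter => y /=; rewrite andbC.
    rewrite eY filter_cat (all_filterP _); last by apply/allP => y /le1.
    rewrite (_ : filter _ Y2 = [::]) ?cats0 //; apply/eqP.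
    rewrite -size_eq0 size_filter -leqn0 leqNgt -has_count; apply/hasPn => y yY2.
    by rewrite ltnS -ltnNge; apply: (sep (v, j)).
  have E2 : gfrom v.+1 Y = Y2.
    have := filter_segment sY (leqW lov); rewrite -/(gfrom _ _) -/(gbetween _ _ _).
    rewrite -/(gfrom v.+1 Y) E1 eY => /eqP; rewrite eqseq_cat // eqxx => /eqP.
    by move=> ->.
  rewrite -E2 in bY; have [hs sz [hst hl]] := (IH _ pos1).1 bY.
  exists (v.+1 :: hs); first by rewrite /= sz.
  split=> // -[|i] k0 /= lt; last exact: hst.
  by split; rewrite ?E1 // ltnS; have := hu _ vin.
- move=> [[|hi hs] // [sz] [hst hl]] /=.
  have [lt cM hk uY] := hst 0%N k isT.
  exists (gbetween lo hi Y), (gfrom hi Y); split.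
    split=> //; first exact: filter_segment sY (ltnW lt).
    by move=> y; rewrite mem_filter => /andP[/andP[_ h] _]; move: (leq_trans h hk).
  split.
    move=> y y'; rewrite !mem_filter => /andP[/andP[_ h] _] /andP[h' _].
    exact: leq_trans h h'.
  apply/(IH _ pos1); exists hs => //; split=> // i k0 ii.
  exact: (hst i.+1 k0).
Qed.

End Glide.

Lemma nz_pos (a : state) : {in nz_positions a, forall k : 'I_n, (0 < a k)%N}.
Proof. by move=> k; rewrite mem_filter => /andP[]. Qed.

Lemma glideP (a b : state) red : reflect
  (is_kompo b red /\ gblocks a (nz_positions a) (gword b red)) (glide a b red).
Proof.
have g0 : gfrom 0 (gword b red) = gword b red by apply/all_filterP/allP.
set ns := nz_positions a; set l := size ns.
apply: (iffP andP) => [[kom /existsP[i /and3P[/eqP i0 /forallP iz /forallP ij]]]|[kom]].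
  split=> //; rewrite -g0; apply/gblocks_steps => //; first exact: nz_pos.
  exists (mkseq (fun j => i (inord j.+1) : nat) l); first by rewrite size_mkseq.
  have hE j : (j <= l)%N -> nth 0%N (0%N :: mkseq (fun j => i (inord j.+1) : nat) l) j = i (inord j).
    case: j => [|j] jl /=; last by rewrite nth_mkseq.
    by rewrite -[LHS]i0; congr (nat_of_ord (i _)); apply/val_inj; rewrite /= inordK.
  split.
    move=> j k0 jl; rewrite !hE // ?(ltnW jl) //.
    have := ij (Ordinal jl) => /=.
    have -> : widen_ord (leqnSn l) (Ordinal jl) = inord j.
      by apply/val_inj; rewrite /= inordK // ltnW.
    have -> : lift ord0 (Ordinal jl) = inord j.+1.
      by apply/val_inj; rewrite /= inordK // ltnS.
    rewrite (tnth_nth k0) /= => /and4P[h1 /eqP h2 h3 h4].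
    split=> //; last by rewrite (unjoined_between kom).
    by move: h2; rewrite (count_between kom) => /addIn.
  apply/gfrom_nil => k lk; apply/eqP; have /implyP := iz k; apply.
  apply: leq_trans lk; rewrite (last_nth 0%N) size_mkseq hE //.
  by rewrite (_ : inord l = ord_max) //; apply/val_inj; rewrite /= inordK.
rewrite -{1}g0 => /(gblocks_steps kom 0%N (@nz_pos a)) [hs sz [hst hl]].
split=> //; apply/existsP.
have hn j : (nth 0%N (0%N :: hs) j < n.+1)%N.
  case: j => [//|j]; case: (ltnP j l) => jl; last by rewrite /= nth_default ?sz.
  have k0 : 'I_n by move: jl; rewrite /l; case: (ns).
  have [_ _ h _] := hst j k0 jl; apply: leq_trans h (ltn_ord _).
exists [ffun j : 'I_l.+1 => inord (nth 0%N (0%N :: hs) j)].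
apply/and3P; split.
- by rewrite ffunE inordK.
- apply/forallP => k; apply/implyP; rewrite ffunE inordK //= => lk.
  apply/eqP; apply: ((gfrom_nil b red (last 0%N hs)).1 hl).
  by rewrite (last_nth 0%N) sz.
- apply/forallP => j; cbv zeta; rewrite !ffunE !inordK //.
  have [h1 h2 h3 h4] := hst j (tnth (in_tuple ns) j) (ltn_ord j).
  rewrite (tnth_nth (tnth (in_tuple ns) j)) /=; apply/and4P; split=> //.
    by apply/eqP; rewrite (count_between kom) h2.
  by rewrite -(unjoined_between kom).
Qed.

Lemma glide_gvalid (a b : state) red : glide a b red =
  [&& is_kompo b red, unjoined (gword b red) &
    gvalid (bound_word a (nz_positions a)) (gword b red)].
Proof.
have P := gblocksP (sorted_nz a) (@nz_pos a) (sorted_gword b red).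
apply/glideP/andP => -[kom /P h]; by split.
Qed.

Lemma size_bound_word (a : state) : size (bound_word a (nz_positions a)) = mdeg a.
Proof.
rewrite size_flatten /shape -map_comp mdeg_pos pos_part_nz; congr sumn.
by apply: eq_map => k; rewrite /= size_nseq.
Qed.

Definition gwgt (Y : seq gletter) : {mpoly {poly int}[n]} :=
  ('X ^+ count (fun y : gletter => y.2) Y : {poly int}) *: 'X_[gmon Y].

Lemma glide_poly_gf (a : state) : exists2 l : seq (seq gletter), uniq l &
  (forall Y, (Y \in l) = unjoined Y && gvalid (bound_word a (nz_positions a)) Y) /\
  glide_poly a = \sum_(Y <- l) gwgt Y.
Proof.
set T : finType := ('X_{1..n < (mdeg a + n).+1} * {set 'I_n})%type.
pose f (x : T) := gword (bmnm x.1) x.2.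
exists [seq f x | x <- enum {: T} & glide a (bmnm x.1) x.2].
  rewrite map_inj_in_uniq; first exact/filter_uniq/enum_uniq.
  move=> [b red] [b' red'].
  rewrite !mem_filter !glide_gvalid => /andP[/and3P[k _ _] _] /andP[/and3P[k' _ _] _] e.
  by have /= [eb er] := gword_inj k k' e; congr (_, _) => //; apply/val_inj.
split; last first.
  rewrite /glide_poly pair_big_dep big_map big_filter big_enum_cond /=.
  apply: eq_bigr => -[b red]; rewrite /= glide_gvalid => /and3P[kom _ _].
  rewrite /gwgt /f gmon_gword; congr ('X ^+ _ *: _).
  have E : red :&: [set k | predT k] = red by apply/setP => k; rewrite !inE andbT.
  by have := count_gword_red kom predT; rewrite E => /= ->.
move=> Y; apply/mapP/idP => [[x]|/andP[uY gY]].
  by rewrite mem_filter glide_gvalid => /andP[/and3P[_ h1 h2] _] ->; rewrite h1 h2.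
have sY := gvalid_sorted gY; have eY := gword_gmon sY.
have kom : is_kompo (gmon Y) (gred Y).
  apply/forall_inP => k; rewrite inE mnmE => h; rewrite -has_count; apply/hasP.
  by exists (k, true) => //=.
have mb : (mdeg (gmon Y) < (mdeg a + n).+1)%N.
  have := gvalid_size uY gY; rewrite size_bound_word => <-.
  have := count_gword_val kom predT; rewrite eY /= => e.
  have -> : mdeg (gmon Y) = size Y.
    rewrite -count_predT e mdegE; apply: eq_bigl => k; by rewrite inE.
  have := count_gword_red kom predT; rewrite eY /= => e2.
  have : (#|gred Y :&: [set k | predT k]| <= n)%N by rewrite -[n in (_ <= n)%N]card_ord max_card.
  rewrite -e2 -(count_predC (fun y : gletter => y.2) Y).
  rewrite (@eq_count _ (predC _) (fun y : gletter => ~~ y.2)) //; lia.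
exists (BMultinom mb, gred Y); last by rewrite /f /= eY.
by rewrite mem_filter mem_enum andbT glide_gvalid /= eY kom uY.
Qed.

End GlidePolynomials.

(** * Merging the letters that share a box *)

Local Notation pletter := (nat * bool)%type.

Definition follows (c : nat) (P : seq pletter) : bool := if P is y :: _ then y.1 == c else false.

(* By (S.4), a free letter followed by a letter of the same column lies in the
   same box as the latter. *)
Fixpoint compress (P : seq pletter) : seq pletter :=
  if P is x :: P' then
    if ~~ x.2 && follows x.1 P' then compress P' else x :: compress P'
  else [::].

Lemma follows_compress c P : follows c (compress P) = follows c P.
Proof.
elim: P => //= x P IH; case: ifP => // /andP[_].
by case: P IH => //= y P -> /eqP ->.
Qed.

Lemma size_compress P : (size (compress P) <= size P)%N.
Proof. by elim: P => //= x P IH; case: ifP => _ //=; apply: leqW. Qed.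

Lemma compress_idem P : compress (compress P) = compress P.
Proof. by elim: P => //= x P IH; case: ifP => //= h; rewrite follows_compress h IH. Qed.

Lemma compress_cons x W : compress (x :: W) = x :: W ->
  ~~ (~~ x.2 && follows x.1 W) /\ compress W = W.
Proof.
move=> /=; case: ifP => [_ e|_ [->]] //.
by have := size_compress W; rewrite e /= ltnn.
Qed.

Lemma bump_mem c mu : c \in mu -> c.+1 \in bump c mu.
Proof.
elim: mu => //= x mu IH; rewrite inE eq_sym; case: eqP => [_ _|_ /= /IH h].
  by rewrite mem_head.
by rewrite inE h orbT.
Qed.

Lemma size_bump c mu : size (bump c mu) = size mu.
Proof. by elim: mu => //= x mu IH; case: eqP => //= _; rewrite IH. Qed.

Lemma comp_run_head c mk P mu : comp_run ((c, mk) :: P) = Some mu -> c.+1 \in mu.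
Proof.
move=> /=; case: (comp_run P) => // nu; case: mk; last by case: ifP => // h [<-].
case: c => [[<-]|c]; first by rewrite mem_head.
by case: ifP => // h [<-]; apply: bump_mem.
Qed.

(** A deleted free letter of column [c] is always legal: the letter read just before it has left a
    part equal to [c.+1]. *)
Lemma comp_run_compress P : comp_run (compress P) = comp_run P.
Proof.
elim: P => //= -[c mk] P IH; case: ifP => /= [/andP[/negPf -> h]|_]; last by rewrite IH.
rewrite IH; case E : (comp_run P) => [mu|] //.
case: P E h {IH} => [|[c' mk'] P] // E /= /eqP e; subst c'.
by rewrite (comp_run_head E).
Qed.

Lemma comp_run_size P mu : comp_run P = Some mu -> count_mem (0%N, true) P = size mu.
Proof.
elim: P mu => [|[c mk] P IH] mu /=; first by move=> [<-].
case: (comp_run P) IH => // nu IH; rewrite (IH nu) //.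
case: mk; last by case: ifP => // _ [<-]; rewrite xpair_eqE andbF.
by case: c => [[<-]|c] //; case: ifP => // _ [<-]; rewrite size_bump.
Qed.

Definition ends_new (P : seq pletter) : bool := (P == [::]) || (last (0%N, true) P == (0%N, true)).

Lemma comp_run_ends P mu : comp_run P = Some mu -> ends_new P.
Proof.
elim: P mu => //= -[c mk] P IH mu; case E : (comp_run P) => [nu|] //.
case: P E IH => [|x P] E IH; last by move=> _; have := IH _ E.
move: E => [<-]; case: mk; last by [].
by case: c.
Qed.

(** * quasiLascoux polynomials as sums of glide polynomials *)

Section Expansion.

Variable n : nat.

Local Notation letter := ('I_n * (nat * bool))%type.
Local Notation gletter := ('I_n * bool)%type.
Local Notation state := 'X_{1..n}.

Definition advance (x : pletter) (pl : seq 'I_n) := if x == (0%N, true) then behead pl else pl.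

(** Dominance read from the small end of the word: each first-column anchor uses up one position of
    [pl], which it must not exceed. In a sorted word the letters before it then satisfy the same
    bound, the form that glides call for. *)
Fixpoint bounded (X : seq letter) (pl : seq 'I_n) : bool :=
  if X is (v, x) :: X' then
    if pl is p :: _ then (v <= p)%N && bounded X' (advance x pl) else false
  else pl == [::].

Lemma cnt_run X (b : state) t : run (@insertion n) X b ->
  cnt b 1 t = count (fun l : letter => (l.2 == (0%N, true)) && (l.1 < t)%N) X.
Proof.
elim=> [|v c p {}X {}b _ IH bp chb|v c p {}X {}b _ IH bp] /=.
- by apply: big1 => r _; rewrite mnm0E.
- rewrite cntD IH bp addnC; congr (_ + _)%N; case: c bp chb => [|c] //= _.
  by rewrite /insertion => /eqP ->.
- by rewrite IH xpair_eqE andbF.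
Qed.

Lemma cnt_nz (a : state) t : cnt a 1 t = count (fun p : 'I_n => (p < t)%N) (nz_positions a).
Proof.
rewrite /nz_positions count_filter -sum1_count big_enum_cond /cnt [LHS]big_mkcond [RHS]big_mkcond /=.
by apply: eq_bigr => r _; case: (r < t)%N => //; case: (0 < a r)%N.
Qed.

(** Two increasing lists of equal length compare entry by entry exactly when their counting
    functions do; [ends_new] makes the last letter use up the last position. *)
Lemma boundedP X pl : sorted (@ltl n) X -> ends_new (map snd X) ->
  sorted (fun i j : 'I_n => (i < j)%N) pl ->
  size pl = count_mem (0%N, true) (map snd X) ->
  reflect (forall t, (count (fun p : 'I_n => (p < t)%N) pl <=
    count (fun l : letter => (l.2 == (0%N, true)) && (l.1 < t)%N) X)%N) (bounded X pl).
Proof.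
elim: X pl => [|[v x] X IH] pl sX eX spl sz; first by case: pl spl sz => // _ _; apply: ReflectT.
have [sX1 mX] := sorted_cons_ltl sX.
have eX1 : ends_new (map snd X).
  by move: eX; rewrite /ends_new /=; case: (X) => //.
have pos : (0 < size pl)%N.
  have e : last x (map snd X) = (0%N, true) by apply/eqP.
  rewrite sz -has_count; apply/hasP; exists (0%N, true); last exact: eqxx.
  by rewrite -e mem_last.
case: pl spl sz pos => // p pl spl sz _.
have spl1 : sorted (fun i j : 'I_n => (i < j)%N) (advance x (p :: pl)).
  by rewrite /advance; case: ifP => // _; apply: path_sorted spl.
have sz1 : size (advance x (p :: pl)) = count_mem (0%N, true) (map snd X).
  by move: sz; rewrite /advance /=; case: eqP => /= _; lia.
have low q : q \in pl -> (p < q)%N.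
  move=> qpl; move: spl => /= /(order_path_min (leT := fun i j : 'I_n => (i < j)%N)).
  by move=> h; have /allP/(_ _ qpl) := h (fun (y x z : 'I_n) => @ltn_trans y x z).
apply: (iffP andP) => [[vp /(IH _ sX1 eX1 spl1 sz1) h] t|h].
  have := h t; rewrite /advance /=; case: eqP => _ /=; last by lia.
  case: (ltnP p t) => pt; last by lia.
  by rewrite (leq_ltn_trans vp pt); lia.
have vp : (v <= p)%N.
  have := h p.+1; rewrite /= ltnSn add1n => /(leq_ltn_trans (leq0n _)).
  case: (leqP v p) => // pv; have -> : (v < p.+1)%N = false by lia.
  rewrite andbF add0n -has_count => /hasP[l lX /andP[_ lp]].
  by have := mX _ lX; rewrite /ltl /= -val_eqE /=; lia.
split=> //; apply/(IH _ sX1 eX1 spl1 sz1) => t.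
have := h t; rewrite /advance /=; case: eqP => _ /=; last by lia.
case: (ltnP p t) => pt; first by rewrite (leq_ltn_trans vp pt); lia.
suff -> : count (fun p0 : 'I_n => (p0 < t)%N) pl = 0%N by [].
apply/eqP; rewrite -leqn0 leqNgt -has_count; apply/hasPn => q /low; lia.
Qed.

Lemma quasi_lascoux_gf_bounded (a : state) :
  gf (fun X => [/\ sorted (@ltl n) X, comp_run (map snd X) = Some (pos_part a) &
        bounded X (nz_positions a)]) (quasi_lascoux a).
Proof.
apply: gf_iff (quasi_lascoux_gf a) _ => X.
have B (b : state) : sorted (@ltl n) X -> run (@insertion n) X b -> pos_part b = pos_part a ->
    dominates b a <-> bounded X (nz_positions a).
  move=> sX rb pb; have e := run_comp sX rb.
  have P := @boundedP X (nz_positions a) sX (comp_run_ends e) (sorted_nz a) _.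
  rewrite (dominates_cnt pb); split=> [h|/P h t].
    apply/P; first by rewrite (comp_run_size e) pb pos_part_nz size_map.
    by move=> t; rewrite -cnt_nz -(cnt_run _ rb).
  rewrite cnt_nz (cnt_run _ rb); apply: h.
  by rewrite (comp_run_size e) pb pos_part_nz size_map.
split=> [[sX [b rb [db pb]]]|[sX e bX]].
  by split=> //; [rewrite (run_comp sX rb) pb | apply/(B b)].
by have [b rb pb] := comp_run_ex sX e; split=> //; exists b => //; split=> //; apply/(B b).
Qed.

(** [prev] is the column of the preceding letter when that letter is free; a letter of the same
    column then shares its box and is marked as joined, like a red entry. *)
Fixpoint encode (prev : option nat) (X : seq letter) : seq gletter :=
  if X is (v, (c, mk)) :: X' then
    (v, prev == Some c) :: encode (if mk then None else Some c) X'
  else [::].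

Definition joins (Y : seq gletter) : bool := ~~ unjoined Y.

(** Inverse of [encode] once the merged columns and marks [W] are known: a letter followed by a
    joined one must be free, in the column of the current box. *)
Fixpoint decode (W : seq pletter) (Y : seq gletter) : seq letter :=
  if Y is (v, _) :: Y' then
    if joins Y' then (v, ((head (0%N, true) W).1, false)) :: decode W Y'
    else (v, head (0%N, true) W) :: decode (behead W) Y'
  else [::].

Lemma joins_encode c mk X : joins (encode (if mk then None else Some c) X) =
  ~~ mk && follows c (map snd X).
Proof.
by case: X => [|[v [c' mk']] X]; rewrite ?andbF //= /joins /= negbK; case: mk => //=; rewrite eq_sym.
Qed.

Lemma encodeK p X : decode (compress (map snd X)) (encode p X) = X.
Proof.
elim: X p => [|[v [c mk]] X IH] p //=.
rewrite joins_encode; case: (boolP (_ && _)) => h; last by rewrite /= IH.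
rewrite IH; case/andP: h => /negPf -> h; congr ((_, (_, _)) :: _).
have := follows_compress c (map snd X); rewrite h.
by case: (compress _) => //= y s /eqP.
Qed.

(* The words [Y] such that [decode W Y] is sorted and bounded by [pl]. *)
Fixpoint coded (W : seq pletter) (pl : seq 'I_n) (Y : seq gletter) : bool :=
  if Y is (v, _) :: Y' then
    match W, pl with
    | x :: W', p :: _ => (v <= p)%N &&
      match Y' with
      | (v', true) :: _ => (v < v')%N && coded W pl Y'
      | (v', false) :: _ =>
          ((v < v')%N || ((v == v') && ((head x W').1 < x.1)%N)) && coded W' (advance x pl) Y'
      | [::] => coded W' (advance x pl) Y'
      end
    | _, _ => false
    end
  else (W == [::]) && (pl == [::]).

Lemma coded1 x W p pl v j : coded (x :: W) (p :: pl) [:: (v, j)] =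
  (v <= p)%N && ((W == [::]) && (advance x (p :: pl) == [::])).
Proof. by []. Qed.

Lemma coded_joined x W p pl v j v' Y :
  coded (x :: W) (p :: pl) [:: (v, j), (v', true) & Y] =
  [&& (v <= p)%N, (v < v')%N & coded (x :: W) (p :: pl) ((v', true) :: Y)].
Proof. by []. Qed.

Lemma coded_new x W p pl v j v' Y :
  coded (x :: W) (p :: pl) [:: (v, j), (v', false) & Y] =
  [&& (v <= p)%N, (v < v')%N || ((v == v') && ((head x W).1 < x.1)%N) &
    coded W (advance x (p :: pl)) ((v', false) :: Y)].
Proof. by []. Qed.

Lemma coded_encode p X pl :
  sorted (@ltl n) X && bounded X pl = coded (compress (map snd X)) pl (encode p X).
Proof.
elim: X p pl => [|[v [c mk]] X IH] p pl //.
have -> : encode p ((v, (c, mk)) :: X) =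
    (v, p == Some c) :: encode (if mk then None else Some c) X by [].
have -> : bounded ((v, (c, mk)) :: X) pl =
  (if pl is p0 :: _ then (v <= p0)%N && bounded X (advance (c, mk) pl) else false) by [].
have IH' := IH (if mk then None else Some c).
have -> : compress (map snd ((v, (c, mk)) :: X)) =
   if ~~ mk && follows c (map snd X) then compress (map snd X) else (c, mk) :: compress (map snd X) by [].
case: pl => [|q pl].
  rewrite andbF; case: ifP => h //=; by case: compress.
case: X IH IH' => [|[v' [c' mk']] X] IH IH'.
  by rewrite andbF [encode _ [::]]/= coded1.
have hF := follows_compress c' (map snd ((v', (c', mk')) :: X)).
rewrite [follows c' (map snd _)]/= eqxx in hF.
case E : (compress (map snd ((v', (c', mk')) :: X))) hF IH' => [//|y W] /eqP yc IH'.
have eX : encode (if mk then None else Some c) ((v', (c', mk')) :: X) =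
  (v', (if mk then None else Some c) == Some c') :: encode (if mk' then None else Some c') X by [].
rewrite eX in IH' *.
rewrite [sorted _ _]/= -/(sorted _ ((v', (c', mk')) :: X)).
have -> : follows c (map snd ((v', (c', mk')) :: X)) = (c' == c) by [].
case: ifP => [/andP[/negPf emk /eqP ecc]|h].
  rewrite emk ecc eqxx in IH' *; rewrite coded_joined -IH' /advance xpair_eqE andbF.
  by rewrite {1}/ltl /= ltnn andbF orbF; case: (v < v')%N; rewrite ?andbF //= andbCA.
have ej : ((if mk then None else Some c) == Some c') = false.
  by case: mk h {IH' eX} => //=; rewrite eq_sym.
rewrite ej in IH' *; rewrite coded_new -IH' {1}/ltl /= yc.
by rewrite -!andbA; do !bool_congr; rewrite andbCA.
Qed.

Lemma decodeK p W pl Y : compress W = W -> coded W pl Y ->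
  (Y != [::] -> joins Y = (p == Some (head (0%N, true) W).1)) ->
  encode p (decode W Y) = Y /\ compress (map snd (decode W Y)) = W.
Proof.
elim: Y p W pl => [|[v j] Y IH] p W pl eW.
  by case: W eW => //= x W eW /andP[].
case: W eW => [//|x W] eW; case: pl => [|q pl] //.
have [nx eW1] := compress_cons eW.
case: Y IH => [|[v' j'] Y] IH.
  rewrite coded1 => /and3P[_ /eqP -> _] /(_ isT) /=; rewrite /joins /= negbK => ->.
  by case: x {eW nx} => c mk /=; rewrite andbF.
have decE : decode (x :: W) ((v, j) :: (v', j') :: Y) =
    if j' then (v, (x.1, false)) :: decode (x :: W) ((v', j') :: Y)
    else (v, x) :: decode W ((v', j') :: Y).
  by rewrite [LHS]/= /joins /= negbK.
rewrite decE; case: j' IH decE => IH _.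
  rewrite coded_joined => /and3P[_ _ cY] /(_ isT) hj.
  have [|e1 e2] := IH (Some x.1) (x :: W) (q :: pl) eW cY.
    by rewrite /joins /= eqxx.
  have -> : encode p ((v, (x.1, false)) :: decode (x :: W) ((v', true) :: Y)) =
    (v, p == Some x.1) :: encode (Some x.1) (decode (x :: W) ((v', true) :: Y)) by [].
  move: (decode (x :: W) ((v', true) :: Y)) e1 e2 => D e1 e2.
  rewrite e1 -hj /joins /= negbK; split=> //.
  by rewrite -follows_compress e2 /= eqxx.
rewrite coded_new => /and3P[_ _ cY] /(_ isT) hj.
have [|e1 e2] := IH (if x.2 then None else Some x.1) W (advance x (q :: pl)) eW1 cY.
  move=> _; rewrite /joins /=; case: x nx {eW hj IH} cY => c [] //= nx.
  case: W nx {eW1} => [|y W] //= nx _; apply/esym/negbTE; apply: contra nx.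
  by move=> /eqP[->].
have -> : encode p ((v, x) :: decode W ((v', false) :: Y)) =
    (v, p == Some x.1) :: encode (if x.2 then None else Some x.1) (decode W ((v', false) :: Y)).
  by case: (x).
move: (decode W ((v', false) :: Y)) e1 e2 => D e1 e2.
rewrite e1 -hj /joins /= negbK; split=> //.
by rewrite -follows_compress e2 (negPf nx).
Qed.

(* Largest values allowed in the successive boxes: the bounds of [pl], lowered
   so as to increase strictly at every forced ascent of [W]. *)
Fixpoint box_bounds (W : seq pletter) (pl : seq 'I_n) : seq nat :=
  if W is x :: W' then
    let us := box_bounds W' (advance x pl) in
    let p : nat := if pl is p :: _ then nat_of_ord p else 0%N in
    (if W' is y :: _ then
       if (y.1 < x.1)%N then minn p (head 0%N us) else minn p (head 0%N us).-1
     else p) :: us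
  else [::].

(** Excludes the cases where the truncated predecessor in [box_bounds] would hide a forced ascent
    under the bound 0, or where [pl] does not have the right length. *)
Fixpoint feasible (W : seq pletter) (pl : seq 'I_n) : bool :=
  if W is x :: W' then
    [&& pl != [::], feasible W' (advance x pl) &
      if W' is y :: _ then (y.1 < x.1)%N || (0 < head 0%N (box_bounds W' (advance x pl)))%N
      else true]
  else pl == [::].

Lemma box_bounds_le W p pl : W != [::] -> (head 0%N (box_bounds W (p :: pl)) <= p)%N.
Proof.
case: W => // x [|y W] _ //.
rewrite [box_bounds _ _]/= [head _ _]/=; case: ifP => _; exact: geq_minl.
Qed.

Lemma box_boundsE x y W p pl : box_bounds [:: x, y & W] (p :: pl) =
  (if (y.1 < x.1)%N then minn p (head 0%N (box_bounds (y :: W) (advance x (p :: pl))))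
   else minn p (head 0%N (box_bounds (y :: W) (advance x (p :: pl)))).-1)
  :: box_bounds (y :: W) (advance x (p :: pl)).
Proof. by []. Qed.

Lemma feasibleE x y W p pl : feasible [:: x, y & W] (p :: pl) =
  feasible (y :: W) (advance x (p :: pl)) &&
  ((y.1 < x.1)%N || (0 < head 0%N (box_bounds (y :: W) (advance x (p :: pl))))%N).
Proof. by []. Qed.

Lemma box_bounds_cons x W pl : exists u us, box_bounds (x :: W) pl = u :: us /\
  us = box_bounds W (advance x pl).
Proof. by eexists; eexists; split; first reflexivity. Qed.

(* [x] is not in the first column, hence [advance] does not move. *)
Lemma box_bounds_same x y W p pl : (y.1 < x.1)%N ->
  head 0%N (box_bounds [:: x, y & W] (p :: pl)) =
  head 0%N (box_bounds (y :: W) (advance x (p :: pl))).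
Proof.
move=> lt; rewrite box_boundsE lt.
have -> : advance x (p :: pl) = p :: pl.
  by rewrite /advance; case: eqP => // e; rewrite e in lt.
exact/minn_idPr/(@box_bounds_le (y :: W)).
Qed.

(** Equal values in consecutive boxes are allowed only when the column drops, and then the two
    bounds coincide; otherwise the first bound is strictly smaller. So the strictness asked by
    [coded] is the one that [gvalid] reads off from the bounds. *)
Lemma coded_gvalid W pl Y : coded W pl Y -> gvalid (box_bounds W pl) Y /\ feasible W pl.
Proof.
elim: Y W pl => [|[v j] Y IH] W pl; first by move=> /andP[/eqP -> /eqP ->].
case: W => [//|x W]; case: pl => [//|p pl].
case: Y IH => [|[v' j'] Y] IH.
  by rewrite coded1 => /and3P[vp /eqP -> /eqP e]; rewrite /= vp e.
case: j' IH => IH.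
  rewrite coded_joined => /and3P[vp lt /IH[gY fe]]; split=> //.
  have [u [us [eu eus]]] := box_bounds_cons x W (p :: pl); rewrite eu in gY *.
  rewrite gvalid_joined lt gY !andbT; apply: leq_trans (ltnW lt) _.
  by case/andP: gY.
rewrite coded_new => /and3P[vp ord /IH[gY fe]].
case: W ord gY fe IH => [|y W] ord gY fe IH //.
have [u' [us' [eu' _]]] := box_bounds_cons y W (advance x (p :: pl)).
have vu' : (v' <= u')%N by rewrite eu' in gY; case/andP: gY.
have -> : feasible [:: x, y & W] (p :: pl) = (y.1 < x.1)%N || (0 < u')%N.
  by rewrite feasibleE fe eu'.
have vv : (v <= v')%N by case/orP: ord => [/ltnW //|/andP[/eqP -> _]].
case: (boolP (y.1 < x.1)%N) => yx; rewrite ?orbT ?orTb.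
  split=> //; have := box_bounds_same W p pl yx; rewrite box_boundsE yx eu'.
  rewrite ![head _ (_ :: _)]/= => ->; rewrite gvalid_new [head _ _]/= ltnn vv (leq_trans vv vu') /=.
  by rewrite eu' in gY.
have lt : (v < v')%N by move: ord; rewrite [head _ _]/= (negPf yx) andbF orbF.
split; last by apply: leq_ltn_trans (leq0n v) (leq_trans lt vu').
rewrite box_boundsE (negPf yx) eu' [head _ (_ :: us')]/= gvalid_new lt vv implybT.
rewrite eu' in gY; rewrite gY !andbT leq_min vp /=.
by rewrite -ltnS prednK ?(leq_trans lt vu') // (leq_ltn_trans (leq0n v)) // (leq_trans lt).
Qed.

Lemma gvalid_coded W pl Y : feasible W pl -> gvalid (box_bounds W pl) Y -> coded W pl Y.
Proof.
elim: Y W pl => [|[v j] Y IH] W pl.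
  by case: W => //= /eqP -> _; rewrite eqxx.
case: W => [//|x W]; case: pl => [//|p pl] fe.
have [u [us [eu eus]]] := box_bounds_cons x W (p :: pl).
have up : (u <= p)%N by have := @box_bounds_le (x :: W) p pl isT; rewrite eu.
rewrite eu; case: Y IH => [|[v' j'] Y] IH.
  rewrite gvalid1 coded1 => /andP[vu /eqP e]; rewrite (leq_trans vu up) /=.
  case: W fe eus {eu} => [|y W] fe eus; last by rewrite e in eus.
  by move: fe => /= /andP[-> _].
case: j' IH => IH.
  rewrite gvalid_joined coded_joined => /and3P[vu lt gY].
  by rewrite (leq_trans vu up) lt IH // eu.
rewrite gvalid_new coded_new => /and4P[vu vv imp gY].
rewrite (leq_trans vu up) andTb; case: W fe eu eus => [|y W] fe eu eus.
  by rewrite eus in gY.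
move: fe; rewrite feasibleE => /andP[fe pos].
rewrite (IH (y :: W)) -?eus // andbT.
have [u' [us' [eu' _]]] := box_bounds_cons y W (advance x (p :: pl)).
rewrite [head _ _]/=; case: (boolP (y.1 < x.1)%N) => yx.
  by rewrite andbT -val_eqE orbC -leq_eqVlt.
rewrite andbF orbF; move: imp => /implyP; apply.
move: pos; rewrite (negPf yx) eu' /= => u0.
move: eu; rewrite box_boundsE (negPf yx) eus eu' => -[eu].
by have := geq_minr p u'.-1; rewrite eu /=; lia.
Qed.

Lemma box_bounds_sorted W pl : feasible W pl ->
  sorted leq (box_bounds W pl) /\ all (fun u => (u < n)%N) (box_bounds W pl).
Proof.
elim: W pl => [|x W IH] pl // fe.
case: pl fe => [//|p pl]; case: W IH => [|y W] IH fe.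
  by rewrite /= ltn_ord.
move: fe; rewrite feasibleE => /andP[/IH[so al] _].
have le := @box_bounds_le [:: x, y & W] p pl isT.
have [u [us [eu eus]]] := box_bounds_cons x (y :: W) (p :: pl).
have [u' [us' [eu' _]]] := box_bounds_cons y W (advance x (p :: pl)).
have hu : (u <= u')%N.
  move: eu; rewrite box_boundsE eus eu' => -[<-] /=; case: ifP => _.
    exact: geq_minr.
  by apply: leq_trans (geq_minr _ _) (leq_pred _).
rewrite eu eus eu' /= in le so al *.
by rewrite hu so al (leq_ltn_trans le (ltn_ord p)).
Qed.

(** The index of the glide polynomial whose boxes are bounded by [us]. *)
Definition content (us : seq nat) : state := [multinom count_mem (i : nat) us | i < n].

Lemma bound_word_content us : sorted leq us -> all (fun u => (u < n)%N) us ->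
  bound_word (content us) (nz_positions (content us)) = us.
Proof.
move=> so al; apply: (sorted_eq leq_trans anti_leq) => //.
  rewrite (sorted_pairwise leq_trans).
  have := sorted_nz (content us); rewrite sorted_pairwise; last by move=> y x z; apply: ltn_trans.
  rewrite /bound_word; elim: (nz_positions _) => //= k ks IH /andP[/allP hk /IH {}IH].
  rewrite pairwise_cat IH andbT; apply/andP; split.
    apply/allrelP => y y' /nseqP[-> _] /flatten_mapP[k' /hk lt /nseqP[-> _]]; exact: ltnW.
  by elim: (content us k) => //= m ->; rewrite andbT; apply/allP => y /nseqP[-> _].
have W : bound_word (content us) (nz_positions (content us)) =
    flatten [seq nseq (content us k) (k : nat) | k <- enum 'I_n].
  rewrite /bound_word /nz_positions; elim: (enum 'I_n) => //= i s IH.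
  by case E : (content us i) => [|m] /=; rewrite ?E IH.
apply/allP => u _ /=; rewrite W count_flatten -map_comp sumnE big_map big_enum /=.
case: (ltnP u n) => un.
  rewrite (bigD1 (Ordinal un)) //= count_nseq mnmE /= eqxx mul1n big1 ?addn0 //.
  move=> k ne; rewrite count_nseq /=; case: eqP => // e; case/eqP: ne; exact/val_inj.
rewrite big1; last first.
  by move=> k _; rewrite count_nseq /=; case: eqP => // e; have := ltn_ord k; lia.
apply/eqP/esym/eqP; rewrite -leqn0 leqNgt -has_count; apply/hasPn => x /(allP al) xn.
by rewrite /=; apply/eqP; lia.
Qed.

Lemma mon_encode p X : gmon (encode p X) = mon X :> state.
Proof.
apply/mnmP => i; rewrite !mnmE; elim: X p => [|[v [c mk]] X IH] p //=.
by rewrite IH.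
Qed.

Definition pending (p : option nat) (P : seq pletter) := if p is Some c then follows c P else false.

(** Each free letter either survives merging or makes the next letter joined; [pending] accounts for
    a first letter joined to one before [X]. Hence the power of [beta] splits into a factor
    depending on the merged word and the excess of the glide. *)
Lemma free_encode p X :
  (count (fun l : letter => ~~ l.2.2) X + pending p (map snd X) =
  count (fun x : pletter => ~~ x.2) (compress (map snd X)) + count (fun y : gletter => y.2) (encode p X))%N.
Proof.
elim: X p => [|[v [c mk]] X IH] p; first by case: p.
have := IH (if mk then None else Some c); set Z := encode _ X => IH'.
have -> : encode p ((v, (c, mk)) :: X) = (v, p == Some c) :: Z by [].
have -> : compress (map snd ((v, (c, mk)) :: X)) =
   if ~~ mk && follows c (map snd X) then compress (map snd X) else (c, mk) :: compress (map snd X) by [].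
have -> : pending p (map snd ((v, (c, mk)) :: X)) = (p == Some c).
  by case: p => //= c0; rewrite eq_sym.
case: mk Z IH' => Z /= IH'; first by lia.
case: ifP IH' => _ /=; lia.
Qed.

Lemma wgt_encode (X : seq letter) : wgt X =
  ('X ^+ count (fun x : pletter => ~~ x.2) (compress (map snd X)) : {poly int}) *:
    gwgt (encode None X).
Proof.
rewrite /wgt /gwgt scalerA mon_encode -exprD; congr ('X ^+ _ *: _).
by have := free_encode None X; rewrite addn0.
Qed.

(** Words with the same merged columns and marks [W] correspond through [encode] to all glides of
    one weak composition; the free letters of [W] give the coefficient, a power of [beta]. *)
Lemma quasi_refines_glides : refines (@quasi_lascoux n) (@glide_poly n).
Proof.
apply: refines_intro => a.
have [l ul [hl ->]] := quasi_lascoux_gf_bounded a.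
set pl := nz_positions a in hl.
pose comp X := compress (map snd (X : seq letter)).
exists [seq ('X ^+ count (fun x : pletter => ~~ x.2) W, content (box_bounds W pl)) |
         W <- undup (map comp l)].
  by move=> x /mapP[W _ ->]; apply: nnegp_Xn.
rewrite big_map /=.
transitivity (\sum_(W <- undup (map comp l)) \sum_(X <- l) (if comp X == W then wgt X else 0)).
  rewrite exchange_big /= big_seq [RHS]big_seq; apply: eq_bigr => X Xl.
  rewrite (bigD1_seq (comp X)) ?undup_uniq ?mem_undup ?map_f //= eqxx big1 ?addr0 //.
  by move=> W /negPf; rewrite eq_sym => ->.
rewrite big_seq [RHS]big_seq; apply: eq_bigr => W; rewrite mem_undup => /mapP[X0 X0l eW].
rewrite -big_mkcond -big_filter.
have [s0 r0 b0] := (hl X0).1 X0l.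
have c0 : coded W pl (encode None X0) by rewrite eW -coded_encode s0 b0.
have [_ fe] := coded_gvalid c0; have [so al] := box_bounds_sorted fe.
have idW : compress W = W by rewrite eW; apply: compress_idem.
have [lG uG [hG ->]] := glide_poly_gf (content (box_bounds W pl)).
rewrite bound_word_content // in hG.
have pm : perm_eq (map (encode None) [seq X <- l | comp X == W]) lG.
  apply: uniq_perm => //.
    rewrite map_inj_in_uniq ?filter_uniq // => X X'; rewrite !mem_filter.
    move=> /andP[/eqP e _] /andP[/eqP e' _] eX.
    by rewrite -(encodeK None X) -(encodeK None X') eX -/(comp X) -/(comp X') e e'.
  move=> Y; rewrite hG; apply/mapP/andP => [[X]|[uY gY]].
    rewrite mem_filter => /andP[/eqP e /hl[sX rX bX]] ->; split.
      by case: (X) => [|[v [c mk]] X'].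
    have := coded_encode None X pl; rewrite sX bX -/(comp X) e => /esym cX.
    by case: (coded_gvalid cX).
  have cY := gvalid_coded fe gY.
  have [|e1 e2] := decodeK (p := None) idW cY; first by rewrite /joins uY.
  exists (decode W Y) => //.
  rewrite mem_filter /comp e2 eqxx /=; apply/hl.
  have := coded_encode None (decode W Y) pl; rewrite e1 e2 cY => /andP[sX bX].
  by split=> //; rewrite -comp_run_compress e2 eW comp_run_compress.
rewrite -(perm_big _ pm) big_map scaler_sumr big_seq [RHS]big_seq; apply: eq_bigr => X.
by rewrite mem_filter => /andP[/eqP e _]; rewrite wgt_encode -/(comp X) e.
Qed.

End Expansion.

Lemma beta0_quasi_lascoux n (a : 'X_{1..n}) : beta0 (quasi_lascoux a) = quasikey a.
Proof. by rewrite /beta0 /quasi_lascoux raddf_sum. Qed.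

Theorem theorem1p3 (n : nat) (n_ge1 : (1 <= n)%N) :
  [/\ is_basis (fun _ => True) (@quasi_lascoux n),
      is_basis (@quasisymmetric n {poly int})
        (fun alpha : {alpha : seq nat | is_comp n alpha} =>
           quasi_grothendieck n (val alpha)),
      forall f : {mpoly {poly int}[n]},
        (exists a : 'X_{1..n}, f = quasi_lascoux a) /\ quasisymmetric f
        <-> exists2 alpha : seq nat,
              is_comp n alpha & f = quasi_grothendieck n alpha,
      forall a : 'X_{1..n}, beta0 (quasi_lascoux a) = quasikey a
    & [/\ refines (@lascoux n) (@quasi_lascoux n),
          refines (@quasi_lascoux n) (@glide_poly n)
        & refines (@quasi_lascoux n) (@lascoux_atom n)]].
Proof.
split; [exact: quasi_basis|exact: qsym_basis|exact: quasi_cap_qsym|exact: beta0_quasi_lascoux|].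
split; [exact: lascoux_refines|exact: quasi_refines_glides|exact: quasi_refines_atoms].
Qed.
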